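(* Let $f$ be a uniformly continuous function on $\mathbb{B}$ and let $g$ be a bounded measurable function on $\mathbb{B}$. Then $T_{gf}-T_gT_f$ and $T_{gf}-T_fT_g$ are compact operators on $b^2_\nu$, $\sigma_e(T_f)=f(\mathbb{S})$, and $\|T_f\|_e=\sup\{|f(\zeta)|:\zeta\in\mathbb{S}\}$. In particular, $T_f$ is compact if and only if $f$ vanishes on $\mathbb{S}$.
   Context: Fix an integer $n\ge 2$. $\mathbb{B}$ is the open unit ball, $\bar{\mathbb{B}}$ the closed unit ball and $\mathbb{S}$ the unit sphere in $\mathbb{R}^n$; $|x|$ is the Euclidean norm. $\nu$ is a regular Borel probability measure on $\mathbb{B}$ that is invariant under the orthogonal group $O(n)$ and satisfies $\nu(\{x\in\mathbb{B}:|x|\ge r\})>0$ for all $0<r<1$. $L^2_\nu=L^2(\mathbb{B},\nu)$ (complex-valued functions), and $b^2_\nu$ is the closed subspace of $L^2_\nu$ consisting of the harmonic functions on $\mathbb{B}$ that belong to $L^2_\nu$. $Q:L^2_\nu\to b^2_\nu$ is the orthogonal projection. For a bounded measurable function $f$ on $\mathbb{B}$, the Toeplitz operator $T_f:b^2_\nu\to b^2_\nu$ is $T_fu=Q(fu)$. A uniformly continuous (complex-valued) function on $\mathbb{B}$ extends uniquely to a continuous function on $\bar{\mathbb{B}}$, also denoted $f$; $f(\mathbb{S})$ and $f(\zeta)$ for $\zeta\in\mathbb{S}$ refer to this extension. For a bounded operator $A$ on $b^2_\nu$, with $\mathcal{K}$ the ideal of compact operators in the algebra $\mathcal{B}(b^2_\nu)$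 of bounded operators, $\sigma_e(A)$ (essential spectrum) is the spectrum of $A+\mathcal{K}$ in $\mathcal{B}(b^2_\nu)/\mathcal{K}$ and $\|A\|_e$ (essential norm) is the norm of $A+\mathcal{K}$ in $\mathcal{B}(b^2_\nu)/\mathcal{K}$. *)

(* Defs.v *)
From HB Require Import structures.
From mathcomp Require Import all_boot all_order all_algebra.
From mathcomp Require Import complex.
From mathcomp Require Import all_classical all_reals all_analysis.
From mathcomp Require Import measurable_realfun.

Set Implicit Arguments.
Unset Strict Implicit.
Unset Printing Implicit Defensive.
Import Order.TTheory GRing.Theory Num.Theory Normc.
Import numFieldNormedType.Exports.
Local Open Scope classical_set_scope.
Local Open Scope complex_scope.
Local Open Scope ring_scope.

Section euclidean.
Context {R : realType} {n : nat}.
Local Notation E := 'rV[R]_n.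

(* The norm `|x| of the library on 'rV[R]_n is the sup norm; it induces the
   same topology as the Euclidean norm below. *)
Definition enorm (x : E) : R := Num.sqrt (\sum_i x ord0 i ^+ 2).

Definition unit_ball : set E := [set x | enorm x < 1].
Definition unit_sphere : set E := [set x | enorm x = 1].

Definition pderiv (i : 'I_n) (u : E -> R) : E -> R := 'D_(delta_mx ord0 i) u.

Definition C2_on (D : set E) (u : E -> R) := forall x, D x ->
  [/\ {for x, continuous u},
      (forall i, derivable u x (delta_mx ord0 i) /\
                 {for x, continuous (pderiv i u)}) &
      (forall i j, derivable (pderiv j u) x (delta_mx ord0 i) /\
                   {for x, continuous (pderiv i (pderiv j u))})].

Definition rharmonic_on (D : set E) (u : E -> R) :=
  C2_on D u /\ forall x, D x -> \sum_i pderiv i (pderiv i u) x = 0.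

Definition harmonic_on (D : set E) (u : E -> R[i]) :=
  rharmonic_on D (@complex.Re R \o u) /\ rharmonic_on D (@complex.Im R \o u).

Definition unif_continuous_on (D : set E) (f : E -> R[i]) :=
  forall e : R, 0 < e -> exists2 d : R, 0 < d &
    forall x y, D x -> D y -> enorm (x - y) < d -> normc (f x - f y) < e.

(* The continuous extension to the closed ball of a uniformly continuous
   function f on the open ball. *)
Definition ball_ext (f : E -> R[i]) (z : E) : R[i] :=
  lim ((f y : R[i]^o) @[y --> within unit_ball (nbhs z)]).

Lemma continuous_enorm : continuous enorm.
Proof.
have cs : continuous (fun x : E => \sum_i x ord0 i ^+ 2).
  apply: continuous_big => [|i _ y]; first exact: add_continuous.
  apply: (@continuous_comp _ _ _ (fun y : E => y ord0 i)
    (fun r : R => r ^+ 2)); first exact: coord_continuous.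
  exact: exprn_continuous.
move=> x; apply: (@continuous_comp _ _ _ _ (@Num.sqrt R)); first exact: cs.
exact: sqrt_continuous.
Qed.

Lemma open_unit_ball : open unit_ball.
Proof.
rewrite (_ : unit_ball = enorm @^-1` [set y | y < 1])//.
by apply: open_comp => [? _|]; [exact: continuous_enorm|exact: open_lt].
Qed.

Lemma rharmonic_on0 D : rharmonic_on D (fun=> 0).
Proof.
have d0 i : pderiv i (fun=> 0) = (fun=> 0).
  by apply/funext => x; rewrite /pderiv derive_cst.
split=> [x Dx|x Dx]; last by rewrite big1// => i _; rewrite !d0.
by split=> [|i|i j]; rewrite ?d0; first exact: cst_continuous;
  (split; [exact: derivable_cst|exact: cst_continuous]).
Qed.

Lemma rharmonic_onZD (D : set E) (c : R) u v : open D ->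
  rharmonic_on D u -> rharmonic_on D v -> rharmonic_on D (c \*: u + v).
Proof.
move=> oD [uC ul] [vC vl].
have lin (p q : E -> R) w x : derivable p x w -> derivable q x w ->
    derivable (c \*: p + q) x w /\
    'D_w (c \*: p + q) x = (c \*: ('D_w p) + 'D_w q) x.
  move=> dp dq; split; first exact/derivableD/dq/derivableZ.
  by rewrite deriveD ?deriveZ//; exact: derivableZ.
have lc (p q : E -> R) x : {for x, continuous p} -> {for x, continuous q} ->
    {for x, continuous (c \*: p + q)}.
  by move=> cp cq; apply: continuousD => //; exact: continuousZl_tmp.
have d1 i x : D x -> pderiv i (c \*: u + v) x =
                     (c \*: pderiv i u + pderiv i v) x.
  move=> Dx; have [_ du _] := uC x Dx; have [_ dv _] := vC x Dx.
  exact: (lin _ _ _ _ (du i).1 (dv i).1).2.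
have n1 i x : D x -> \forall y \near x, (c \*: pderiv i u + pderiv i v) y =
                                        pderiv i (c \*: u + v) y.
  by move=> Dx; near=> y; rewrite d1//; near: y; exact: open_nbhs_nbhs.
have d2 i j x : D x ->
    derivable (pderiv j (c \*: u + v)) x (delta_mx ord0 i) /\
    pderiv i (pderiv j (c \*: u + v)) x =
    (c \*: pderiv i (pderiv j u) + pderiv i (pderiv j v)) x.
  move=> Dx; have [_ _ du] := uC x Dx; have [_ _ dv] := vC x Dx.
  have [dl dE] := lin _ _ _ _ (du i j).1 (dv i j).1.
  split; first exact: near_eq_derivable (n1 j x Dx) dl.
  by rewrite -[RHS]dE; apply/esym/near_eq_derive/n1.
have n2 i j x : D x -> \forall y \near x,
    (c \*: pderiv i (pderiv j u) + pderiv i (pderiv j v)) y =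
    pderiv i (pderiv j (c \*: u + v)) y.
  by move=> Dx; near=> y; rewrite (d2 _ _ _ _).2//; near: y;
    exact: open_nbhs_nbhs.
have nc (p q : E -> R) x : (\forall y \near x, p y = q y) ->
    {for x, continuous p} -> {for x, continuous q}.
  move=> pq cp; rewrite /prop_for /continuous_at -(nbhs_singleton pq).
  exact: cvg_trans (near_eq_cvg pq) cp.
split=> [x Dx|x Dx].
  have [cu du ddu] := uC x Dx; have [cv dv ddv] := vC x Dx.
  split; first exact: lc.
    move=> i; split; first exact: (lin _ _ _ _ (du i).1 (dv i).1).1.
    by apply: nc (n1 i x Dx) _; apply: lc; [have [] := du i|have [] := dv i].
  move=> i j; split; first exact: (d2 _ _ _ Dx).1.
  by apply: nc (n2 i j x Dx) _; apply: lc; [have [] := ddu i j|have [] := ddv i j].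
under eq_bigr do rewrite (d2 _ _ _ Dx).2.
by rewrite big_split/= -scaler_sumr ul// vl// scaler0 addr0.
Unshelve. all: by end_near. Qed.

End euclidean.

Definition borel_rV (R : realType) (n : nat) :=
  g_sigma_algebraType (@open 'rV[R]_n).

Section measure_hypotheses.
Context {R : realType} {n : nat} (nu : probability (borel_rV R n) R).

(* A Borel probability measure on the unit ball is encoded as a Borel
   probability measure on 'rV[R]_n that gives mass 1 to the ball. *)
Definition carried_by_ball := nu unit_ball = 1%E.

Definition regular_on_ball := forall A : set 'rV[R]_n,
  measurable (A : set (borel_rV R n)) -> A `<=` unit_ball ->
  nu A = ereal_sup [set nu K | K in [set K : set 'rV[R]_n |
                                      compact K /\ K `<=` A]] /\
  nu A = ereal_inf [set nu U | U in [set U : set 'rV[R]_n |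
                                      [/\ open U, A `<=` U & U `<=` unit_ball]]].

Definition orthogonal_invariant := forall O : 'M[R]_n, O *m O^T = 1%:M ->
  forall A : set 'rV[R]_n, measurable (A : set (borel_rV R n)) ->
  nu [set x *m O | x in A] = nu A.

Definition charges_boundary := forall r : R, 0 < r < 1 ->
  (0 < nu [set x | unit_ball x /\ (r <= enorm x)%R])%E.

End measure_hypotheses.

Definition cmeasurable_on {R : realType} {n : nat} (D : set 'rV[R]_n)
    (h : 'rV[R]_n -> R[i]) :=
  measurable_fun (D : set (borel_rV R n)) (@complex.Re R \o h : borel_rV R n -> R) /\
  measurable_fun (D : set (borel_rV R n)) (@complex.Im R \o h : borel_rV R n -> R).

Definition bounded_on {R : realType} {n : nat} (D : set 'rV[R]_n)
    (h : 'rV[R]_n -> R[i]) :=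
  exists M : R, forall x, D x -> normc (h x) <= M.

Section bergman.
Context {R : realType} {n : nat} (nu : probability (borel_rV R n) R).
Local Notation E := 'rV[R]_n.

Definition L2norm (h : E -> R[i]) : \bar R :=
  'N[nu]_2%:E [(fun x => (normc (h x))%:E) : borel_rV R n -> \bar R].

Definition in_L2 (h : E -> R[i]) := cmeasurable_on setT h /\ (L2norm h < +oo)%E.

Definition inner (h k : E -> R[i]) : R[i] :=
  (\int[nu]_x complex.Re (h x * conjc (k x))) +i*
  (\int[nu]_x complex.Im (h x * conjc (k x))).

(* A function on the ball is encoded by its extension by zero, so that equality
   in b2 is equality of functions on the ball. *)
Definition is_b2 (u : E -> R[i]^o) :=
  [/\ harmonic_on unit_ball u, in_L2 u & forall x, ~ unit_ball x -> u x = 0].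

Definition b2_pred : {pred E -> R[i]^o} := mem [set u | is_b2 u].

Record b2 := B2 { b2_fun :> E -> R[i]^o; b2_funP : b2_fun \in b2_pred }.

HB.instance Definition _ := [isSub for b2_fun].
HB.instance Definition _ := [Choice of b2 by <:].


Lemma cmeasurable_normc h : cmeasurable_on setT h ->
  measurable_fun setT ((fun x => normc (h x)) : borel_rV R n -> R).
Proof.
move=> [mr mi].
rewrite (_ : (fun _ => _) = (@Num.sqrt R \o
    ((fun x => complex.Re (h x) ^+ 2) \+ (fun x => complex.Im (h x) ^+ 2))));
  last by apply/funext => x /=; case: (h x).
apply: measurableT_comp.
  by apply: continuous_measurable_fun; exact: sqrt_continuous.
by apply: measurable_funD; exact: measurable_funX.
Qed.

Lemma L2norm_fin h : (L2norm h < +oo)%E -> L2norm h \is a fin_num.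
Proof. by move=> hoo; rewrite ge0_fin_numE// Lnorm_ge0. Qed.

Lemma L2normE h : L2norm h = ((\int[nu]_x ((normc (h x)) `^ 2)%:E) `^ 2^-1)%E.
Proof.
rewrite /L2norm unlock /Lnorm; congr poweR; apply: eq_integral => x _ /=.
by rewrite ger0_norm//; case: (h x) => a b /=; exact: sqrtr_ge0.
Qed.

Lemma normc_ge0 (z : R[i]) : 0 <= normc z.
Proof. by case: z => a b /=; exact: sqrtr_ge0. Qed.

Lemma L2norm_triangle h k1 k2 : cmeasurable_on setT h ->
  cmeasurable_on setT k1 -> cmeasurable_on setT k2 ->
  (forall x, normc (h x) <= normc (k1 x) + normc (k2 x)) ->
  (L2norm h <= L2norm k1 + L2norm k2)%E.
Proof.
move=> mh mk1 mk2 hk.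
pose a (x : borel_rV R n) : R := normc (k1 x).
pose b (x : borel_rV R n) : R := normc (k2 x).
have ma : measurable_fun setT a by exact: cmeasurable_normc.
have mb : measurable_fun setT b by exact: cmeasurable_normc.
have ab : (L2norm h <= 'N[nu]_2%:E[EFin \o (a \+ b)%R])%E.
  rewrite L2normE unlock /Lnorm.
  apply: gt0_ler_poweR; rewrite ?invr_ge0 ?ler0n ?in_itv//= ?leey ?andbT.
  - by apply: integral_ge0 => x _; rewrite lee_fin powR_ge0.
  - by apply: integral_ge0 => x _; rewrite ?lee_fin ?powR_ge0 ?poweR_ge0.
  have mp (q : borel_rV R n -> R) : measurable_fun setT q ->
      measurable_fun setT (fun x => (q x `^ 2)%:E).
    move=> mq; apply/measurable_EFinP.
    by apply: (@measurableT_comp _ _ _ _ _ _ (@powR R ^~ 2)) => //;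
      exact: measurable_powR.
  apply: ge0_le_integral => //=.
  - by move=> x _; rewrite lee_fin powR_ge0.
  - by apply: mp; exact: cmeasurable_normc.
  - by apply: mp; apply: measurableT_comp => //; exact: measurable_funD.
  move=> x _; rewrite lee_fin ge0_ler_powR ?nnegrE ?normc_ge0 ?normr_ge0//.
  by rewrite ger0_norm ?addr_ge0 ?normc_ge0.
apply: (le_trans ab); apply: eminkowski => //.
by rewrite lee_fin ler1n.
Qed.

Lemma L2normZ (c : R[i]) h : cmeasurable_on setT h ->
  L2norm (fun x => c * h x) = ((normc c)%:E * L2norm h)%E.
Proof.
move=> mh; rewrite !L2normE.
under eq_integral do rewrite normcM powRM ?normc_ge0// EFinM.
rewrite ge0_integralZl//; last 3 first.
- apply/measurable_EFinP; apply: (@measurableT_comp _ _ _ _ _ _ (@powR R ^~ 2)).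
    exact: measurable_powR.
  exact: cmeasurable_normc.
- by move=> x _; rewrite lee_fin powR_ge0.
- by rewrite lee_fin powR_ge0.
rewrite poweRM ?lee_fin ?powR_ge0//; last first.
  by apply: integral_ge0 => x _; rewrite lee_fin powR_ge0.
by rewrite poweR_EFin -powRrM mulfV// powRr1// normc_ge0.
Qed.

Lemma cmeasurableZD (c : R[i]) h k :
  cmeasurable_on setT h -> cmeasurable_on setT k ->
  cmeasurable_on setT (fun x : E => c * h x + k x).
Proof.
move=> [mhr mhi] [mkr mki]; split.
  rewrite (_ : _ \o _ = ((cst (complex.Re c) \* (@complex.Re R \o h)) \-
    (cst (complex.Im c) \* (@complex.Im R \o h))) \+ (@complex.Re R \o k)).
    by apply: measurable_funD => //; apply: measurable_funB;
      apply: measurable_funM.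
  by apply/funext => x /=; case: c (h x) (k x) => [c d] [a b] [p q].
rewrite (_ : _ \o _ = ((cst (complex.Re c) \* (@complex.Im R \o h)) \+
  (cst (complex.Im c) \* (@complex.Re R \o h))) \+ (@complex.Im R \o k)).
  by apply: measurable_funD => //; apply: measurable_funD;
    apply: measurable_funM.
by apply/funext => x /=; case: c (h x) (k x) => [c d] [a b] [p q].
Qed.

Lemma in_L2_0 : in_L2 (fun=> 0).
Proof.
split; first by split; exact: measurable_cst.
rewrite L2normE; under eq_integral do rewrite normc0 powR0//.
by rewrite integral0 poweR0r// invr_neq0.
Qed.

Lemma in_L2_ZD c h k : in_L2 h -> in_L2 k -> in_L2 (fun x => c * h x + k x).
Proof.
move=> [mh hoo] [mk koo]; split; first exact: cmeasurableZD.
have mch : cmeasurable_on setT (fun x : E => c * h x).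
  rewrite (_ : (fun _ => _) = (fun x => c * h x + (fun=> 0) x)).
    exact: cmeasurableZD in_L2_0.1.
  by apply/funext => x; rewrite addr0.
apply: le_lt_trans (L2norm_triangle (cmeasurableZD c mh mk) mch mk _) _.
  by move=> x; exact: le_normcD.
by rewrite L2normZ// lte_add_pinfty// lte_mul_pinfty// lee_fin normc_ge0.
Qed.

Lemma b2_submod_closed : submod_closed b2_pred.
Proof.
split=> [|c u v].
  rewrite inE; split=> //; last exact: in_L2_0.
  by split; exact: rharmonic_on0.
have obB := @open_unit_ball R n.
rewrite !inE => -[[ur ui] uL u0] [[vr vi] vL v0]; split.
- split.
    rewrite (_ : _ \o _ = (complex.Re c \*: (@complex.Re R \o u)) +
      ((- complex.Im c) \*: (@complex.Im R \o u) + (@complex.Re R \o v))).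
      exact: (rharmonic_onZD _ obB ur (rharmonic_onZD _ obB ui vr)).
    apply/funext => x /=; rewrite !fctE /=.
    case: c (u x) (v x) => [c d] [a b] [p q] /=.
    by rewrite -[c *: a]/(c * a) -[- d *: b]/(- d * b) mulNr addrA.
  rewrite (_ : _ \o _ = (complex.Re c \*: (@complex.Im R \o u)) +
    (complex.Im c \*: (@complex.Re R \o u) + (@complex.Im R \o v))).
    exact: (rharmonic_onZD _ obB ui (rharmonic_onZD _ obB ur vi)).
  apply/funext => x /=; rewrite !fctE /=.
  case: c (u x) (v x) => [c d] [a b] [p q] /=.
  by rewrite -[c *: b]/(c * b) -[d *: a]/(d * a) addrA.
- exact: in_L2_ZD.
- by move=> x xB; rewrite !fctE u0// v0// scaler0 addr0.
Qed.

HB.instance Definition _ :=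
  GRing.isSubmodClosed.Build _ _ b2_pred b2_submod_closed.
HB.instance Definition _ := [SubChoice_isSubLmodule of b2 by <:].

Definition b2norm (u : b2) : R := fine (L2norm u).

Definition b2ball (u : b2) (e : R) : set b2 := [set v | b2norm (u - v) < e].

Lemma b2_in_L2 (u : b2) : in_L2 u.
Proof. by have := b2_funP u; rewrite inE => -[]. Qed.

Lemma b2normN (u : b2) : b2norm (- u) = b2norm u.
Proof.
rewrite /b2norm !L2normE; congr (fine (_ `^ _)%E); apply: eq_integral => x _.
by rewrite -[normc (u x)](normcN (u x)).
Qed.

Lemma b2normD (u v : b2) : b2norm (u + v) <= b2norm u + b2norm v.
Proof.
have [mu uoo] := b2_in_L2 u; have [mv voo] := b2_in_L2 v.
have [mw woo] := b2_in_L2 (u + v).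
rewrite -lee_fin EFinD !fineK ?L2norm_fin//.
by apply: L2norm_triangle => // x; exact: le_normcD.
Qed.

Lemma b2norm0 : b2norm 0 = 0.
Proof.
rewrite /b2norm L2normE; under eq_integral do rewrite normc0 powR0//.
by rewrite integral0 poweR0r// invr_neq0.
Qed.

Lemma b2ball_center u e : 0 < e -> b2ball u e u.
Proof. by move=> e0; rewrite /b2ball/= subrr b2norm0. Qed.

Lemma b2ball_sym u v e : b2ball u e v -> b2ball v e u.
Proof. by rewrite /b2ball/= -b2normN opprB. Qed.

Lemma b2ball_triangle u v w e1 e2 :
  b2ball u e1 v -> b2ball v e2 w -> b2ball u (e1 + e2) w.
Proof.
move=> uv vw; rewrite /b2ball/= (_ : u - w = (u - v) + (v - w)).
  by apply: le_lt_trans (b2normD _ _) _; exact: ltrD.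
by rewrite addrA subrK.
Qed.

(* The topology of b2 is that of the L^2 distance. Only the pseudometric structure
   is declared since separation depends on the properties of nu. *)
HB.instance Definition _ := hasNbhs.Build b2 (nbhs_ball_ b2ball).

Lemma b2_nbhsE : nbhs = nbhs_ (entourage_ b2ball).
Proof.
apply/funext => u; apply/seteqP; split=> A /=.
  move=> [e e0 uA]; exists [set xy | b2ball xy.1 e xy.2]; first by exists e.
  by move=> v /xsectionP/uA.
move=> [U [e e0 eU] UA]; exists e => // v uv.
by apply: UA; apply/xsectionP; exact: eU.
Qed.

HB.instance Definition _ := Nbhs_isPseudoMetric.Build R b2
  b2_nbhsE b2ball_center b2ball_sym b2ball_triangle erefl.

(* h - w is orthogonal to b2; xget selects the unique such w in b2, which exists
   for every h in L^2 when nu satisfies the hypotheses of the previous section. *)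
Definition orthoproj (h : E -> R[i]) : b2 :=
  xget 0 [set w : b2 | forall v : b2, inner (fun x => h x - w x) v = 0].

Definition toeplitz (f : E -> R[i]) (u : b2) : b2 :=
  orthoproj (fun x => f x * u x).

Definition bounded_operator (A : b2 -> b2) :=
  linear A /\ exists M : R, forall u, b2norm (A u) <= M * b2norm u.

Definition compact_operator (A : b2 -> b2) :=
  linear A /\ precompact [set A u | u in [set u | b2norm u <= 1]].

Definition op_norm (A : b2 -> b2) : R :=
  sup [set b2norm (A u) | u in [set u | b2norm u <= 1]].

(* A and B define the same element of the quotient of the bounded operators by
   the compact ones. *)
Definition eq_mod_compact (A B : b2 -> b2) :=
  compact_operator (fun u => A u - B u).

(* The coset of A is a unit of the quotient algebra. *)
Definition calkin_invertible (A : b2 -> b2) :=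
  exists S, [/\ bounded_operator S, eq_mod_compact (A \o S) id &
                eq_mod_compact (S \o A) id].

Definition essential_spectrum (A : b2 -> b2) : set R[i] :=
  [set l | ~ calkin_invertible (fun u => A u - l *: u)].

(* The norm of the coset of A in the quotient normed space. *)
Definition essential_norm (A : b2 -> b2) : R :=
  inf [set op_norm (fun u => A u + K u) | K in compact_operator].

End bergman.

Arguments toeplitz {R n} nu f u.

(* Main.v *)
(* The theorem reduces to the compactness of the Hankel operators u |-> (I - Q)(f u)
   for f uniformly continuous. The set of such f is an algebra closed under uniform limits,
   hence under absolute values and minima, and a uniformly continuous real function is a
   uniform limit of minima of quadratic polynomials; so the coordinates suffice. For
   these, let u be the Poisson integral of a density f on the sphere, the general case
   following by dilation. The Poisson kernel is 2 z . r(x - z) - |x - z|^(2 - n) with the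
   harmonic field r(y) = - y / |y|^n, and it gives x_j u = V - (1 - |x|^2) h with V the
   Poisson integral of z_j f and h that of f against r_j; moreover |h| <= C |u|. Hence
   (I - Q)(x_j u) = -(I - Q)((1 - |x|^2) h), and multiplication by a function vanishing
   at the boundary is compact on b^2, by interior estimates.

   The measure on the sphere used for Poisson integrals is the image of nu under
   x |-> x / |x|; its rotation invariance is all that is needed.

   For the spectrum and the essential norm, multiplication by a tent function at a boundary
   point z is not compact: otherwise, by rotations and compactness of the sphere, the
   identity would be compact, whereas the functions Re (x_1 + i x_2)^k are orthogonal.
   On the range of the tent, T_f is close to f(z). *)
Require Import Defs.
From HB Require Import structures.
From mathcomp Require Import all_boot all_order all_algebra.
From mathcomp Require Import complex ring lra.
From mathcomp Require Import all_classical all_reals all_analysis.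
From mathcomp Require Import measurable_realfun.

Set Implicit Arguments.
Unset Strict Implicit.
Unset Printing Implicit Defensive.
Import Order.TTheory GRing.Theory Num.Theory Normc.
Import numFieldNormedType.Exports.
Local Open Scope classical_set_scope.
Local Open Scope complex_scope.
Local Open Scope ring_scope.

(** * Integrals of bounded measurable functions *)

Section bounded_measurable.
Context {R : realType} {d : measure_display} {T : measurableType d}.

Definition bm (f : T -> R) :=
  measurable_fun setT f /\ exists M, forall x, `|f x| <= M.

Lemma bm_cst c : bm (fun=> c).
Proof. by split; [exact: measurable_cst|exists `|c|]. Qed.

Lemma bmD f g : bm f -> bm g -> bm (fun x => f x + g x).
Proof.
move=> [mf [M fM]] [mg [N gN]]; split; first exact: measurable_funD.
by exists (M + N) => x; rewrite (le_trans (ler_normD _ _))// lerD.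
Qed.

Lemma bmM f g : bm f -> bm g -> bm (fun x => f x * g x).
Proof.
move=> [mf [M fM]] [mg [N gN]]; split; first exact: measurable_funM.
by exists (M * N) => x; rewrite normrM ler_pM.
Qed.

Lemma bmN f : bm f -> bm (fun x => - f x).
Proof.
move=> /(bmM (bm_cst (-1))); rewrite (_ : (fun x => -1 * f x) = (fun x => - f x))//.
by apply/funext => x; rewrite mulN1r.
Qed.

Lemma bmB f g : bm f -> bm g -> bm (fun x => f x - g x).
Proof. by move=> bf bg; apply: bmD => //; exact: bmN. Qed.

Lemma bmX f k : bm f -> bm (fun x => f x ^+ k).
Proof.
move=> bf; elim: k => [|k IH]; first exact: bm_cst.
rewrite (_ : (fun x => _) = (fun x => f x * f x ^+ k)); first exact: bmM.
by apply/funext => x; rewrite exprS.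
Qed.

Lemma bm_abs f : bm f -> bm (fun x => `|f x|).
Proof.
move=> [mf [M fM]]; split; first exact: measurableT_comp.
by exists M => x; rewrite normr_id.
Qed.

Lemma bm_sum (I : finType) (f : I -> T -> R) : (forall i, bm (f i)) ->
  bm (fun x => \sum_i f i x).
Proof.
move=> bf; rewrite unlock; elim: (index_enum I) => [|i s IH] /=; first exact: bm_cst.
exact: bmD.
Qed.

Context {P : probability T R}.

Lemma bm_integrable f : bm f -> P.-integrable setT (EFin \o f).
Proof.
move=> [mf [M fM]]; apply: measurable_bounded_integrable => //.
  by apply: le_lt_trans (ltry 1); exact: probability_le1.
by exists M; split; [exact: num_real|move=> N /ltW MN x _; exact: le_trans MN].
Qed.

Local Notation I f := (\int[P]_x f x).

Lemma bm_intD f g : bm f -> bm g -> \int[P]_x (f x + g x) = I f + I g.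
Proof. by move=> bf bg; rewrite RintegralD//; exact: bm_integrable. Qed.

Lemma bm_intB f g : bm f -> bm g -> \int[P]_x (f x - g x) = I f - I g.
Proof. by move=> bf bg; rewrite RintegralB//; exact: bm_integrable. Qed.

Lemma bm_intZ c f : bm f -> \int[P]_x (c * f x) = c * I f.
Proof. by move=> bf; rewrite RintegralZl//; exact: bm_integrable. Qed.

Lemma bm_int_cst (c : R) : \int[P]_x c = c.
Proof.
have P1 : P setT = 1%E by exact: probability_setT.
by rewrite Rintegral_cst// [X in fine X]P1 mulr1.
Qed.

Lemma bm_int_sum (J : finType) (f : J -> T -> R) : (forall i, bm (f i)) ->
  \int[P]_x (\sum_i f i x) = \sum_i I (f i).
Proof.
move=> bf; rewrite unlock; elim: (index_enum J) => [|i s IH] /=.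
  exact: bm_int_cst.
rewrite -IH bm_intD//.
elim: s {IH} => [|j s IH] /=; [exact: bm_cst|exact: bmD].
Qed.

Lemma bm_int_le f g : bm f -> bm g -> (forall x, f x <= g x) -> I f <= I g.
Proof. by move=> bf bg fg; apply: le_Rintegral => //; exact: bm_integrable. Qed.

Lemma bm_int_abs f : bm f -> `|I f| <= \int[P]_x `|f x|.
Proof. by move=> bf; apply: le_normr_Rintegral => //; exact: bm_integrable. Qed.

Lemma bm_int_norm_le f M : bm f -> (forall x, `|f x| <= M) -> `|I f| <= M.
Proof.
move=> bf fM; apply: le_trans (bm_int_abs bf) _.
rewrite -(bm_int_cst M); apply: bm_int_le => //; first exact: bm_abs.
exact: bm_cst.
Qed.

Lemma bm_int_EFin f : bm f -> (\int[P]_x (f x)%:E)%E = (I f)%:E.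
Proof.
move=> bf; rewrite /Rintegral fineK//.
by apply: integrable_fin_num => //; exact: bm_integrable.
Qed.

Lemma bm_int_cs f g : bm f -> bm g ->
  (\int[P]_x (f x * g x)) ^+ 2 <= (\int[P]_x (f x ^+ 2)) * (\int[P]_x (g x ^+ 2)).
Proof.
move=> bf bg.
set a := (\int[P]_x (f x ^+ 2)); set b := (\int[P]_x (f x * g x)).
set c := (\int[P]_x (g x ^+ 2)).
have bff := bmX 2 bf; have bgg := bmX 2 bg; have bfg := bmM bf bg.
have q t : 0 <= a + 2 * t * b + t ^+ 2 * c.
  rewrite -/a -/b -/c -bm_intZ// -bm_intZ// -!bm_intD//;
    try (repeat (apply: bmD => //); by apply: bmM => //; exact: bm_cst).
  apply: Rintegral_ge0 => x _.
  rewrite (_ : _ + _ = (f x + t * g x) ^+ 2) ?sqr_ge0//; ring.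
have a0 : 0 <= a by apply: Rintegral_ge0 => x _; exact: sqr_ge0.
have : 0 <= c by apply: Rintegral_ge0 => x _; exact: sqr_ge0.
rewrite le_eqVlt => /predU1P[c0|c0].
  rewrite -c0 mulr0; have [->|b0] := eqVneq b 0; first by rewrite expr0n.
  have := q (- (a + 1) / (2 * b)); rewrite -c0 mulr0 addr0.
  rewrite (_ : 2 * (- (a + 1) / (2 * b)) * b = - (a + 1)); last by field.
  by rewrite opprD addrA subrr add0r oppr_ge0 ler10.
have := q (- b / c).
rewrite (_ : a + _ + _ = (a * c - b ^+ 2) / c); last first.
  by field; rewrite gt_eqF.
by rewrite pmulr_lge0 ?invr_gt0// subr_ge0.
Qed.

Lemma bm_lim (f : nat -> T -> R) g M : (forall n, measurable_fun setT (f n)) ->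
  (forall n x, `|f n x| <= M) -> (forall x, f n x @[n --> \oo] --> g x) -> bm g.
Proof.
move=> mf fM fg; split.
  by apply: (measurable_fun_cvg mf) => x _; exact: fg.
exists M => x.
rewrite -(cvg_lim (@norm_hausdorff _ _) (cvg_norm (fg x))).
apply: limr_le; first by apply: cvgP; apply: cvg_norm; exact: fg.
exact: nearW.
Qed.

Lemma bm_int_cvg (f : nat -> T -> R) g M : (forall n, measurable_fun setT (f n)) ->
  (forall n x, `|f n x| <= M) -> (forall x, f n x @[n --> \oo] --> g x) ->
  I (f n) @[n --> \oo] --> I g.
Proof.
move=> mf fM fg; have bg := bm_lim mf fM fg.
have bf n : bm (f n) by split => //; exists M.
apply: fine_cvg; rewrite -bm_int_EFin//.
apply: (@dominated_cvg _ _ _ P setT measurableT (fun n x => (f n x)%:E) _ (EFin \o (fun=> M))).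
- by move=> n; apply/measurable_EFinP.
- by move=> x _; apply: cvg_EFin; [exact: nearW|exact: fg].
- by [].
- by apply: bm_integrable; exact: bm_cst.
- by move=> n x _; rewrite lee_fin.
Qed.

End bounded_measurable.

Section fubini_bounded.
Context {R : realType} {d1 d2 : measure_display}
  {T1 : measurableType d1} {T2 : measurableType d2}
  {P1 : probability T1 R} {P2 : probability T2 R}.
Variable f : T1 * T2 -> R.
Hypothesis bf : bm f.

Lemma bm_sec1 x : bm (fun y => f (x, y)).
Proof.
have [mf [M fM]] := bf; split; last by exists M.
exact: measurableT_comp.
Qed.

Lemma bm_sec2 y : bm (fun x => f (x, y)).
Proof.
have [mf [M fM]] := bf; split; last by exists M.
exact: measurableT_comp.
Qed.

Let integ : (P1 \x P2)%E.-integrable setT (EFin \o f).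
Proof.
have [mf [M fM]] := bf.
apply: measurable_bounded_integrable => //.
  by apply: le_lt_trans (ltry 1); exact: (@probability_le1 _ _ _ (P1 \x P2)%E).
by exists M; split; [exact: num_real|move=> N /ltW MN x _; exact: le_trans MN].
Qed.

Lemma bm_int1 : bm (fun x => \int[P2]_y f (x, y)).
Proof.
have [mf [M fM]] := bf; split; last first.
  by exists M => x; apply: bm_int_norm_le; [exact: bm_sec1|].
apply/measurable_EFinP.
have := measurable_fubini_F integ; congr measurable_fun; apply/funext => x.
by rewrite /fubini_F /= bm_int_EFin//; exact: bm_sec1.
Qed.

Lemma bm_int2 : bm (fun y => \int[P1]_x f (x, y)).
Proof.
have [mf [M fM]] := bf; split; last first.
  by exists M => x; apply: bm_int_norm_le; [exact: bm_sec2|].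
apply/measurable_EFinP.
have := measurable_fubini_G integ; congr measurable_fun; apply/funext => x.
by rewrite /fubini_G /= bm_int_EFin//; exact: bm_sec2.
Qed.

Lemma bm_fubini :
  \int[P1]_x (\int[P2]_y f (x, y)) = \int[P2]_y (\int[P1]_x f (x, y)).
Proof.
apply: EFin_inj; rewrite -bm_int_EFin; last exact: bm_int1.
rewrite -bm_int_EFin; last exact: bm_int2.
transitivity (\int[P1]_x \int[P2]_y (EFin \o f) (x, y))%E.
  by apply: eq_integral => x _; rewrite -bm_int_EFin//; exact: bm_sec1.
rewrite (Fubini integ); apply: eq_integral => y _.
by rewrite -bm_int_EFin//; exact: bm_sec2.
Qed.

End fubini_bounded.

(** * Euclidean geometry *)

Section euclidean_norm.
Context {R : realType} {n : nat}.
Local Notation E := 'rV[R]_n.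
Implicit Types (x y z v : E) (O : 'M[R]_n).

Definition dot x y : R := \sum_i x ord0 i * y ord0 i.

Lemma dotC x y : dot x y = dot y x.
Proof. by apply: eq_bigr => i _; rewrite mulrC. Qed.

Lemma dotDl x y z : dot (x + y) z = dot x z + dot y z.
Proof. by rewrite -big_split; apply: eq_bigr => i _; rewrite mxE mulrDl. Qed.

Lemma dotZl (a : R) x y : dot (a *: x) y = a * dot x y.
Proof. by rewrite mulr_sumr; apply: eq_bigr => i _; rewrite mxE mulrA. Qed.

Lemma dotNl x y : dot (- x) y = - dot x y.
Proof. by rewrite -scaleN1r dotZl mulN1r. Qed.

Lemma dotBl x y z : dot (x - y) z = dot x z - dot y z.
Proof. by rewrite dotDl dotNl. Qed.

Lemma dotDr x y z : dot z (x + y) = dot z x + dot z y.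
Proof. by rewrite dotC dotDl !(dotC z). Qed.

Lemma dotZr (a : R) x y : dot x (a *: y) = a * dot x y.
Proof. by rewrite dotC dotZl dotC. Qed.

Lemma dotBr x y z : dot z (x - y) = dot z x - dot z y.
Proof. by rewrite dotC dotBl !(dotC z). Qed.

Lemma dot_ge0 x : 0 <= dot x x.
Proof. by apply: sumr_ge0 => i _; rewrite -expr2 sqr_ge0. Qed.

Lemma enorm_ge0 x : 0 <= enorm x.
Proof. exact: sqrtr_ge0. Qed.

Lemma enorm_sqr x : enorm x ^+ 2 = dot x x.
Proof.
rewrite sqr_sqrtr; first by apply: eq_bigr => i _; rewrite expr2.
by apply: sumr_ge0 => i _; exact: sqr_ge0.
Qed.

Lemma enormE x : enorm x = Num.sqrt (dot x x).
Proof. by rewrite -enorm_sqr sqrtr_sqr ger0_norm// enorm_ge0. Qed.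

Lemma dot_eq0 x : (dot x x == 0) = (x == 0).
Proof.
apply/idP/eqP => [|->]; last first.
  by rewrite /dot big1// => i _; rewrite mxE mul0r.
rewrite psumr_eq0 => [/allP h|i _]; last by rewrite -expr2 sqr_ge0.
apply/rowP => i; rewrite mxE; have := h i; rewrite mem_index_enum.
by move=> /(_ isT) /=; rewrite mulf_eq0 orbb => /eqP.
Qed.

Lemma enorm_eq0 x : (enorm x == 0) = (x == 0).
Proof. by rewrite -dot_eq0 -enorm_sqr sqrf_eq0. Qed.

Lemma enorm0 : enorm (0 : E) = 0.
Proof. by apply/eqP; rewrite enorm_eq0. Qed.

Lemma enorm_gt0 x : (0 < enorm x) = (x != 0).
Proof. by rewrite lt0r enorm_eq0 enorm_ge0 andbT. Qed.

Lemma enormZ (a : R) x : enorm (a *: x) = `|a| * enorm x.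
Proof.
by rewrite !enormE dotZl dotZr mulrA -expr2 sqrtrM ?sqr_ge0// sqrtr_sqr.
Qed.

Lemma enormN x : enorm (- x) = enorm x.
Proof. by rewrite -scaleN1r enormZ normrN1 mul1r. Qed.

Lemma enormB x y : enorm (x - y) = enorm (y - x).
Proof. by rewrite -enormN opprB. Qed.

Lemma dot_cs x y : `|dot x y| <= enorm x * enorm y.
Proof.
rewrite -(@ler_pXn2r _ 2)// ?nnegrE ?mulr_ge0 ?enorm_ge0// exprMn !enorm_sqr.
rewrite real_normK ?num_real//.
have [->|y0] := eqVneq y 0.
  by rewrite (_ : dot x 0 = 0) ?expr0n ?mulr_ge0 ?dot_ge0// dotC -(scale0r 0) dotZl mul0r.
have yy : 0 < dot y y by rewrite lt0r dot_ge0 dot_eq0 y0.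
have := dot_ge0 (x - (dot x y / dot y y) *: y).
rewrite dotBl !dotBr !dotZl !dotZr (dotC y x).
rewrite (_ : _ - _ = (dot x x * dot y y - dot x y ^+ 2) / dot y y); last first.
  by field; rewrite gt_eqF.
by rewrite pmulr_lge0 ?invr_gt0// subr_ge0.
Qed.

Lemma enormD x y : enorm (x + y) <= enorm x + enorm y.
Proof.
rewrite -(@ler_pXn2r _ 2)// ?nnegrE ?addr_ge0 ?enorm_ge0//.
rewrite sqrrD !enorm_sqr dotDl !dotDr (dotC y x).
have := dot_cs x y; have := ler_norm (dot x y); rewrite mulr2n; lra.
Qed.

Lemma enorm_dist x y : `|enorm x - enorm y| <= enorm (x - y).
Proof.
rewrite ler_norml; apply/andP; split.
  by have := enormD (y - x) x; rewrite subrK (enormB y x); lra.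
by have := enormD (x - y) y; rewrite subrK; lra.
Qed.

Lemma coord_le x i : `|x ord0 i| <= enorm x.
Proof.
rewrite -(@ler_pXn2r _ 2)// ?nnegrE ?enorm_ge0// real_normK ?num_real// enorm_sqr.
by rewrite /dot (bigD1 i)//= expr2 lerDl sumr_ge0// => j _; rewrite -expr2 sqr_ge0.
Qed.

Lemma mx_norm_le_enorm x : `|x| <= enorm x.
Proof.
have [x0|] := eqVneq (mx_norm x) 0; first by rewrite [leLHS]x0 enorm_ge0.
move=> /mx_norm_neq0[[i j]] /= h; rewrite [leLHS]h.
by rewrite (ord1 i) coord_le.
Qed.

Lemma nbhs_enorm x (A : set E) :
  nbhs x A <-> exists2 e : R, 0 < e & forall y, enorm (x - y) < e -> A y.
Proof.
split.
  move=> /nbhs_normP[e /= e0 eA]; exists e => // y xy; apply: eA.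
  exact: le_lt_trans (mx_norm_le_enorm _) xy.
move=> [e e0 eA].
have c : {for x, continuous (fun y => enorm (x - y))}.
  apply: (@continuous_comp _ _ _ (fun y => x - y) enorm).
    by apply: continuousB; [exact: cst_continuous|].
  exact: continuous_enorm.
have : \forall y \near x, enorm (x - y) < e.
  have /cvgr_lt := c; apply.
  by rewrite subrr enorm0.
exact: filterS.
Qed.

Lemma enorm_delta i : enorm (delta_mx ord0 i : E) = 1.
Proof.
apply/eqP; rewrite -(@eqrXn2 _ 2)// ?enorm_ge0// expr1n enorm_sqr /dot.
rewrite (bigD1 i)//= big1 ?addr0.
  by rewrite mxE !eqxx mulr1.
by move=> j ji; rewrite mxE (negbTE ji) andbF mul0r.
Qed.

Lemma mul_mx_dot x y : x *m y^T = (dot x y)%:M.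
Proof.
apply/matrixP => i j; rewrite !ord1 !mxE eqxx mulr1n; apply: eq_bigr => k _.
by rewrite mxE.
Qed.

Lemma dot_orth O x y : O *m O^T = 1%:M -> dot (x *m O) (y *m O) = dot x y.
Proof.
move=> OO; have := mul_mx_dot (x *m O) (y *m O).
rewrite trmx_mul mulmxA -(mulmxA x) OO mulmx1 mul_mx_dot.
by move=> /matrixP/(_ ord0 ord0); rewrite !mxE eqxx !mulr1n.
Qed.

Lemma enorm_orth O x : O *m O^T = 1%:M -> enorm (x *m O) = enorm x.
Proof. by move=> OO; rewrite !enormE dot_orth. Qed.

Lemma orth_tr O : O *m O^T = 1%:M -> O^T *m O = 1%:M.
Proof. exact: mulmx1C. Qed.

Lemma orth_transitive x y : enorm x = enorm y ->
  exists2 O, O *m O^T = 1%:M & x *m O = y.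
Proof.
move=> xy; have {}xy : dot x x = dot y y by rewrite -!enorm_sqr xy.
have [->|nxy] := eqVneq x y.
  by exists 1%:M; rewrite ?trmx1 mulmx1.
pose v := x - y; pose c := 2 / dot v v.
have vv0 : dot v v != 0 by rewrite dot_eq0 subr_eq0.
exists (1%:M - c *: (v^T *m v)).
  have -> : (1%:M - c *: (v^T *m v))^T = 1%:M - c *: (v^T *m v).
    by apply/matrixP => i j; rewrite !mxE eq_sym; congr (_ - _ * _); apply: eq_bigr => k _; rewrite !mxE mulrC.
  have : (v^T *m v) *m (v^T *m v) = dot v v *: (v^T *m v).
    by rewrite mulmxA -(mulmxA v^T v) mul_mx_dot -(mulmxA v^T) mul_scalar_mx -scalemxAr.
  move: (v^T *m v) => A AA.
  rewrite mulmxBl !mulmxBr !mulmx1 !mul1mx -scalemxAl -scalemxAr AA !scalerA.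
  have -> : c * c * dot v v = c + c by rewrite /c; field.
  by rewrite scalerDl opprB addrK subrK.
rewrite mulmxBr mulmx1 -scalemxAr mulmxA mul_mx_dot mul_scalar_mx scalerA.
have -> : c * dot x v = 1.
  rewrite /c; apply: (mulIf vv0); rewrite mulrAC mulfVK// mul1r.
  rewrite /v !dotBl !dotBr (dotC y x) -xy; ring.
by rewrite scale1r subKr.
Qed.

Lemma compact_closed_ball (r : R) : compact [set x : E | enorm x <= r].
Proof.
apply: bounded_closed_compact.
  exists r; split; first exact: num_real.
  by move=> s rs x /= xr; rewrite (le_trans (mx_norm_le_enorm _))// (le_trans xr)// ltW.
rewrite (_ : mkset _ = enorm @^-1` [set y | y <= r])//.
by apply: closed_comp => [? _|]; [exact: continuous_enorm|exact: closed_le].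
Qed.

Lemma compact_sphere (r : R) : compact [set x : E | enorm x = r].
Proof.
apply: (subclosed_compact _ (@compact_closed_ball r)); last by move=> x /= ->.
rewrite (_ : mkset _ = enorm @^-1` [set r])//.
by apply: closed_comp => [? _|]; [exact: continuous_enorm|exact: closed_eq].
Qed.

Lemma compact_net (K : set E) (e : R) : compact K -> 0 < e ->
  exists s : seq E, (forall x, x \in s -> K x) /\
    forall x, K x -> exists2 y, y \in s & enorm (x - y) < e.
Proof.
rewrite compact_cover => cK e0.
have [|x Kx|s sK Ks] := cK E K (fun y => [set x | enorm (x - y) < e]).
- move=> y _; rewrite (_ : mkset _ = (fun x => enorm (x - y)) @^-1` [set z | z < e])//.
  apply: open_comp => [x _|]; last exact: open_lt.
  apply: (@continuous_comp _ _ _ (fun x => x - y) enorm).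
    by apply: continuousB; [|exact: cst_continuous].
  exact: continuous_enorm.
- by exists x => //=; rewrite subrr enorm0.
exists (finmap.enum_fset s); split=> [x xs|x /Ks[y ys yx]].
  by have := sK x xs; rewrite inE.
by exists y.
Qed.

Lemma continuous_enormP (f : E -> R) x : {for x, continuous f} <->
  forall e : R, 0 < e ->
    exists2 d : R, 0 < d & forall y, enorm (x - y) < d -> `|f x - f y| < e.
Proof.
split=> [h e e0|h].
  have h' : f y @[y --> x] --> f x by exact: h.
  have := pseudometric_normed_Zmodule.cvgr_dist_lt (FF := nbhs_filter x) _ _ h' _ e0.
  by move=> /nbhs_enorm.
apply/(@pseudometric_normed_Zmodule.cvgrPdist_lt _ _ _ (nbhs x) (nbhs_filter x)) => e e0.
exact/nbhs_enorm/h.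
Qed.

Lemma measurable_open (A : set E) : open A -> measurable (A : set (borel_rV R n)).
Proof. exact: sub_sigma_algebra. Qed.

Lemma continuous_on_measurable (D : set E) (f : E -> R) : open D ->
  (forall x, D x -> {for x, continuous f}) ->
  measurable_fun (D : set (borel_rV R n)) (f : borel_rV R n -> R).
Proof.
move=> oD cf; apply: (measurability _ (@RGenOInfty.measurableE R)) => /= _ [_ [a ->] <-].
apply: measurable_open; rewrite openE => x [Dx fx].
rewrite /= in_itv /= andbT in fx.
have cx : f y @[y --> x] --> f x by exact: cf.
have fy : \forall y \near x, a < f y := cvgr_gt (FF := nbhs_filter x) _ cx _ fx.
have : \forall y \near x, D y by exact: open_nbhs_nbhs.
apply: (@filterS2 _ _ (nbhs_filter x) _ _ _ _ fy) => y fy' Dy; by split=> //=; rewrite in_itv /= andbT.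
Qed.

Lemma continuous_measurable (f : E -> R) : continuous f ->
  measurable_fun setT (f : borel_rV R n -> R).
Proof. by move=> cf; apply: continuous_on_measurable => [|x _]; [exact: openT|exact: cf]. Qed.

Lemma measurable_enorm : measurable_fun setT (enorm : borel_rV R n -> R).
Proof. exact: continuous_measurable continuous_enorm. Qed.

End euclidean_norm.

(** * Derivatives and harmonic functions *)

Section derivatives.
Context {R : realType}.

Lemma is_derive_epsP (V : normedModType R) (f : V -> R) x v (d : R) :
  is_derive x v f d <-> forall e : R, 0 < e -> exists2 r : R, 0 < r &
    forall h : R, h != 0 -> `|h| < r -> `|d - h^-1 * (f (h *: v + x) - f x)| <= e.
Proof.
pose q := fun h : R => h^-1 *: (f (h *: v + x) - f x).
have qE : is_derive x v f d <-> q h @[h --> 0^'] --> d.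
  split=> [[dv <-] //|qd]; split; first by apply/cvg_ex; exists d.
  exact/cvg_lim.
apply: iff_trans qE _; split=> [/cvgrPdist_le h e e0|h].
  have [r /= r0 hr] := h e e0; exists r => // k k0 kr.
  by apply: hr => //=; rewrite sub0r normrN.
apply/cvgrPdist_le => e /h[r r0 hr]; exists r => //= k /=; rewrite sub0r normrN => kr k0.
exact: hr.
Qed.

Lemma is_derive_line (V : normedModType R) (f : V -> R) x v (d : R) :
  is_derive x v f d <-> is_derive (0 : R) 1 (fun t : R => f (t *: v + x)) d.
Proof.
apply: iff_trans (is_derive_epsP _ _ _ _) _; apply: iff_sym.
apply: iff_trans (is_derive_epsP _ _ _ _) _.
by split=> h e /h[r r0 hr]; exists r => // k k0 kr; have := hr k k0 kr;
  rewrite -[k *: (1 : R)]/(k * 1) mulr1 addr0 scale0r add0r.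
Qed.

Lemma is_derive_lineS (V : normedModType R) (f : V -> R) x v (d s : R) :
  is_derive (s *: v + x) v f d -> is_derive s 1 (fun t : R => f (t *: v + x)) d.
Proof.
move=> /is_derive_epsP h; apply/is_derive_epsP => e /h[r r0 hr].
exists r => // k k0 kr; have := hr k k0 kr.
by rewrite -[k *: (1 : R)]/(k * 1) mulr1 addrA -scalerDl.
Qed.

Lemma is_derive_continuous (f : R -> R) (x d : R) : is_derive x 1 f d -> {for x, continuous f}.
Proof. by move=> [/derivable1_diffP /differentiable_continuous]. Qed.

Lemma mvt_line (V : normedModType R) (f f1 : V -> R) x v :
  (forall s : R, 0 <= s <= 1 -> is_derive (s *: v + x) v f (f1 (s *: v + x))) ->
  exists2 s : R, 0 <= s <= 1 & f (v + x) - f x = f1 (s *: v + x).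
Proof.
move=> df; have d1 (s : R) : 0 <= s <= 1 ->
    is_derive s 1 (fun t : R => f (t *: v + x)) (f1 (s *: v + x)).
  by move=> /df; exact: is_derive_lineS.
have [|||s] := @MVT_segment R (fun t : R => f (t *: v + x)) (fun s => f1 (s *: v + x)) 0 1.
- exact: ler01.
- by move=> s; rewrite in_itv /= => /andP[/ltW s0 /ltW s1]; apply: d1; rewrite s0.
- apply: continuous_in_subspaceT => s; rewrite inE /= in_itv /= => /d1.
  exact: is_derive_continuous.
rewrite in_itv /= => s01; rewrite scale1r scale0r add0r subr0 mulr1 => fE.
by exists s.
Qed.

Lemma second_derivative_max (f f1 : R -> R) (d r : R) : 0 < r ->
  (forall t : R, `|t| < r -> is_derive t 1 f (f1 t)) ->
  is_derive (0 : R) 1 f1 d -> (forall t : R, `|t| < r -> f t <= f 0) -> d <= 0.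
Proof.
move=> r0 df /is_derive_epsP df1 fmax; rewrite leNgt; apply/negP => d0.
have f10 : f1 0 = 0.
  have [_ fd] : is_derive (0 : R) 1 f 0.
    apply: (@derive1_at_max R f (- r) r 0).
    - by rewrite ge0_cp// ltW.
    - by move=> t; rewrite in_itv /= -ltr_norml => /df[].
    - by rewrite in_itv /= oppr_lt0 r0.
    - by move=> t; rewrite in_itv /= -ltr_norml => /fmax.
  have : is_derive (0 : R) 1 f (f1 0) by apply: df; rewrite normr0.
  by case=> _ <-.
have [s s0 hs] := df1 (d / 2) (divr_gt0 d0 (ltr0n _ 2)).
pose t := Num.min s r / 2.
have m0 : 0 < Num.min s r by rewrite lt_min s0.
have t0 : 0 < t by rewrite divr_gt0.
have ts : t < s by rewrite (@lt_le_trans _ _ (Num.min s r)) ?ge_min ?lexx// /t ltr_pdivrMr// ltr_pMr// ltr1n.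
have tr : t < r by rewrite (@lt_le_trans _ _ (Num.min s r)) ?ge_min ?lexx ?orbT// /t ltr_pdivrMr// ltr_pMr// ltr1n.
have pos u : 0 < u <= t -> 0 < f1 u.
  move=> /andP[u0 ut]; have := hs u (lt0r_neq0 u0).
  rewrite gtr0_norm// (le_lt_trans ut)// => /(_ isT).
  rewrite -[u *: (1 : R)]/(u * 1) mulr1 addr0 f10 subr0 ler_norml => /andP[_].
  rewrite lerBlDl -lerBlDr (_ : d - d / 2 = d / 2); last by field.
  move=> h; have : 0 < u^-1 * f1 u by apply: lt_le_trans h; rewrite divr_gt0.
  by rewrite pmulr_rgt0// invr_gt0.
have [||u] := @MVT R f f1 0 t t0.
- move=> u; rewrite in_itv /= => /andP[u0 ut]; apply: df.
  by rewrite gtr0_norm// (lt_trans ut).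
- apply: continuous_in_subspaceT => u; rewrite inE /= in_itv /= => /andP[u0 ut].
  by apply: is_derive_continuous (df u _); rewrite ger0_norm// (le_lt_trans ut).
rewrite in_itv /= => /andP[u0 ut] fE.
have : 0 < f t - f 0 by rewrite fE mulr_gt0 ?subr0// pos// u0 ltW.
by rewrite subr_gt0 ltNge fmax// gtr0_norm.
Qed.

Lemma is_derive_comp1 (V : normedModType R) (f : V -> R) (g : R -> R) x v (d e : R) :
  is_derive x v f d -> is_derive (f x) 1 g e -> is_derive x v (g \o f) (e * d).
Proof.
move=> /is_derive_line df dg; apply/is_derive_line.
have dg' : is_derive (f ((0 : R) *: v + x)) 1 g e by rewrite scale0r add0r.
exact: (is_derive1_comp dg' df).
Qed.

Lemma is_derive_ext (V : normedModType R) (f g : V -> R) x v d e :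
  is_derive x v f d -> f =1 g -> d = e -> is_derive x v g e.
Proof. by move=> df /funext <- <-. Qed.

End derivatives.

Section compact_uniform.
Context {R : realType} {n : nat}.
Local Notation E := 'rV[R]_n.

Lemma compact_unif_cont (A : set E) (g : E -> R) : compact A ->
  (forall x, A x -> {for x, continuous g}) -> forall e : R, 0 < e ->
  exists2 d : R, 0 < d & forall y, A y -> forall z, enorm (y - z) < d -> `|g y - g z| < e.
Proof.
move=> /compact_near_coveringP cA cg e e0.
pose P (d : R) (y : E) := forall z, enorm (y - z) < d -> `|g y - g z| < e.
have := cA R (0^'+)%R P _.
case=> [x Ax|d /= d0 hd].
  have /continuous_enormP/(_ (e / 2) (divr_gt0 e0 (ltr0n _ 2)))[d d0 hd] := cg x Ax.
  exists ([set y | enorm (x - y) < d / 2], [set t : R | t < d / 2]).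
    split=> /=; first by apply/nbhs_enorm; exists (d / 2) => //; rewrite divr_gt0.
    by apply: nbhs_right_lt; rewrite divr_gt0.
  move=> [y t] /= [xy td] z yz.
  rewrite (_ : g y - g z = (g y - g x) + (g x - g z)); last by rewrite addrA subrK.
  rewrite (le_lt_trans (ler_normD _ _))// (splitr e) ltrD//.
    by rewrite distrC hd// (lt_trans xy)// ltr_pdivrMr// ltr_pMr// ltr1n.
  apply: hd; rewrite (_ : x - z = (x - y) + (y - z)); last by rewrite addrA subrK.
  by rewrite (le_lt_trans (enormD _ _))// (splitr d) ltrD// (lt_trans yz).
exists (d / 2); first by rewrite divr_gt0.
move=> y Ay z yz; have := hd (d / 2); rewrite /= sub0r normrN gtr0_norm ?divr_gt0//.
by rewrite ltr_pdivrMr// ltr_pMr ?ltr1n// => /(_ isT isT)/(_ y Ay); exact.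
Qed.

Lemma compact_bounded_fun (A : set E) (g : E -> R) : compact A ->
  (forall x, A x -> {for x, continuous g}) -> exists M, forall y, A y -> `|g y| <= M.
Proof.
move=> cA cg; have [d d0 hd] := compact_unif_cont cA cg ltr01.
have [s [_ sA]] := compact_net cA d0.
exists (\sum_(y <- s) (`|g y| + 1)) => y Ay; have [z zs yz] := sA y Ay.
rewrite (big_rem z)//= -[leLHS]addr0 lerD//; last first.
  by apply: sumr_ge0 => w _; rewrite addr_ge0.
have := hd y Ay z yz; have := ler_normD (g y - g z) (g z); rewrite subrK; lra.
Qed.

End compact_uniform.

Section pointwise_rules.
Context {R : realType} {V : normedModType R}.
Implicit Types (f g : V -> R) (x v : V) (c d e : R).

Lemma is_derive_add f g x v d e : is_derive x v f d -> is_derive x v g e ->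
  is_derive x v (fun y => f y + g y) (d + e).
Proof. by move=> df dg; exact: is_deriveD. Qed.

Lemma is_derive_mul f g x v d e : is_derive x v f d -> is_derive x v g e ->
  is_derive x v (fun y => f y * g y) (f x * e + g x * d).
Proof. by move=> df dg; exact: is_deriveM. Qed.

Lemma is_derive_scal c f x v d : is_derive x v f d ->
  is_derive x v (fun y => c * f y) (c * d).
Proof. by move=> df; exact: is_deriveZ. Qed.

Lemma continuous_at_add f g x : {for x, continuous f} -> {for x, continuous g} ->
  {for x, continuous (fun y => f y + g y)}.
Proof. by move=> cf cg; exact: continuousD. Qed.

Lemma continuous_at_mul f g x : {for x, continuous f} -> {for x, continuous g} ->
  {for x, continuous (fun y => f y * g y)}.
Proof. by move=> cf cg; exact: continuousM. Qed.

Lemma continuous_at_cst c x : {for x, continuous (fun _ : V => c)}.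
Proof. exact: cst_continuous. Qed.

End pointwise_rules.

(* An opaque name for is_derive, which as a class would trigger instance search on
   the premises of rharmonic_intro. *)
Definition has_derive {R : realType} {V : normedModType R} (x v : V) (f : V -> R)
  (d : R) : Prop := is_derive x v f d.

Section harmonic_rules.
Context {R : realType} {n : nat}.
Local Notation E := 'rV[R]_n.
Local Notation d_ i := (delta_mx ord0 i : E).
Implicit Types (D : set E) (u : E -> R).

Lemma rharmonic_intro D u (u1 : 'I_n -> E -> R) (u2 : 'I_n -> 'I_n -> E -> R) :
  open D ->
  (forall x, D x -> {for x, continuous u}) ->
  (forall i x, D x -> has_derive x (d_ i) u (u1 i x)) ->
  (forall i x, D x -> {for x, continuous (u1 i)}) ->
  (forall i j x, D x -> has_derive x (d_ i) (u1 j) (u2 i j x)) ->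
  (forall i j x, D x -> {for x, continuous (u2 i j)}) ->
  (forall x, D x -> \sum_i u2 i i x = 0) -> rharmonic_on D u.
Proof.
move=> oD cu du cu1 du1 cu2 lu.
have nD x : D x -> \forall y \near x, D y by move=> Dx; exact: open_nbhs_nbhs.
have nc (p q : E -> R) x : (\forall y \near x, p y = q y) ->
    {for x, continuous p} -> {for x, continuous q}.
  move=> pq cp; rewrite /prop_for /continuous_at -(nbhs_singleton pq).
  exact: cvg_trans (near_eq_cvg pq) cp.
have e1 i x : D x -> \forall y \near x, u1 i y = pderiv i u y.
  by move=> /nD; apply: filterS => y Dy; have [_] := du i y Dy.
have d2 i j x : D x -> is_derive x (d_ i) (pderiv j u) (u2 i j x).
  by move=> Dx; apply: near_eq_is_derive (e1 j x Dx) (du1 i j x Dx).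
have e2 i j x : D x -> \forall y \near x, u2 i j y = pderiv i (pderiv j u) y.
  by move=> /nD; apply: filterS => y Dy; have [_] := d2 i j y Dy.
split=> x Dx; last first.
  rewrite -[RHS](lu x Dx); apply: eq_bigr => i _.
  by have [_] := d2 i i x Dx.
split; first exact: cu.
- move=> i; split; first by have [] := du i x Dx.
  exact: nc (e1 i x Dx) (cu1 i x Dx).
- move=> i j; split; first by have [] := d2 i j x Dx.
  exact: nc (e2 i j x Dx) (cu2 i j x Dx).
Qed.

Lemma rharmonic_elim D u : rharmonic_on D u ->
  [/\ (forall x, D x -> {for x, continuous u}),
      (forall i x, D x -> is_derive x (d_ i) u (pderiv i u x)),
      (forall i x, D x -> {for x, continuous (pderiv i u)}) &
      (forall i j x, D x ->
         is_derive x (d_ i) (pderiv j u) (pderiv i (pderiv j u) x)) ] /\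
  (forall i j x, D x -> {for x, continuous (pderiv i (pderiv j u))}) /\
  (forall x, D x -> \sum_i pderiv i (pderiv i u) x = 0).
Proof.
move=> [C2 lu]; split; [split|split => //] => [x|i x|i x|i j x|i j x] /C2[] //.
- by move=> _ h _; apply: DeriveDef => //; have [] := h i.
- by move=> _ h _; have [] := h i.
- by move=> _ _ h; apply: DeriveDef => //; have [] := h i j.
- by move=> _ _ h; have [] := h i j.
Qed.

Lemma rharmonic_ext D u v : open D -> (forall x, D x -> u x = v x) ->
  rharmonic_on D u -> rharmonic_on D v.
Proof.
move=> oD uv /rharmonic_elim[[cu du cu1 du1] [cu2 lu]].
have nv x : D x -> \forall y \near x, u y = v y.
  by move=> Dx; near=> y; apply: uv; near: y; exact: open_nbhs_nbhs.
apply: (@rharmonic_intro D v (fun i => pderiv i u) (fun i j => pderiv i (pderiv j u))) => //.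
- move=> x Dx; rewrite /prop_for /continuous_at -(uv x Dx).
  exact: cvg_trans (near_eq_cvg (nv x Dx)) (cu x Dx).
- by move=> i x Dx; apply: near_eq_is_derive (nv x Dx) (du i x Dx).
Unshelve. all: by end_near. Qed.

Lemma rharmonic_sub D D' u : D' `<=` D -> rharmonic_on D u -> rharmonic_on D' u.
Proof. by move=> D'D [C2 lu]; split=> x /D'D; [exact: C2|exact: lu]. Qed.

Lemma rharmonic_cst D c : open D -> rharmonic_on D (fun=> c).
Proof.
move=> oD; apply: (@rharmonic_intro _ _ (fun _ _ => 0) (fun _ _ _ => 0)) => //.
- by move=> x _; exact: cst_continuous.
- by move=> i x _; exact: is_derive_cst.
- by move=> i x _; exact: cst_continuous.
- by move=> i j x _; exact: is_derive_cst.
- by move=> i j x _; exact: cst_continuous.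
- by move=> x _; rewrite big1.
Qed.

Lemma rharmonicD D u v : open D -> rharmonic_on D u -> rharmonic_on D v ->
  rharmonic_on D (fun x => u x + v x).
Proof.
move=> oD hu hv; apply: (rharmonic_ext oD _ (rharmonic_onZD 1 oD hu hv)) => x _.
by rewrite !fctE /= scale1r.
Qed.

Lemma rharmonicZ D c u : open D -> rharmonic_on D u ->
  rharmonic_on D (fun x => c * u x).
Proof.
move=> oD hu; apply: (rharmonic_ext oD _ (rharmonic_onZD c oD hu (rharmonic_on0 D))) => x _.
by rewrite !fctE /= addr0.
Qed.

Lemma rharmonicB D u v : open D -> rharmonic_on D u -> rharmonic_on D v ->
  rharmonic_on D (fun x => u x - v x).
Proof.
move=> oD hu hv; apply: (rharmonic_ext oD _ (rharmonicD oD hu (rharmonicZ (-1) oD hv))) => x _.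
by rewrite mulN1r.
Qed.

Lemma rharmonic_sum D (I : finType) (u : I -> E -> R) : open D ->
  (forall i, rharmonic_on D (u i)) -> rharmonic_on D (fun x => \sum_i u i x).
Proof.
move=> oD hu; rewrite unlock; elim: (index_enum I) => [|i s IH] /=.
  exact: rharmonic_cst.
exact: (rharmonicD oD (hu i) IH).
Qed.

Lemma is_derive_affine (f : E -> R) (s : R) (z x v : E) (d : R) :
  is_derive (s *: x + z) v f d -> is_derive x v (fun y => f (s *: y + z)) (s * d).
Proof.
move=> /is_derive_line df; apply/is_derive_line.
have ds : is_derive (0 : R) 1 (fun t : R => s * t) (s * 1).
  exact: is_derive_scal.
have df' : is_derive (s * 0) 1 (fun t : R => f (t *: v + (s *: x + z))) d.
  by rewrite mulr0.
have := is_derive1_comp df' ds; rewrite mulr1 mulrC.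
move=> h; apply: (is_derive_ext h) => // t /=.
by rewrite scalerDr scalerA addrA.
Qed.

Lemma rharmonic_affine D u (s : R) (z : E) : open D -> rharmonic_on D u ->
  rharmonic_on [set x | D (s *: x + z)] (fun x => u (s *: x + z)).
Proof.
move=> oD /rharmonic_elim[[cu du cu1 du1] [cu2 lu]].
have ca x : {for x, continuous (fun y : E => s *: y + z)}.
  by apply: continuousD; [apply: continuousZl_tmp|exact: cst_continuous].
have cc (f : E -> R) (x : E) : {for s *: x + z, continuous f} ->
    {for x, continuous (fun y : E => f (s *: y + z))}.
  by move=> cf; apply: (@continuous_comp _ _ _ (fun y : E => s *: y + z) f).
apply: (@rharmonic_intro _ _ (fun i x => s * pderiv i u (s *: x + z))
  (fun i j x => s * (s * pderiv i (pderiv j u) (s *: x + z)))).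
- by apply: open_comp => // x _; exact: ca.
- by move=> x Dx; apply: cc; exact: cu.
- by move=> i x Dx; exact: (is_derive_affine (du i _ Dx)).
- by move=> i x Dx; apply: continuous_at_mul; [exact: continuous_at_cst|apply: cc; exact: cu1].
- by move=> i j x Dx; exact: (is_derive_scal s (is_derive_affine (du1 i j _ Dx))).
- by move=> i j x Dx; do 2!(apply: continuous_at_mul; first exact: continuous_at_cst);
    apply: cc; exact: cu2.
- by move=> x Dx; rewrite -!mulr_sumr lu// !mulr0.
Qed.

End harmonic_rules.

Section maximum_principle.
Context {R : realType} {n : nat}.
Local Notation E := 'rV[R]_n.
Local Notation d_ i := (delta_mx ord0 i : E).

Lemma is_derive_coord (x v : E) j : is_derive x v (fun y : E => y ord0 j) (v ord0 j).
Proof.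
apply/is_derive_epsP => e e0; exists 1 => // h h0 _.
by rewrite !mxE addrK mulKf// subrr normr0 ltW.
Qed.

Lemma is_derive_dot (x v : E) : is_derive x v (fun y => dot y y) (2 * dot x v).
Proof.
apply/is_derive_epsP => e e0; exists (e / (dot v v + 1)).
  by rewrite divr_gt0// ltr_wpDl// dot_ge0.
move=> h h0; rewrite ltr_pdivlMr ?ltr_wpDl ?dot_ge0// => he.
rewrite !dotDl !dotDr !dotZl !dotZr (dotC v x).
rewrite (_ : _ - _ = - (h * dot v v)); last by field.
rewrite normrN normrM (ger0_norm (dot_ge0 v)).
by apply: le_trans (ltW he); rewrite ler_wpM2l// lerDl.
Qed.

Lemma continuous_dot (x : E) : {for x, continuous (fun y => dot y y)}.
Proof.
rewrite (_ : (fun y => dot y y) = (fun y => enorm y * enorm y)).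
  by apply: continuous_at_mul; exact: continuous_enorm.
by apply/funext => y; rewrite -expr2 enorm_sqr.
Qed.

Lemma dot_delta (x : E) i : dot x (d_ i) = x ord0 i.
Proof.
rewrite /dot (bigD1 i)//= big1 ?addr0; first by rewrite mxE !eqxx mulr1.
by move=> j ji; rewrite mxE (negbTE ji) andbF mulr0.
Qed.

Lemma max_principle (u : E -> R) (r M : R) : (0 < n)%N -> 0 <= r < 1 ->
  rharmonic_on unit_ball u -> (forall x, enorm x = r -> u x <= M) ->
  forall x, enorm x <= r -> u x <= M.
Proof.
move=> n0 /andP[r0 r1] /rharmonic_elim[[cu du cu1 du1] [cu2 lu]] uM x xr.
have key e : 0 < e -> u x <= M + e * r ^+ 2.
  move=> e0; pose v y := u y + e * dot y y.
  have cv y : enorm y <= r -> {for y, continuous v}.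
    move=> yr; apply: continuous_at_add; first by apply: cu; exact: le_lt_trans yr r1.
    by apply: continuous_at_mul; [exact: continuous_at_cst|exact: continuous_dot].
  have [||c cr vc] := @compact_EVT_max _ R v [set y : E | enorm y <= r] _ (@compact_closed_ball _ _ r).
  - by exists x.
  - by apply: continuous_in_subspaceT => y; rewrite inE /=; exact: cv.
  have ux : u x <= v c.
    apply: (@le_trans _ _ (v x)); first by rewrite lerDl mulr_ge0 ?dot_ge0// ltW.
    by apply: vc; rewrite inE.
  move: cr; rewrite inE /= le_eqVlt => /predU1P[cr|cr].
    by apply: le_trans ux _; rewrite /v -enorm_sqr cr lerD2r uM.
  exfalso.
  have d2 i : pderiv i (pderiv i u) c + 2 * e <= 0.
    pose f t := v (t *: d_ i + c).
    pose f1 t := pderiv i u (t *: d_ i + c) + e * (2 * (t *: d_ i + c) ord0 i).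
    have near_c t : `|t| < r - enorm c -> enorm (t *: d_ i + c) < r.
      move=> tr; apply: le_lt_trans (enormD _ _) _.
      by rewrite enormZ enorm_delta mulr1 -ltrBrDr.
    apply: (@second_derivative_max R f f1 _ (r - enorm c)).
    - by rewrite subr_gt0.
    - move=> t /near_c tr; apply: is_derive_lineS.
      apply: is_derive_add; first by apply: du; exact: lt_trans tr r1.
      by apply: is_derive_scal; rewrite -dot_delta; exact: is_derive_dot.
    - apply: (@is_derive_line _ _ (fun y => pderiv i u y + e * (2 * y ord0 i)) c (d_ i) _).1.
      apply: is_derive_add.
        by apply: du1; exact: lt_trans cr r1.
      rewrite mulrC; apply: is_derive_scal; rewrite -[X in is_derive _ _ _ X]mulr1.
      apply: is_derive_scal.
      have := is_derive_coord c (d_ i) i; by rewrite mxE !eqxx.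
    - move=> t /near_c tr; rewrite /f scale0r add0r; apply: vc.
      by rewrite inE /= ltW.
  have : \sum_(i < n) (pderiv i (pderiv i u) c + 2 * e) <= 0 by exact: sumr_le0.
  rewrite big_split /= lu; last exact: lt_trans cr r1.
  rewrite add0r sumr_const card_ord leNgt => /negP; apply.
  by rewrite pmulrn_lgt0 ?mulr_gt0//; exact: n0.
apply/ler_addgt0Pr => e e0.
have := key e e0; move=> /le_trans; apply; rewrite lerD2l.
by rewrite ler_piMr ?ltW// expr_lt1.
Qed.

End maximum_principle.

(** * Poisson integrals over an invariant measure on the sphere *)

Section kernels.
Context {R : realType} {n : nat}.
Local Notation E := 'rV[R]_n.
Local Notation d_ i := (delta_mx ord0 i : E).
Implicit Types (a : R) (x y v : E).

Definition radial_pow a y : R := (dot y y) `^ a.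
Local Notation K := radial_pow.

Lemma dot_gt0 y : y != 0 -> 0 < dot y y.
Proof. by move=> y0; rewrite lt0r dot_eq0 y0 dot_ge0. Qed.

Lemma is_derive_radial_pow a y v : y != 0 ->
  is_derive y v (K a) (2 * a * dot y v * K (a - 1) y).
Proof.
move=> y0; have d1 : is_derive (dot y y) 1 (@powR R ^~ a) (a * (dot y y) `^ (a - 1)).
  by apply: is_derive1_powR; exact: dot_gt0.
by apply: (is_derive_ext (is_derive_comp1 (is_derive_dot y v) d1)) => //; rewrite /K; ring.
Qed.

Lemma continuous_radial_pow a y : y != 0 -> {for y, continuous (K a)}.
Proof.
move=> y0; apply: (@continuous_comp _ _ _ (fun y => dot y y) (@powR R ^~ a)).
  exact: continuous_dot.
apply: is_derive_continuous (is_derive1_powR a _); exact: dot_gt0.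
Qed.

Lemma radial_powS a y : y != 0 -> K a y = dot y y * K (a - 1) y.
Proof.
move=> y0; rewrite /K -{2}(powRr1 (dot_ge0 y)) -powRD; last first.
  by apply/implyP => _; rewrite dot_eq0.
by congr powR; ring.
Qed.

Lemma open_neq0 : open [set y : E | y != 0].
Proof.
rewrite (_ : mkset _ = enorm @^-1` [set t | 0 < t]).
  by apply: open_comp => [? _|]; [exact: continuous_enorm|exact: open_gt].
by apply/seteqP; split => y /=; rewrite enorm_gt0.
Qed.

(* Up to constants, newton is the fundamental solution of the Laplacian (the constant 1
   for n = 2) and riesz its gradient, so that riesz convolved with a density f on the
   sphere is a Riesz system; poisson_decomp below ties both to the Poisson kernel. *)
Definition newton : E -> R := K (1 - n%:R / 2).
Definition riesz (j : 'I_n) (y : E) : R := - (y ord0 j * K (- (n%:R / 2)) y).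

Lemma delta_coord i j : (d_ i) ord0 j = (i == j)%:R :> R.
Proof. by rewrite mxE eqxx eq_sym. Qed.

Lemma sum_delta (F : 'I_n -> R) j : \sum_i (i == j)%:R * F i = F j.
Proof.
rewrite (bigD1 j)//= eqxx mul1r big1 ?addr0// => i /negbTE ->.
by rewrite mul0r.
Qed.

Lemma rharmonic_newton : rharmonic_on [set y : E | y != 0] newton.
Proof.
pose b : R := 1 - n%:R / 2.
apply: (@rharmonic_intro _ _ _ _ (fun i y => 2 * b * (y ord0 i * K (b - 1) y))
  (fun i j y => 2 * b * (y ord0 j * (2 * (b - 1) * y ord0 i * K (b - 1 - 1) y) +
                         K (b - 1) y * (i == j)%:R))).
- exact: open_neq0.
- by move=> x x0; exact: continuous_radial_pow.
- move=> i x x0; apply: (is_derive_ext (is_derive_radial_pow b (d_ i) x0)) => //.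
  by rewrite dot_delta; ring.
- move=> i x x0; apply: continuous_at_mul; first exact: continuous_at_cst.
  by apply: continuous_at_mul; [exact: coord_continuous|exact: continuous_radial_pow].
- move=> i j x x0; rewrite /has_derive -delta_coord -(dot_delta x i).
  exact: (is_derive_scal _ (is_derive_mul (is_derive_coord x (d_ i) j)
    (is_derive_radial_pow (b - 1) (d_ i) x0))).
- move=> i j x x0; apply: continuous_at_mul; first exact: continuous_at_cst.
  apply: continuous_at_add; last first.
    by apply: continuous_at_mul; [exact: continuous_radial_pow|exact: continuous_at_cst].
  apply: continuous_at_mul; first exact: coord_continuous.
  apply: continuous_at_mul; last exact: continuous_radial_pow.
  by apply: continuous_at_mul; [exact: continuous_at_cst|exact: coord_continuous].
- move=> x x0; rewrite -mulr_sumr.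
  rewrite (eq_bigr (fun i => 2 * (b - 1) * K (b - 1 - 1) x * (x ord0 i * x ord0 i) + K (b - 1) x)).
    rewrite big_split /= -mulr_sumr -/(dot x x) sumr_const card_ord -[_ *+ n]mulr_natr.
    rewrite (radial_powS (b - 1) x0) /b; by field.
  by move=> i _; rewrite eqxx mulr1; ring.
Qed.

Lemma rharmonic_riesz j : rharmonic_on [set y : E | y != 0] (riesz j).
Proof.
pose c : R := - (n%:R / 2).
apply: (@rharmonic_intro _ _ _ _
  (fun i y => - 1 * (y ord0 j * (2 * c * y ord0 i * K (c - 1) y) + K c y * (i == j)%:R))
  (fun i k y => - 1 * ((y ord0 j * (2 * c * y ord0 k * (2 * (c - 1) * y ord0 i * K (c - 1 - 1) y)
      + K (c - 1) y * (2 * c * (i == k)%:R)) + (2 * c * y ord0 k * K (c - 1) y) * (i == j)%:R)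
    + (k == j)%:R * (2 * c * y ord0 i * K (c - 1) y)))).
- exact: open_neq0.
- move=> x x0; rewrite (_ : riesz j = (fun y => -1 * (y ord0 j * K c y))).
    apply: continuous_at_mul; first exact: continuous_at_cst.
    by apply: continuous_at_mul; [exact: coord_continuous|exact: continuous_radial_pow].
  by apply/funext => y; rewrite mulN1r.
- move=> i x x0; rewrite /has_derive -delta_coord -(dot_delta x i).
  apply: (is_derive_ext (is_derive_scal (-1) (is_derive_mul (is_derive_coord x (d_ i) j)
    (is_derive_radial_pow c (d_ i) x0)))) => // y.
  by rewrite mulN1r.
- move=> i x x0; apply: continuous_at_mul; first exact: continuous_at_cst.
  apply: continuous_at_add; last first.
    by apply: continuous_at_mul; [exact: continuous_radial_pow|exact: continuous_at_cst].
  apply: continuous_at_mul; first exact: coord_continuous.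
  apply: continuous_at_mul; last exact: continuous_radial_pow.
  by apply: continuous_at_mul; [exact: continuous_at_cst|exact: coord_continuous].
- move=> i k x x0; rewrite /has_derive -(delta_coord i k) -(delta_coord i j) -(dot_delta x i).
  apply: (is_derive_ext (is_derive_scal (-1) (is_derive_add
    (is_derive_mul (is_derive_coord x (d_ i) j)
      (is_derive_mul (is_derive_scal (2 * c) (is_derive_coord x (d_ i) k))
        (is_derive_radial_pow (c - 1) (d_ i) x0)))
    (is_derive_scal (k == j)%:R (is_derive_radial_pow c (d_ i) x0))))) => // y.
  ring.
- move=> i k x x0; apply: continuous_at_mul; first exact: continuous_at_cst.
  have cx m : {for x, continuous (fun y : E => y ord0 m)} by exact: coord_continuous.
  have cK a : {for x, continuous (K a)} by exact: continuous_radial_pow.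
  have cc a : {for x, continuous (fun _ : E => a)} by exact: continuous_at_cst.
  have cM (f g : E -> R) : {for x, continuous f} -> {for x, continuous g} ->
    {for x, continuous (fun y : E => f y * g y)} := @continuous_at_mul R _ f g x.
  have cA (f g : E -> R) : {for x, continuous f} -> {for x, continuous g} ->
    {for x, continuous (fun y : E => f y + g y)} := @continuous_at_add R _ f g x.
  exact: (cA _ _ (cA _ _ (cM _ _ (cx _) (cA _ _ (cM _ _ (cM _ _ (cc _) (cx _))
    (cM _ _ (cM _ _ (cc _) (cx _)) (cK _))) (cM _ _ (cK _) (cc _))))
    (cM _ _ (cM _ _ (cM _ _ (cc _) (cx _)) (cK _)) (cc _)))
    (cM _ _ (cc _) (cM _ _ (cM _ _ (cc _) (cx _)) (cK _)))).
- move=> x x0; rewrite -mulr_sumr.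
  rewrite (eq_bigr (fun i => x ord0 j * (4 * c * (c - 1) * K (c - 1 - 1) x) * (x ord0 i * x ord0 i)
     + (2 * c * x ord0 j * K (c - 1) x + (i == j)%:R * (4 * c * x ord0 i * K (c - 1) x)))).
    rewrite big_split /= -mulr_sumr -/(dot x x) big_split /= sumr_const card_ord -[_ *+ n]mulr_natr.
    rewrite (sum_delta (fun i => 4 * c * x ord0 i * K (c - 1) x)).
    rewrite (radial_powS (c - 1) x0) /c; by field.
  by move=> i _; rewrite eqxx mulr1; ring.
Qed.

End kernels.

Section sphere_integrals.
Context {R : realType} {n : nat} {d : measure_display} {T : measurableType d}.
Variable P : probability T R.
Variable th : T -> 'rV[R]_n.
Hypothesis mth : measurable_fun setT (th : T -> borel_rV R n).
Hypothesis th1 : forall w, enorm (th w) = 1.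
Local Notation E := 'rV[R]_n.
Local Notation d_ i := (delta_mx ord0 i : E).
Local Notation K := radial_pow.

Lemma sub_sphere_neq0 (x z : E) : enorm x < 1 -> enorm z = 1 -> x - z != 0.
Proof.
move=> x1 z1; rewrite -enorm_gt0; apply: lt_le_trans (enorm_dist _ _).
by rewrite z1 normr_gt0 subr_eq0 lt_eqF.
Qed.

Definition shell (r : R) : set E := [set y | r <= enorm y <= 2].

Lemma compact_shell r : compact (shell r).
Proof.
apply: (subclosed_compact _ (@compact_closed_ball _ _ 2)); last by move=> x /andP[].
rewrite (_ : shell r = enorm @^-1` `[r, 2]).
  by apply: closed_comp => [? _|]; [exact: continuous_enorm|exact: itv_closed].
by apply/seteqP; split => y /=; rewrite in_itv.
Qed.

Lemma shell_neq0 r y : 0 < r -> shell r y -> y != 0.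
Proof. by move=> r0 /andP[ry _]; rewrite -enorm_gt0 (lt_le_trans r0). Qed.

Lemma shell_sub (x z : E) r : enorm x <= r -> r < 1 -> enorm z = 1 -> shell (1 - r) (x - z).
Proof.
move=> xr r1 z1; apply/andP; split.
  have := enorm_dist z x; rewrite enormB z1; have := ler_norm (1 - enorm x); lra.
have := enormD x (- z); rewrite enormN z1; lra.
Qed.

Lemma measurable_sphere (g : E -> R) (D : set E) : open D ->
  (forall y, D y -> {for y, continuous g}) -> (forall w, D (th w)) ->
  measurable_fun setT (fun w => g (th w)).
Proof.
move=> oD cg Dth; apply: (@measurable_comp _ _ _ _ _ _ (D : set (borel_rV R n))).
- exact: measurable_open.
- by move=> _ [w _ <-]; exact: Dth.
- exact: continuous_on_measurable.
- exact: mth.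
Qed.

Lemma bm_coord_sphere i : bm (fun w => th w ord0 i).
Proof.
split; first by apply: (@measurable_sphere (fun y => y ord0 i) setT) => //;
  [exact: openT|move=> y _; exact: coord_continuous].
by exists 1 => w; rewrite -(th1 w) coord_le.
Qed.

Lemma bm_kernel (g : E -> R) x : (forall y, y != 0 -> {for y, continuous g}) ->
  enorm x < 1 -> bm (fun w => g (x - th w)).
Proof.
move=> cg x1; split.
  apply: (@measurable_sphere (fun z => g (x - z)) [set z | x - z != 0]).
  - rewrite (_ : mkset _ = (fun z => x - z) @^-1` [set y : E | y != 0])//.
    apply: open_comp; last exact: open_neq0.
    by move=> z _; apply: continuousB; [exact: cst_continuous|].
  - move=> y xy; apply: (@continuous_comp E E R (fun z : E => x - z) g); last exact: cg.
    by apply: continuousB; [exact: cst_continuous|].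
  - by move=> w /=; exact: sub_sphere_neq0.
have x0 : 0 < 1 - enorm x by rewrite subr_gt0.
have [M hM] := @compact_bounded_fun _ _ (shell (1 - enorm x)) g (@compact_shell _)
  (fun y Ay => cg y (shell_neq0 x0 Ay)).
by exists M => w; apply: hM; exact: shell_sub.
Qed.

Lemma kernel_unif (g : E -> R) r e : (forall y, y != 0 -> {for y, continuous g}) ->
  r < 1 -> 0 < e -> exists2 s : R, 0 < s & forall x x', enorm x <= r -> enorm (x - x') < s ->
    forall z, enorm z = 1 -> `|g (x - z) - g (x' - z)| < e.
Proof.
move=> cg r1 e0; have r0 : 0 < 1 - r by rewrite subr_gt0.
have [s s0 hs] := compact_unif_cont (@compact_shell (1 - r))
  (fun y Ay => cg y (shell_neq0 r0 Ay)) e0.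
exists s => // x x' xr xx' z z1; apply: hs; first exact: shell_sub.
by rewrite opprB addrA subrK.
Qed.

Definition conv (g : E -> R) (f : T -> R) (x : E) : R := \int[P]_w (g (x - th w) * f w).

Lemma bm_conv (g : E -> R) f x : (forall y, y != 0 -> {for y, continuous g}) -> bm f ->
  enorm x < 1 -> bm (fun w => g (x - th w) * f w).
Proof. by move=> cg bf x1; apply: bmM => //; exact: bm_kernel. Qed.

Lemma continuous_conv (g : E -> R) f x : (forall y, y != 0 -> {for y, continuous g}) ->
  bm f -> enorm x < 1 -> {for x, continuous (conv g f)}.
Proof.
move=> cg bf x1; apply/continuous_enormP => e e0.
have [_ [M fM]] := bf; pose M1 := `|M| + 1.
have M10 : 0 < M1 by rewrite ltr_wpDl.
have [s s0 hs] := kernel_unif cg x1 (divr_gt0 e0 (mulr_gt0 (ltr0n _ 2) M10)).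
exists (Num.min s (1 - enorm x)); first by rewrite lt_min s0 subr_gt0.
move=> y; rewrite lt_min => /andP[ys yx].
have y1 : enorm y < 1.
  have := enormD (y - x) x; rewrite subrK enormB; lra.
rewrite /conv -bm_intB; [|exact: bm_conv|exact: bm_conv].
apply: (@le_lt_trans _ _ (e / 2)); last by rewrite ltr_pdivrMr// ltr_pMr// ltr1n.
apply: bm_int_norm_le; first by apply: bmB; exact: bm_conv.
move=> w; rewrite -mulrBl normrM.
have -> : e / 2 = e / (2 * M1) * M1 by field; rewrite gt_eqF.
apply: ler_pM => //; first by rewrite ltW// hs.
by rewrite (le_trans (fM w))// (le_trans (ler_norm M))// lerDl.
Qed.

Lemma is_derive_dirZ (V : normedModType R) (f : V -> R) (x v : V) (h e : R) :
  is_derive x v f e -> is_derive x (h *: v) f (h * e).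
Proof.
move=> /is_derive_line df; apply/is_derive_line.
have ds : is_derive (0 : R) 1 (fun t : R => h * t) (h * 1) by exact: is_derive_scal.
have df' : is_derive (h * 0) 1 (fun t : R => f (t *: v + x)) e by rewrite mulr0.
have := is_derive1_comp df' ds; rewrite mulr1 mulrC.
by move=> H; apply: (is_derive_ext H) => // t /=; rewrite scalerA mulrC.
Qed.

Lemma is_derive_conv (g g1 : E -> R) f i x :
  (forall y, y != 0 -> {for y, continuous g}) ->
  (forall y, y != 0 -> is_derive y (d_ i) g (g1 y)) ->
  (forall y, y != 0 -> {for y, continuous g1}) -> bm f -> enorm x < 1 ->
  has_derive x (d_ i) (conv g f) (conv g1 f x).
Proof.
move=> cg dg cg1 bf x1; apply/is_derive_epsP => e e0.
have [_ [M fM]] := bf; pose M1 := `|M| + 1.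
have M10 : 0 < M1 by rewrite ltr_wpDl.
have [s s0 hs] := kernel_unif cg1 x1 (divr_gt0 e0 M10).
exists (Num.min s (1 - enorm x)); first by rewrite lt_min s0 subr_gt0.
move=> h h0; rewrite lt_min => /andP[ys yx].
have hx t : 0 <= t <= 1 -> enorm (t *: (h *: d_ i)) <= `|h|.
  move=> /andP[t0 t1]; rewrite !enormZ enorm_delta mulr1 ger0_norm//.
  by rewrite ler_piMl.
have hx1 t : 0 <= t <= 1 -> enorm (t *: (h *: d_ i) + x) < 1.
  move=> /hx; have := enormD (t *: (h *: d_ i)) x; lra.
have y1 : enorm (h *: d_ i + x) < 1.
  by have := hx1 1; rewrite scale1r ler01 lexx; apply.
rewrite /conv -bm_intB; [|exact: bm_conv|exact: bm_conv].
have bdiff : bm (fun w => g (h *: d_ i + x - th w) * f w - g (x - th w) * f w).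
  by apply: bmB; exact: bm_conv.
rewrite -bm_intZ// -bm_intB; [|exact: bm_conv|by apply: bmM => //; exact: bm_cst].
apply: bm_int_norm_le.
  by apply: bmB; [exact: bm_conv|by apply: bmM => //; exact: bm_cst].
move=> w; rewrite -mulrBl mulrA -mulrBl normrM.
have -> : e = e / M1 * M1 by field; rewrite gt_eqF.
apply: ler_pM => //; last first.
  by rewrite (le_trans (fM w))// (le_trans (ler_norm M))// lerDl.
have [t t01 tE] := @mvt_line R _ g (fun y => h * g1 y) (x - th w) (h *: d_ i) (fun t t01 =>
  is_derive_dirZ h (dg _ (eq_ind _ (fun y => y != 0) (sub_sphere_neq0 (hx1 t t01) (th1 w)) _
    (esym (addrA _ _ _))))).
rewrite -addrA tE mulKf// ltW//.
rewrite addrA; apply: hs => //.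
by rewrite opprD addrCA subrr addr0 enormN (le_lt_trans (hx _ t01)).
Qed.

Lemma rharmonic_conv (g : E -> R) f : rharmonic_on [set y | y != 0] g -> bm f ->
  rharmonic_on unit_ball (conv g f).
Proof.
move=> /rharmonic_elim[[cu du cu1 du1] [cu2 lu]] bf.
apply: (@rharmonic_intro _ _ _ _ (fun i => conv (pderiv i g) f)
  (fun i j => conv (pderiv i (pderiv j g)) f)).
- exact: open_unit_ball.
- by move=> x x1; exact: continuous_conv.
- by move=> i x x1; apply: (is_derive_conv cu _ (cu1 i) bf x1); exact: du.
- by move=> i x x1; apply: continuous_conv => //; exact: cu1.
- by move=> i j x x1; apply: (is_derive_conv (cu1 j) _ (cu2 i j) bf x1); exact: du1.
- by move=> i j x x1; apply: continuous_conv => //; exact: cu2.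
move=> x x1; rewrite /conv -bm_int_sum; last first.
  by move=> i; apply: bm_conv => //; exact: cu2.
rewrite (_ : (fun w => _) = (fun=> 0)) ?bm_int_cst//; apply/funext => w.
by rewrite -mulr_suml lu ?mul0r//; exact: sub_sphere_neq0.
Qed.

Lemma radial_constant (u : E -> R) : (0 < n)%N -> rharmonic_on unit_ball u ->
  (forall O x, O *m O^T = 1%:M -> enorm x < 1 -> u (x *m O) = u x) ->
  forall x, enorm x < 1 -> u x = u 0.
Proof.
move=> n0 hu ui x x1.
have rx : 0 <= enorm x < 1 by rewrite enorm_ge0.
have cst y : enorm y = enorm x -> u y = u x.
  move=> yx; have [U UU <-] := orth_transitive (esym yx).
  exact: ui.
have e0 : enorm (0 : E) <= enorm x by rewrite enorm0 enorm_ge0.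
apply/eqP; rewrite eq_le; apply/andP; split.
  rewrite -lerN2.
  have hN := rharmonicZ (-1) (@open_unit_ball R n) hu.
  have := max_principle n0 rx hN (M := - u x) _ e0; rewrite mulN1r; apply.
  by move=> y /cst ->; rewrite mulN1r.
apply: (max_principle n0 rx hu _ e0).
by move=> y /cst ->.
Qed.

Definition poisson (x z : E) : R := (1 - dot x x) * K (- (n%:R / 2)) (x - z).

Lemma poisson_decomp x z : enorm z = 1 -> x != z ->
  poisson x z = 2 * (\sum_j z ord0 j * riesz j (x - z)) - newton (x - z).
Proof.
move=> z1 xz; have y0 : x - z != 0 by rewrite subr_eq0.
rewrite /newton (radial_powS _ y0).
have -> : 1 - n%:R / 2 - 1 = - (n%:R / 2) :> R by ring.
rewrite (eq_bigr (fun j => - K (- (n%:R / 2)) (x - z) * (z ord0 j * (x - z) ord0 j))); last first.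
  by move=> j _; rewrite /riesz; ring.
rewrite -mulr_sumr -/(dot z (x - z)) dotBl !dotBr (dotC z x).
have zz : dot z z = 1 by rewrite -enorm_sqr z1 expr1n.
rewrite /poisson zz; ring.
Qed.

Lemma poisson_ge0 x z : enorm x <= 1 -> 0 <= poisson x z.
Proof.
move=> x1; rewrite mulr_ge0 ?powR_ge0// subr_ge0 -enorm_sqr.
by rewrite -[leRHS](expr1n _ 2) ler_pXn2r// ?nnegrE ?enorm_ge0.
Qed.

Lemma poisson_far x z (e : R) : 0 < e -> e <= enorm (x - z) -> enorm x <= 1 ->
  poisson x z <= (1 - dot x x) * (e ^+ 2) `^ (- (n%:R / 2)).
Proof.
move=> e0 exz x1; apply: ler_wpM2l.
  rewrite subr_ge0 -enorm_sqr.
  by rewrite -[leRHS](expr1n _ 2) ler_pXn2r// ?nnegrE ?enorm_ge0.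
have e2 : 0 < e ^+ 2 by rewrite exprn_gt0.
have h : e ^+ 2 <= dot (x - z) (x - z).
  by rewrite -enorm_sqr ler_pXn2r// nnegrE ?enorm_ge0// ltW.
rewrite /K !powRN lef_pV2 ?posrE ?powR_gt0//; last exact: lt_le_trans h.
by apply: ge0_ler_powR; rewrite ?nnegrE ?divr_ge0// ?ltW// (lt_le_trans e2).
Qed.

Lemma poisson_sym (c : R) z z' : enorm z = 1 -> enorm z' = 1 ->
  poisson (c *: z) z' = poisson (c *: z') z.
Proof.
move=> z1 z1'; rewrite /poisson /K !dotBl !dotBr !dotZl !dotZr (dotC z' z).
by rewrite -!enorm_sqr z1 z1'.
Qed.

Lemma poisson_orth O x z : O *m O^T = 1%:M -> poisson (x *m O) (z *m O) = poisson x z.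
Proof. by move=> OO; rewrite /poisson /K -mulmxBl !dot_orth. Qed.

Lemma poisson_orthl O x z : O *m O^T = 1%:M -> poisson (x *m O) z = poisson x (z *m O^T).
Proof. by move=> OO; rewrite -(poisson_orth x (z *m O^T) OO) -mulmxA (orth_tr OO) mulmx1. Qed.

Lemma poisson0 z : enorm z = 1 -> poisson 0 z = 1.
Proof.
move=> z1; rewrite /poisson /K sub0r -!enorm_sqr enormN z1 enorm0 expr0n /= subr0 expr1n.
by rewrite powR1 mulr1.
Qed.

Definition pois_int (f : T -> R) (x : E) : R := \int[P]_w (poisson x (th w) * f w).

Lemma bm_poisson x : enorm x < 1 -> bm (fun w => poisson x (th w)).
Proof.
move=> x1; apply: bmM; first exact: bm_cst.
by apply: bm_kernel => // y; exact: continuous_radial_pow.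
Qed.

Lemma bm_pois_int f x : bm f -> enorm x < 1 -> bm (fun w => poisson x (th w) * f w).
Proof. by move=> bf x1; apply: bmM => //; exact: bm_poisson. Qed.

Lemma riesz_cont j (y : E) : y != 0 -> {for y, continuous (riesz j)}.
Proof. by have [[cu _ _ _] _] := rharmonic_elim (@rharmonic_riesz R n j) => /cu. Qed.

Lemma newton_cont (y : E) : y != 0 -> {for y, continuous (@newton R n)}.
Proof. by have [[cu _ _ _] _] := rharmonic_elim (@rharmonic_newton R n) => /cu. Qed.

Lemma pois_intE f x : bm f -> enorm x < 1 -> pois_int f x =
  2 * (\sum_j conv (riesz j) (fun w => th w ord0 j * f w) x) - conv newton f x.
Proof.
move=> bf x1; have bj j : bm (fun w => th w ord0 j * f w).
  by apply: bmM => //; exact: bm_coord_sphere.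
have bc j : bm (fun w => riesz j (x - th w) * (th w ord0 j * f w)).
  by apply: bm_conv => //; exact: riesz_cont.
rewrite /conv -bm_int_sum// -bm_intZ; last exact: bm_sum.
rewrite -bm_intB.
- rewrite /pois_int; congr Rintegral; apply/funext => w.
  rewrite poisson_decomp//; last by rewrite -subr_eq0 sub_sphere_neq0.
  rewrite mulrBl -mulrA mulr_suml; congr (2 * _ - _).
  by apply: eq_bigr => j _; ring.
- by apply: bmM; [exact: bm_cst|exact: bm_sum].
- by apply: bm_conv => //; exact: newton_cont.
Qed.

Lemma rharmonic_pois_int f : bm f -> rharmonic_on unit_ball (pois_int f).
Proof.
move=> bf; have oB := @open_unit_ball R n.
apply: (rharmonic_ext oB _ (rharmonicB oB (rharmonicZ 2 oB (rharmonic_sum oB _))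
  (rharmonic_conv (@rharmonic_newton R n) bf))).
  by move=> x x1; rewrite pois_intE.
move=> j; apply: rharmonic_conv; first exact: rharmonic_riesz.
by apply: bmM => //; exact: bm_coord_sphere.
Qed.

Hypothesis n_gt0 : (0 < n)%N.
Hypothesis th_inv : forall O, O *m O^T = 1%:M -> forall g : E -> R,
  bm (fun w => g (th w)) -> \int[P]_w g (th w *m O) = \int[P]_w g (th w).

Lemma int_poisson x : enorm x < 1 -> \int[P]_w poisson x (th w) = 1.
Proof.
move=> x1; pose u := pois_int (fun=> 1).
have uE y : u y = \int[P]_w poisson y (th w).
  by rewrite /u /pois_int; congr Rintegral; apply/funext => w; rewrite mulr1.
have u0 : u 0 = 1.
  rewrite uE (_ : (fun w => _) = (fun=> 1)) ?bm_int_cst//; apply/funext => w.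
  exact: poisson0.
have hu : rharmonic_on unit_ball u by apply: rharmonic_pois_int; exact: bm_cst.
rewrite -uE -u0; apply: (radial_constant n_gt0 hu _ x1).
move=> O y OO y1; rewrite !uE.
have OT : O^T *m O^T^T = 1%:M by rewrite trmxK orth_tr.
rewrite -(th_inv OT (g := poisson y)); last exact: bm_poisson.
by congr Rintegral; apply/funext => w; exact: (poisson_orthl _ _ OO).
Qed.

Lemma poisson_formula1 (u : E -> R) M : rharmonic_on unit_ball u ->
  (forall e, 0 < e -> exists2 s : R, 0 < s & forall x w, enorm x < 1 ->
     enorm (x - th w) < s -> `|u x - u (th w)| < e) ->
  (forall x, enorm x <= 1 -> `|u x| <= M) -> bm (fun w => u (th w)) ->
  forall x, enorm x < 1 -> u x = pois_int (fun w => u (th w)) x.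
Proof.
move=> hu uu uM bu x0 x01; have oB := @open_unit_ball R n.
set v := pois_int _.
have hv : rharmonic_on unit_ball v by exact: rharmonic_pois_int.
have M0 : 0 <= M by apply: le_trans (uM 0 _) => //; rewrite enorm0.
suff key e : 0 < e -> `|u x0 - v x0| <= e.
  apply/eqP; rewrite -subr_eq0 -normr_eq0 eq_le normr_ge0 andbT.
  by apply/ler_addgt0Pr => e e0; rewrite add0r key.
move=> e0; have [s s0 hs] := uu _ (divr_gt0 e0 (ltr0n _ 2)).
pose C := (s ^+ 2) `^ (- (n%:R / 2)) : R.
have C0 : 0 <= C by exact: powR_ge0.
have bd x : enorm x < 1 -> `|u x - v x| <= e / 2 + 2 * M * (1 - dot x x) * C.
  move=> x1.
  have xx : 0 <= 1 - dot x x.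
    by rewrite subr_ge0 -enorm_sqr expr_le1 ?enorm_ge0 ?ltW.
  have -> : u x - v x = \int[P]_w (poisson x (th w) * (u x - u (th w))).
    rewrite -[u x in LHS]mulr1 -(int_poisson x1) -bm_intZ; last exact: bm_poisson.
    rewrite /v /pois_int -bm_intB; [|by apply: bmM; [exact: bm_cst|exact: bm_poisson]|exact: bm_pois_int].
    by congr Rintegral; apply/funext => w; ring.
  have bux : bm (fun w => u x - u (th w)) by apply: bmB => //; exact: bm_cst.
  apply: le_trans (bm_int_abs _) _; first exact: bm_pois_int.
  apply: (@le_trans _ _ (\int[P]_w (e / 2 * poisson x (th w) + 2 * M * (1 - dot x x) * C))).
    apply: bm_int_le.
    - by apply: bm_abs; exact: bm_pois_int.
    - by apply: bmD; [apply: bmM; [exact: bm_cst|exact: bm_poisson]|exact: bm_cst].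
    move=> w; rewrite normrM ger0_norm ?poisson_ge0 ?(ltW x1)//.
    have p0 := poisson_ge0 (th w) (ltW x1).
    have [xs|xs] := ltP (enorm (x - th w)) s.
      apply: (@le_trans _ _ (e / 2 * poisson x (th w))).
        by rewrite mulrC ler_wpM2r// ltW// hs.
      by rewrite lerDl !mulr_ge0.
    apply: (@le_trans _ _ (2 * M * (1 - dot x x) * C)); last first.
      by rewrite lerDr mulr_ge0// divr_ge0// ltW.
    rewrite [leRHS](_ : _ = (1 - dot x x) * C * (2 * M)); last by ring.
    apply: ler_pM => //; first exact: poisson_far (ltW x1).
    apply: le_trans (ler_normB _ _) _; rewrite mulr_natl mulr2n lerD// uM ?th1//.
    exact: ltW.
  rewrite bm_intD; last 2 first.
  - by apply: bmM; [exact: bm_cst|exact: bm_poisson].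
  - exact: bm_cst.
  by rewrite bm_int_cst bm_intZ ?int_poisson ?mulr1//; exact: bm_poisson.
pose t := e / (8 * (M * C + 1) + e).
have D0 : 0 < 8 * (M * C + 1) + e by have := mulr_ge0 M0 C0; lra.
have t0 : 0 < t by rewrite divr_gt0.
have t1 : t <= 1 by rewrite ler_pdivrMr// mul1r lerDr; have := mulr_ge0 M0 C0; lra.
pose r := Num.max (enorm x0) (1 - t).
have r01 : 0 <= r < 1.
  by rewrite le_max enorm_ge0 /= gt_max x01 /= ltrBlDr ltrDl.
have bdr x : enorm x = r -> `|u x - v x| <= e.
  move=> xr; have /andP[r0 r1] := r01.
  apply: le_trans (bd x _) _; first by rewrite xr.
  have tr : 1 - t <= r by rewrite le_max lexx orbT.
  have h1 : 1 - dot x x <= 2 * t.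
    rewrite -enorm_sqr xr; apply: (@le_trans _ _ (2 * (1 - r))); last by lra.
    by rewrite -subr_ge0 (_ : _ - _ = (1 - r) ^+ 2) ?sqr_ge0//; ring.
  have h2 : 2 * M * (1 - dot x x) * C <= 4 * t * (M * C).
    rewrite (_ : 2 * M * _ * C = (1 - dot x x) * (2 * (M * C))); last by ring.
    rewrite (_ : 4 * t * _ = 2 * t * (2 * (M * C))); last by ring.
    by apply: ler_wpM2r => //; rewrite !mulr_ge0.
  apply: (@le_trans _ _ (e / 2 + 4 * t * (M * C))); first by rewrite lerD2l.
  have : 4 * t * (M * C) <= e / 2.
    have tD : t * (8 * (M * C + 1) + e) = e by rewrite divfK// gt_eqF.
    have : 8 * (t * (M * C)) + 8 * t + t * e = e by rewrite -[RHS]tD; ring.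
    have := mulr_ge0 (ltW t0) (ltW e0); rewrite -mulrA; lra.
  lra.
have x0r : enorm x0 <= r by rewrite le_max lexx.
rewrite ler_norml; apply/andP; split.
  rewrite -lerN2 opprK.
  have hN := rharmonicB oB hv hu.
  rewrite opprB; apply: (max_principle n_gt0 r01 hN _ x0r) => x /bdr.
  by rewrite ler_norml => /andP[]; lra.
apply: (max_principle n_gt0 r01 (rharmonicB oB hu hv) _ x0r) => x /bdr.
by rewrite ler_norml => /andP[].
Qed.

Lemma bm_sphere_cont (u : E -> R) s : (forall x, enorm x < 1 -> {for x, continuous u}) ->
  0 <= s < 1 -> bm (fun w => u (s *: th w)).
Proof.
move=> cu /andP[s0 s1].
have sE (y : E) : enorm (s *: y) = s * enorm y by rewrite enormZ ger0_norm.
have cs (y : E) : enorm (s *: y) < 1 -> {for y, continuous (fun y : E => u (s *: y))}.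
  move=> sy; apply: (@continuous_comp E E R (fun y : E => s *: y) u); last exact: cu.
  exact: continuousZl_tmp.
have b1 w : enorm (s *: th w) < 1 by rewrite sE th1 mulr1.
split.
  apply: (@measurable_sphere (fun y => u (s *: y)) [set y : E | enorm (s *: y) < 1]) => //.
  rewrite (_ : mkset _ = (fun y : E => s *: y) @^-1` unit_ball)//.
  by apply: open_comp; [move=> y _; exact: continuousZl_tmp|exact: open_unit_ball].
have [|M hM] := @compact_bounded_fun _ _ _ (fun y : E => u (s *: y)) (@compact_closed_ball _ n 1).
  by move=> y /= y1; apply: cs; rewrite sE (le_lt_trans _ s1)// ler_piMr.
by exists M => w; apply: hM => /=; rewrite th1.
Qed.

Lemma bm_sphere (u : E -> R) s : rharmonic_on unit_ball u -> 0 <= s < 1 ->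
  bm (fun w => u (s *: th w)).
Proof. by move=> /rharmonic_elim[[cu _ _ _] _]; exact: bm_sphere_cont. Qed.

Lemma poisson_formula (u : E -> R) s x : rharmonic_on unit_ball u -> 0 <= s < 1 ->
  enorm x < 1 -> u (s *: x) = pois_int (fun w => u (s *: th w)) x.
Proof.
move=> hu s01 x1; have oB := @open_unit_ball R n.
have /andP[s0 s1] := s01.
have sE (y : E) : enorm (s *: y) = s * enorm y by rewrite enormZ ger0_norm.
have [[cu _ _ _] _] := rharmonic_elim hu.
have cs (y : E) : enorm y <= 1 -> {for y, continuous (fun y : E => u (s *: y))}.
  move=> y1; apply: (@continuous_comp E E R (fun y : E => s *: y) u).
    exact: continuousZl_tmp.
  by apply: cu; rewrite /unit_ball /= sE (le_lt_trans _ s1)// ler_piMr.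
have [M hM] := compact_bounded_fun (@compact_closed_ball _ n 1) cs.
have hv : rharmonic_on unit_ball (fun y => u (s *: y)).
  have := rharmonic_affine s 0 oB hu.
  rewrite (_ : (fun y => u (s *: y + 0)) = (fun y => u (s *: y))); last first.
    by apply/funext => y; rewrite addr0.
  apply: rharmonic_sub => y /= y1; rewrite /unit_ball /= addr0 sE.
  by rewrite (le_lt_trans _ s1)// ler_piMr// ltW.
apply: (poisson_formula1 hv _ hM (bm_sphere hu s01) x1).
move=> e e0; have [r r0 hr] := compact_unif_cont (@compact_closed_ball _ n 1) cs e0.
by exists r => // y w y1 yw; apply: hr => //=; exact: ltW.
Qed.

Lemma rharmonic_of_poisson (u : E -> R) :
  (forall s, 0 <= s < 1 -> bm (fun w => u (s *: th w)) /\
     forall x, enorm x < 1 -> u (s *: x) = pois_int (fun w => u (s *: th w)) x) ->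
  rharmonic_on unit_ball u.
Proof.
move=> h; have oB := @open_unit_ball R n.
suff key x0 : enorm x0 < 1 -> exists2 D : set E, D x0 & rharmonic_on D u.
  by split=> x /key[D Dx [C2 lu]]; [exact: C2|exact: lu].
move=> x01; pose s := (1 + enorm x0) / 2.
have s0 : 0 < s by rewrite divr_gt0// ltr_wpDr ?enorm_ge0.
have s01 : 0 <= s < 1 by rewrite ltW//= ltr_pdivrMr// mul1r -[2]/(1 + 1) ltrD2l.
have xs : enorm x0 < s by rewrite ltr_pdivlMr// mulr_natr mulr2n ltrD2r.
have [bs hs] := h s s01.
pose D : set E := [set x | unit_ball (s^-1 *: x + 0)].
have DE x : D x <-> enorm x < s.
  rewrite /D /unit_ball /= addr0 enormZ gtr0_norm ?invr_gt0//.
  by rewrite ltr_pdivrMl// mulr1.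
exists D; first exact/DE.
have := rharmonic_affine s^-1 0 oB (rharmonic_pois_int bs).
apply: rharmonic_ext => [|x].
  rewrite (_ : mkset _ = (fun y : E => s^-1 *: y + 0) @^-1` unit_ball)//.
  apply: open_comp => // y _.
  by apply: continuousD; [exact: continuousZl_tmp|exact: cst_continuous].
rewrite /= addr0 => xD; rewrite -hs// scalerA divff ?scale1r//.
exact: lt0r_neq0.
Qed.

Lemma poisson_near (c : R) (z : E) : 0 <= c < 1 -> enorm z = 1 -> enorm (c *: z) < 1.
Proof. by move=> /andP[c0 c1] z1; rewrite enormZ z1 mulr1 ger0_norm. Qed.

Lemma bm_comp {d1 d2 : measure_display} {T1 : measurableType d1} {T2 : measurableType d2}
  (f : T2 -> R) (p : T1 -> T2) : measurable_fun setT p -> bm f -> bm (f \o p).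
Proof.
move=> mp [mf [M fM]]; split; first exact: measurableT_comp.
by exists M => x; exact: fM.
Qed.

Lemma bm_fst (f : T -> R) : bm f -> bm (fun p : T * T => f p.1).
Proof. by move=> bf; apply: (bm_comp _ bf). Qed.

Lemma bm_snd (f : T -> R) : bm f -> bm (fun p : T * T => f p.2).
Proof. by move=> bf; apply: (bm_comp _ bf). Qed.

Lemma bm_poisson2 (c : R) : 0 <= c < 1 ->
  bm (fun p : T * T => poisson (c *: th p.1) (th p.2)).
Proof.
move=> /andP[c0 c1].
apply: bmM.
  rewrite (_ : (fun _ => _) = (fun=> 1 - c ^+ 2)); first exact: bm_cst.
  by apply/funext => p; rewrite -enorm_sqr enormZ th1 mulr1 ger0_norm.
pose q (p : T * T) := c ^+ 2 + 1 - 2 * c * \sum_i (th p.1 ord0 i * th p.2 ord0 i).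
have bq : bm q.
  apply: bmB; first exact: bm_cst.
  apply: bmM; first exact: bm_cst.
  apply: bm_sum => i; apply: bmM; [apply: (bm_fst (f := fun w => th w ord0 i))|apply: (bm_snd (f := fun w => th w ord0 i))];
    exact: bm_coord_sphere.
have qE p : dot (c *: th p.1 - th p.2) (c *: th p.1 - th p.2) = q p.
  rewrite dotBl !dotBr !dotZl !dotZr (dotC (th p.2)) -!enorm_sqr !th1 /q -/(dot _ _); ring.
split.
  rewrite (_ : (fun _ => _) = (@powR R ^~ (- (n%:R / 2))) \o q).
    by apply: measurableT_comp; [exact: measurable_powR|have [] := bq].
  by apply/funext => p; rewrite /K qE.
exists (((1 - c) ^+ 2) `^ (- (n%:R / 2))) => p.
rewrite ger0_norm ?powR_ge0//.
have c2 : 0 < (1 - c) ^+ 2 by rewrite exprn_gt0// subr_gt0.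
have h : (1 - c) ^+ 2 <= dot (c *: th p.1 - th p.2) (c *: th p.1 - th p.2).
  rewrite -enorm_sqr ler_pXn2r// ?nnegrE ?enorm_ge0 ?subr_ge0 ?(ltW c1)//.
  have := enorm_dist (th p.2) (c *: th p.1).
  rewrite enormB enormZ !th1 mulr1 (ger0_norm c0).
  by have := ler_norm (1 - c); lra.
rewrite /K !powRN lef_pV2 ?posrE ?powR_gt0//; last exact: lt_le_trans h.
by apply: ge0_ler_powR; rewrite ?nnegrE ?divr_ge0// ?ltW// (lt_le_trans c2).
Qed.

Lemma sphere_sym (F G : E -> R) a b : rharmonic_on unit_ball F ->
  rharmonic_on unit_ball G -> 0 <= a < 1 -> 0 <= b < 1 ->
  \int[P]_w (F (a *: th w) * G (b *: th w)) = \int[P]_w (F (b *: th w) * G (a *: th w)).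
Proof.
wlog ba : F G a b / b <= a.
  move=> h hF hG a01 b01; have [ba|/ltW ab] := leP b a; first exact: h.
  rewrite (_ : (fun w => _) = (fun w => G (b *: th w) * F (a *: th w))); last first.
    by apply/funext => w; rewrite mulrC.
  rewrite h//; congr Rintegral; apply/funext => w; exact: mulrC.
move=> hF hG a01 b01; have /andP[a0 a1] := a01; have /andP[b0 b1] := b01.
have [->//|ab] := eqVneq a b.
have lba : b < a by rewrite lt_neqAle eq_sym ab.
have a_gt0 : 0 < a by exact: le_lt_trans lba.
pose c := b / a.
have c01 : 0 <= c < 1 by rewrite divr_ge0//= ltr_pdivrMr// mul1r.
have bE (z : E) : b *: z = a *: (c *: z) by rewrite scalerA mulrC mulfVK// gt_eqF.
have FE (H : E -> R) w : rharmonic_on unit_ball H ->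
    H (b *: th w) = \int[P]_w' (poisson (c *: th w) (th w') * H (a *: th w')).
  by move=> hH; rewrite bE (poisson_formula hH a01)//; exact: poisson_near.
have bF := bm_sphere hF a01; have bG := bm_sphere hG a01.
have bp := bm_poisson2 c01.
pose k (p : T * T) := poisson (c *: th p.1) (th p.2) * (F (a *: th p.2) * G (a *: th p.1)).
have bk : bm k.
  apply: bmM => //; apply: bmM; first exact: (bm_snd (f := fun w => F (a *: th w))).
  exact: (bm_fst (f := fun w => G (a *: th w))).
transitivity (\int[P]_w' (\int[P]_w k (w, w'))).
  congr Rintegral; apply/funext => w.
  rewrite (FE G)// -bm_intZ; last first.
    by apply: bmM => //; apply: bm_poisson; exact: poisson_near.
  congr Rintegral; apply/funext => w'; rewrite /k /= (poisson_sym _ (th1 w) (th1 w')).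
  ring.
rewrite -(bm_fubini bk); congr Rintegral; apply/funext => w.
rewrite (FE F)// [RHS]mulrC -bm_intZ; last first.
  by apply: bmM => //; apply: bm_poisson; exact: poisson_near.
by congr Rintegral; apply/funext => w'; rewrite /k /=; ring.
Qed.

Lemma sphere_mean_le (u : E -> R) a b : rharmonic_on unit_ball u ->
  0 <= b -> b <= a -> a < 1 ->
  \int[P]_w (u (b *: th w) ^+ 2) <= \int[P]_w (u (a *: th w) ^+ 2).
Proof.
move=> hu b0; rewrite le_eqVlt => /predU1P[-> //|lba] a1.
have a_gt0 : 0 < a by exact: le_lt_trans lba.
have a01 : 0 <= a < 1 by rewrite ltW.
have b01 : 0 <= b < 1 by rewrite b0 (lt_trans lba).
pose c := b / a.
have c01 : 0 <= c < 1 by rewrite divr_ge0//= ?ltr_pdivrMr// ?mul1r ?ltW.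
have bE (z : E) : b *: z = a *: (c *: z) by rewrite scalerA mulrC mulfVK// gt_eqF.
have bu := bm_sphere hu a01; have bub := bm_sphere hu b01.
pose k (p : T * T) := poisson (c *: th p.1) (th p.2) * u (a *: th p.2) ^+ 2.
have bk : bm k.
  apply: bmM; first exact: bm_poisson2.
  by apply: (bm_snd (f := fun w => u (a *: th w) ^+ 2)); exact: bmX.
have bp w : bm (fun w' => poisson (c *: th w) (th w')).
  by apply: bm_poisson; exact: poisson_near.
apply: (@le_trans _ _ (\int[P]_w (\int[P]_w' k (w, w')))).
  apply: bm_int_le; [exact: bmX|exact: bm_int1|move=> w].
  set m := u (b *: th w).
  have mE : m = \int[P]_w' (poisson (c *: th w) (th w') * u (a *: th w')).
    by rewrite /m bE (poisson_formula hu a01)//; exact: poisson_near.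
  have : 0 <= \int[P]_w' (poisson (c *: th w) (th w') * (u (a *: th w') - m) ^+ 2).
    apply: Rintegral_ge0 => w' _; rewrite mulr_ge0 ?sqr_ge0//.
    by apply: poisson_ge0; rewrite ltW// poisson_near.
  rewrite (_ : (fun _ => _) = (fun w' => k (w, w') - 2 * m * (poisson (c *: th w) (th w') * u (a *: th w'))
      + m ^+ 2 * poisson (c *: th w) (th w'))); last first.
    by apply/funext => w'; rewrite /k /=; ring.
  have bk1 : bm (fun w' => k (w, w')) by exact: bm_sec1.
  have bpu : bm (fun w' => poisson (c *: th w) (th w') * u (a *: th w')) by exact: bmM.
  have bc r : bm (fun _ : T => r) by exact: bm_cst.
  rewrite bm_intD; [|by apply: bmB => //; exact: bmM|exact: bmM].
  rewrite bm_intB//; last exact: bmM.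
  rewrite (bm_intZ (2 * m) bpu) (bm_intZ (m ^+ 2) (bp w)) -mE int_poisson; last exact: poisson_near.
  rewrite -/(m ^+ 2); nra.
rewrite (bm_fubini bk) le_eqVlt; apply/orP; left; apply/eqP.
congr Rintegral; apply/funext => w'.
rewrite /k /= (_ : (fun _ => _) = (fun w => u (a *: th w') ^+ 2 * poisson (c *: th w') (th w))).
  by rewrite bm_intZ// int_poisson ?mulr1//; exact: poisson_near.
by apply/funext => w; rewrite mulrC (poisson_sym _ (th1 w) (th1 w')).
Qed.

End sphere_integrals.

(** * Polar decomposition of the measure *)

Section borel_maps.
Context {R : realType} {n : nat}.
Local Notation E := 'rV[R]_n.
Local Notation B_ := (borel_rV R n).

Lemma continuous_on_measurable_map (D : set E) (f : E -> E) : open D ->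
  (forall x, D x -> {for x, continuous f}) ->
  measurable_fun (D : set B_) (f : B_ -> B_).
Proof.
move=> oD cf; have gE : @measurable _ B_ = <<s (@open E : set (set B_)) >> by [].
apply: (@measurability _ _ B_ B_ D f _ gE) => /= _ [A oA <-].
apply: measurable_open; rewrite openE => x [Dx Afx].
have : \forall y \near x, A (f y).
  by apply: (cf x Dx); exact: open_nbhs_nbhs.
have : \forall y \near x, D y by exact: open_nbhs_nbhs.
by apply: (@filterS2 _ _ (nbhs_filter x)).
Qed.

Lemma continuous_mulmx (O : 'M[R]_n) : O *m O^T = 1%:M ->
  continuous (fun x : E => x *m O).
Proof.
move=> OO x A /nbhs_enorm[e e0 eA]; apply/nbhs_enorm; exists e => // y xy.
by apply: eA; rewrite -mulmxBl enorm_orth.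
Qed.

Lemma measurable_mulmx (O : 'M[R]_n) : O *m O^T = 1%:M ->
  measurable_fun setT ((fun x => x *m O) : B_ -> B_).
Proof.
by move=> OO; apply: continuous_on_measurable_map;
  [exact: openT|move=> x _; exact: continuous_mulmx].
Qed.

Lemma preimage_mulmx (O : 'M[R]_n) (A : set E) : O *m O^T = 1%:M ->
  (fun x : E => x *m O) @^-1` A = [set x *m O^T | x in A].
Proof.
move=> OO; apply/seteqP; split => [x Ax|_ [x Ax <-]] /=.
  by exists (x *m O) => //; rewrite -mulmxA OO mulmx1.
by rewrite -mulmxA orth_tr// mulmx1.
Qed.

Lemma integral_orth (Q : probability B_ R) (O : 'M[R]_n) (f : B_ -> \bar R) :
  orthogonal_invariant Q -> O *m O^T = 1%:M -> measurable_fun setT f ->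
  (forall x, (0 <= f x)%E) -> (\int[Q]_x f (x *m O) = \int[Q]_x f x)%E.
Proof.
move=> iQ OO mf f0; have mO := measurable_mulmx OO.
rewrite -[LHS](@ge0_integral_pushforward _ _ _ _ _ _ mO Q setT f)//.
apply: eq_measure_integral => A mA _.
rewrite [LHS](_ : _ = Q ((fun x : E => x *m O) @^-1` A))// preimage_mulmx// iQ//.
by rewrite trmxK orth_tr.
Qed.

Lemma bm_int_orth (Q : probability B_ R) (O : 'M[R]_n) (f : B_ -> R) :
  orthogonal_invariant Q -> O *m O^T = 1%:M -> bm f ->
  \int[Q]_x f (x *m O) = \int[Q]_x f x.
Proof.
move=> iQ OO bf; have [mf [M fM]] := bf; have mO := measurable_mulmx OO.
have bfO : bm (fun x : B_ => f (x *m O)).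
  by split; [exact: (measurableT_comp mf mO)|exists M => x; exact: fM].
have bM : bm (fun _ : B_ => `|M|) by exact: bm_cst.
apply: (addIr `|M|); rewrite -{1 2}(@bm_int_cst _ _ _ Q `|M|) -!bm_intD//.
have f0 x : 0 <= f x + `|M|.
  have := fM x; have := ler_norm M; rewrite ler_norml => ? /andP[]; lra.
have bfM : bm (fun x => f x + `|M|) by exact: bmD.
apply: EFin_inj; rewrite -!bm_int_EFin//; last exact: bmD.
apply: (@integral_orth Q O (fun x => (f x + `|M|)%:E)) => //.
by apply/measurable_EFinP; have [] := bfM.
Qed.

Lemma bm_int_null (Q : probability B_ R) (Z : set B_) (f g : B_ -> R) :
  measurable Z -> Q Z = 0%E -> bm f -> bm g -> (forall x, ~ Z x -> f x = g x) ->
  \int[Q]_x f x = \int[Q]_x g x.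
Proof.
move=> mZ Z0 bf bg fg; apply: EFin_inj; rewrite -!bm_int_EFin//.
apply: ae_eq_integral => //.
- by apply/measurable_EFinP; have [] := bf.
- by apply/measurable_EFinP; have [] := bg.
exists Z; split => // x /= h; apply: contrapT => Zx; apply: h => _.
by rewrite fg.
Qed.

End borel_maps.

Section direction.
Context {R : realType} {n : nat}.
Local Notation E := 'rV[R]_n.
Local Notation B_ := (borel_rV R n).
Variable i0 : 'I_n.

Definition dir (x : E) : E :=
  if x == 0 then delta_mx ord0 i0 else (enorm x)^-1 *: x.

Lemma enorm_dir x : enorm (dir x) = 1.
Proof.
rewrite /dir; case: eqVneq => [_|x0]; first exact: enorm_delta.
by rewrite enormZ gtr0_norm ?invr_gt0 ?enorm_gt0// mulVf// enorm_eq0.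
Qed.

Lemma dir1 x : enorm x = 1 -> dir x = x.
Proof.
move=> x1; rewrite /dir x1 invr1 scale1r ifN//.
by rewrite -enorm_gt0 x1.
Qed.

Lemma dirK x : enorm x *: dir x = x.
Proof.
rewrite /dir; case: eqVneq => [->|x0]; first by rewrite enorm0 scale0r.
by rewrite scalerA mulfV ?scale1r// enorm_eq0.
Qed.

Lemma dir_orth O x : O *m O^T = 1%:M -> x != 0 -> dir (x *m O) = dir x *m O.
Proof.
move=> OO x0; have xO : x *m O != 0 by rewrite -enorm_gt0 enorm_orth// enorm_gt0.
by rewrite /dir (negbTE x0) (negbTE xO) enorm_orth// scalemxAl.
Qed.

Lemma measurable_set1_0 : measurable ([set 0] : set B_).
Proof.
rewrite -[X in measurable X]setCK; apply: measurableC; apply: measurable_open.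
rewrite (_ : ~` _ = [set y : E | y != 0]); first exact: open_neq0.
by apply/seteqP; split => y /= /eqP.
Qed.

Lemma measurable_dir : measurable_fun setT (dir : B_ -> B_).
Proof.
have mb : measurable_fun setT (fun x : B_ => x == 0).
  apply: (@measurable_fun_bool _ _ setT _ true).
  rewrite setTI (_ : _ @^-1` _ = [set 0]); first exact: measurable_set1_0.
  by apply/seteqP; split => x /= /eqP.
apply: measurable_fun_if => //.
rewrite setTI (_ : _ @^-1` _ = [set y : E | y != 0]); last first.
  by apply/seteqP; split => x /=; [move=> ->|move=> /negbTE].
apply: continuous_on_measurable_map; first exact: open_neq0.
move=> x x0; apply: continuousZ; last by [].
apply: continuousV; first by rewrite enorm_eq0.
exact: continuous_enorm.
Qed.

End direction.

Section sphere_probability.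
Context {R : realType} {n : nat}.
Local Notation E := 'rV[R]_n.
Local Notation B_ := (borel_rV R n).
Variable nu : probability B_ R.
Hypothesis nu_inv : orthogonal_invariant nu.
Hypothesis nu_bd : charges_boundary nu.
Variable i0 : 'I_n.

Let D0 : set B_ := ~` [set 0].
Let mD0 : measurable D0. Proof. exact: measurableC measurable_set1_0. Qed.

(* The mass of nu at the origin has no direction, so it is removed before projecting
   to the sphere. *)
Definition away : probability B_ R := mnormalize (mrestr nu mD0) nu.

Let D0_gt0 : (0 < nu D0)%E.
Proof.
have h : 0 < (2^-1 : R) < 1 by rewrite invr_gt0 ltr0n invf_lt1// ltr1n.
apply: lt_le_trans (nu_bd h) _; apply: le_measure; rewrite ?inE//.
  rewrite (_ : mkset _ = unit_ball `&` (enorm @^-1` `[2^-1, +oo[)).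
    apply: measurableI; first by apply: measurable_open; exact: open_unit_ball.
    by rewrite -[X in measurable X]setTI; exact: measurable_enorm.
  by apply/seteqP; split => x /= [xB]; rewrite in_itv /= andbT.
move=> x [_ /= xr] x0; move: xr; rewrite x0 enorm0 leNgt.
by case/andP: h => ->.
Qed.

Let awayE A : away A = (nu (A `&` D0) * (fine (nu D0))^-1%:E)%E.
Proof.
rewrite /away /= /mnormalize /= /mrestr setTI.
have /negbTE -> : nu D0 != 0%E by rewrite gt_eqF.
have /negbTE -> // : nu D0 != +oo%E.
by rewrite lt_eqF//; apply: le_lt_trans (ltry 1); exact: probability_le1.
Qed.

Lemma away0 : away [set 0] = 0%E.
Proof. by rewrite awayE /D0 setICr measure0 mul0e. Qed.

Lemma away_inv : orthogonal_invariant away.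
Proof.
move=> O OO A mA; rewrite !awayE; congr (_ * _)%E.
rewrite -(nu_inv OO (measurableI _ _ mA mD0)); congr (nu _).
apply/seteqP; split=> [_ [[x Ax <-] x0]|_ [x [Ax x0] <-]].
  by exists x => //; split => // xE; apply: x0; rewrite /= xE mul0mx.
split; first by exists x.
move=> /= xO; apply: x0 => /=; apply/eqP; rewrite -enorm_eq0 -(enorm_orth x OO).
by rewrite enorm_eq0; apply/eqP.
Qed.

Lemma dir_inv O : O *m O^T = 1%:M -> forall g : E -> R,
  bm (fun w : B_ => g (dir i0 w)) ->
  \int[away]_w g (dir i0 w *m O) = \int[away]_w g (dir i0 w).
Proof.
move=> OO g bg.
have g1 z : enorm z = 1 -> g z = g (dir i0 z) by move=> /dir1 ->.
have b1 : bm (fun w : B_ => g (dir i0 w *m O)).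
  rewrite (_ : (fun _ => _) = (fun w => g (dir i0 w)) \o ((fun x => x *m O) \o dir i0)).
    apply: bm_comp bg; apply: (measurableT_comp (measurable_mulmx OO)).
    exact: measurable_dir.
  by apply/funext => w /=; rewrite -g1// enorm_orth// enorm_dir.
have b2 : bm (fun w : B_ => g (dir i0 (w *m O))).
  exact: (bm_comp (measurable_mulmx OO) bg).
rewrite -[RHS](bm_int_orth away_inv OO bg).
apply: (bm_int_null measurable_set1_0 away0) => // x /= /eqP x0.
by rewrite dir_orth.
Qed.

End sphere_probability.

Section polar.
Context {R : realType} {n : nat}.
Local Notation E := 'rV[R]_n.
Local Notation B_ := (borel_rV R n).
Variables nu P : probability B_ R.
Variable i0 : 'I_n.
Local Notation th := (dir i0).
Hypothesis n_gt0 : (0 < n)%N.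
Hypothesis nu_inv : orthogonal_invariant nu.
Hypothesis P_inv : forall O, O *m O^T = 1%:M -> forall g : E -> R,
  bm (fun w : B_ => g (dir i0 w)) ->
  \int[P]_w g (dir i0 w *m O) = \int[P]_w g (dir i0 w).

Let mth := @measurable_dir R n i0.
Let th1 := @enorm_dir R n i0.

Lemma bm_radial_dir (k : E -> R) : bm (k : B_ -> R) -> (forall x, enorm x = 0 -> k x = 0) ->
  (forall O x, O *m O^T = 1%:M -> k (x *m O) = k x) -> forall y, enorm y < 1 ->
  \int[nu]_x (poisson y (th x) * k x) = \int[nu]_x k x.
Proof.
move=> bk k0 kO y y1; pose u := @pois_int R n _ _ nu th k.
have hu : rharmonic_on unit_ball u by apply: rharmonic_pois_int => //; exact: mth.
have u0 : u 0 = \int[nu]_x k x.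
  by congr Rintegral; apply/funext => x; rewrite poisson0// mul1r.
rewrite -u0 -[LHS]/(u y); apply: (radial_constant n_gt0 hu _ y1).
move=> O z OO z1; have OT : O^T *m O^T^T = 1%:M by rewrite trmxK orth_tr.
have zO1 : enorm (z *m O) < 1 by rewrite enorm_orth.
rewrite /u /pois_int -[RHS](bm_int_orth nu_inv OT); last first.
  by apply: bm_pois_int => //; exact: mth.
suff pt (x : E) : poisson (z *m O) (th x) * k x =
    poisson z (th (x *m O^T)) * k (x *m O^T).
  by congr Rintegral; apply/funext => x; exact: pt.
(* Proof terms, because rewriting would try to convert x *m O^T to x. *)
have kx : k (x *m O^T) = k x := kO O^T x OT.
have [x0|x0] := eqVneq (enorm x) 0.
  have k1 := k0 x x0; have k2 := etrans kx k1.
  exact (etrans (etrans (congr1 _ k1) (mulr0 _)) (esym (etrans (congr1 _ k2) (mulr0 _)))).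
have x1 : x != 0 by rewrite -enorm_eq0.
have tx : th (x *m O^T) = th x *m O^T := @dir_orth R n i0 O^T x OT x1.
have px := etrans (poisson_orthl z (th x) OO) (congr1 (poisson z) (esym tx)).
exact (congr2 *%R px (esym kx)).
Qed.

Lemma polar_base (k g : E -> R) : bm (k : B_ -> R) -> (forall x, enorm x = 0 -> k x = 0) ->
  (forall O x, O *m O^T = 1%:M -> k (x *m O) = k x) ->
  bm (fun x : B_ => g (th x)) ->
  (forall e : R, 0 < e -> exists2 d : R, 0 < d & forall z z', enorm z = 1 -> enorm z' = 1 ->
    enorm (z - z') < d -> `|g z - g z'| < e) ->
  \int[nu]_x (k x * g (th x)) = \int[nu]_x k x * \int[P]_w g (th w).
Proof.
move=> bk k0 kO bg ug.
have [_ [M0 gM0]] := bg; pose M := `|M0|.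
have gM z : enorm z = 1 -> `|g z| <= M.
  by move=> /(dir1 i0) <-; rewrite (le_trans (gM0 z))// ler_norm.
have [_ [N0 kN0]] := bk; pose N := `|N0|.
have kN x : `|k x| <= N by rewrite (le_trans (kN0 x))// ler_norm.
have M_ge0 : 0 <= M by exact: normr_ge0.
have N_ge0 : 0 <= N by exact: normr_ge0.
pose gt t z := @pois_int R n _ _ P th (fun w => g (th w)) (t *: z).
have bp t : 0 <= t < 1 -> bm (fun p : B_ * B_ => poisson (t *: th p.1) (th p.2)).
  by move=> t01; apply: (bm_poisson2 mth th1 t01).
have fub t : 0 <= t < 1 -> bm (fun x : B_ => gt t (th x)) /\
    \int[nu]_x (k x * gt t (th x)) = \int[nu]_x k x * \int[P]_w g (th w).
  move=> t01.
  have bq : bm (fun p : B_ * B_ => poisson (t *: th p.1) (th p.2) * g (th p.2)).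
    by apply: bmM; [exact: bp|exact: (bm_comp _ bg)].
  have bf : bm (fun p : B_ * B_ => k p.1 * (poisson (t *: th p.1) (th p.2) * g (th p.2))).
    by apply: bmM; [exact: (bm_comp _ bk)|].
  split; first exact: (bm_int1 bq).
  transitivity (\int[nu]_x (\int[P]_w (k x * (poisson (t *: th x) (th w) * g (th w))))).
    by congr Rintegral; apply/funext => x; rewrite bm_intZ//; exact: (bm_sec1 bq).
  rewrite (bm_fubini bf) -bm_intZ//; congr Rintegral; apply/funext => w.
  have tw : enorm (t *: th w) < 1 by apply: poisson_near => //; exact: th1.
  rewrite -(bm_radial_dir bk k0 kO tw) mulrC -bm_intZ; last first.
    by apply: bm_pois_int => //; exact: mth.
  congr Rintegral; apply/funext => x /=.
  rewrite (poisson_sym _ (th1 x) (th1 w)); ring.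
have appr e : 0 < e -> exists2 t : R, 0 <= t < 1 &
    forall z, enorm z = 1 -> `|gt t z - g z| <= e.
  move=> e0; have [d d0 hd] := ug _ (divr_gt0 e0 (ltr0n _ 2)).
  pose C := ((d / 2) ^+ 2) `^ (- (n%:R / 2)) : R.
  have C0 : 0 <= C by exact: powR_ge0.
  have MC := mulr_ge0 M_ge0 C0.
  pose D := 8 * (M * C + 1) + e + e / d *+ 2.
  have D0 : 0 < D by have : 0 < e / d by [exact: divr_gt0]; rewrite /D mulr2n; lra.
  pose s := e / D.
  have s0 : 0 < s by rewrite divr_gt0.
  have sD : s * D = e by rewrite /s divfK// gt_eqF.
  have ed : 0 < e / d by exact: divr_gt0.
  have s1 : s <= 1.
    by rewrite ler_pdivrMr// mul1r /D mulr2n; lra.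
  have sd : s <= d / 2.
    rewrite ler_pdivrMr// /D.
    rewrite (_ : d / 2 * _ = d / 2 * (8 * (M * C + 1) + e) + e); last by field; rewrite gt_eqF.
    by rewrite lerDr mulr_ge0 ?divr_ge0 ?(ltW d0)//; lra.
  have sMC : 8 * (s * (M * C)) <= e.
    rewrite -[leRHS]sD /D.
    rewrite [leRHS](_ : _ = 8 * (s * (M * C)) + s * (8 + e + e / d *+ 2)); last by ring.
    by rewrite lerDl mulr_ge0 ?(ltW s0)// mulr2n; lra.
  pose t := 1 - s.
  have t01 : 0 <= t < 1 by rewrite /t subr_ge0 s1 ltrBlDr ltrDl.
  exists t => // z z1; have /andP[t0 t1] := t01.
  have tz1 : enorm (t *: z) < 1 by exact: poisson_near.
  have bpz : bm (fun w : B_ => poisson (t *: z) (th w)).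
    by apply: bm_poisson => //; exact: mth.
  have ip := int_poisson mth th1 n_gt0 P_inv tz1.
  have bgz : bm (fun w : B_ => g (th w) - g z) by apply: bmB => //; exact: bm_cst.
  have -> : gt t z - g z = \int[P]_w (poisson (t *: z) (th w) * (g (th w) - g z)).
    rewrite -[g z in LHS]mulr1 -ip -bm_intZ// /gt /pois_int -bm_intB.
    - by congr Rintegral; apply/funext => w; ring.
    - exact: bmM.
    - by apply: bmM => //; exact: bm_cst.
  apply: le_trans (bm_int_abs (bmM bpz bgz)) _.
  have bc r : bm (fun _ : B_ => r) by exact: bm_cst.
  apply: (@le_trans _ _ (\int[P]_w (e / 2 * poisson (t *: z) (th w) + 2 * M * (2 * s) * C))).
    apply: bm_int_le.
    - by apply: bm_abs; exact: bmM.
    - by apply: bmD => //; exact: bmM.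
    move=> w; have p0 := poisson_ge0 (th w) (ltW tz1).
    rewrite normrM ger0_norm//.
    have [zs|zs] := ltP (enorm (th w - z)) d.
      apply: (@le_trans _ _ (e / 2 * poisson (t *: z) (th w))).
        by rewrite mulrC ler_wpM2r// ltW// hd.
      rewrite lerDl (_ : 2 * M * _ * C = 4 * (s * (M * C))); last by ring.
      by apply: mulr_ge0 => //; apply: mulr_ge0 => //; exact: ltW.
    apply: (@le_trans _ _ (2 * M * (2 * s) * C)); last first.
      by rewrite lerDr mulr_ge0// divr_ge0// ltW.
    rewrite [leRHS](_ : _ = (2 * s) * C * (2 * M)); last by ring.
    apply: ler_pM => //; last first.
      apply: le_trans (ler_normB _ _) _; rewrite mulr_natl mulr2n lerD// gM//.
    apply: le_trans (poisson_far (e := d / 2) _ _ (ltW tz1)) _.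
    - by rewrite divr_gt0.
    - have := enormD (t *: z - th w) ((1 - t) *: z).
      have -> : t *: z - th w + (1 - t) *: z = z - th w.
        by rewrite addrAC -scalerDl addrC (addrC t) subrK scale1r addrC.
      have -> : 1 - t = s by rewrite /t; ring.
      by rewrite enormZ z1 mulr1 gtr0_norm// enormB; lra.
    - apply: ler_wpM2r => //; rewrite -enorm_sqr enormZ z1 mulr1 ger0_norm// /t.
      by rewrite -subr_ge0 (_ : _ - _ = s ^+ 2) ?sqr_ge0//; ring.
  rewrite bm_intD//; last by apply: bmM.
  rewrite bm_intZ// ip mulr1 bm_int_cst.
  rewrite (_ : 2 * M * (2 * s) * C = 4 * (s * (M * C))); last by ring.
  lra.
have bkg : bm (fun x : B_ => k x * g (th x)) by exact: bmM.
apply/eqP; rewrite -subr_eq0 -normr_eq0 eq_le normr_ge0 andbT.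
apply/ler_addgt0Pr => e e0; rewrite add0r.
have N1 : 0 < N + 1 by rewrite ltr_wpDl.
have [t t01 ht] := appr _ (divr_gt0 e0 N1).
have [bgt <-] := fub t t01.
rewrite -bm_intB//; last exact: bmM.
apply: bm_int_norm_le; first by apply: bmB => //; exact: bmM.
move=> x; rewrite -mulrBr normrM distrC.
apply: (@le_trans _ _ (N * (e / (N + 1)))).
  by apply: ler_pM => //; exact: ht (th1 x).
by rewrite mulrA ler_pdivrMr// [leLHS]mulrC ler_wpM2l ?(ltW e0)// lerDl.
Qed.

End polar.

Section polar_coordinates.
Context {R : realType} {n : nat}.
Local Notation E := 'rV[R]_n.
Local Notation B_ := (borel_rV R n).
Variables nu P : probability B_ R.
Variable i0 : 'I_n.
Local Notation th := (dir i0).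
Hypothesis n_gt0 : (0 < n)%N.
Hypothesis nu_inv : orthogonal_invariant nu.
Hypothesis P_inv : forall O, O *m O^T = 1%:M -> forall g : E -> R,
  bm (fun w : B_ => g (dir i0 w)) ->
  \int[P]_w g (dir i0 w *m O) = \int[P]_w g (dir i0 w).

Let mth := @measurable_dir R n i0.
Let th1 := @enorm_dir R n i0.

Definition cball (s : R) : set E := [set x | enorm x <= s].

Lemma measurable_cball s : measurable (cball s : set B_).
Proof.
rewrite (_ : cball s = enorm @^-1` `]-oo, s]).
  by rewrite -[X in measurable X]setTI; exact: measurable_enorm.
by apply/seteqP; split => x; rewrite /cball /= in_itv.
Qed.

Lemma bm_indic (A : set B_) : measurable A -> bm (\1_A : B_ -> R).
Proof.
move=> mA; split; first exact: measurable_indic.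
by exists 1 => x; rewrite indicE; case: (x \in A); rewrite ?normr1 ?normr0.
Qed.

Lemma bm_restrict (A : set B_) (f : B_ -> R) M : measurable A -> measurable_fun A f ->
  (forall x, A x -> `|f x| <= M) -> bm (fun x => \1_A x * f x).
Proof.
move=> mA mf fM; split; last first.
  exists `|M| => x; rewrite indicE; case: (boolP (x \in A)); rewrite ?mul1r ?mul0r ?normr0// inE => Ax.
  by rewrite (le_trans (fM x Ax))// ler_norm.
rewrite (_ : (fun x => _) = f \_ A); first exact/(measurable_restrictT _ _).1.
by apply/funext => x; rewrite patchE indicE; case: (x \in A); rewrite ?mul1r ?mul0r.
Qed.

Variable G : E -> R.
Hypothesis cG : forall x, enorm x < 1 -> {for x, continuous G}.

Definition smean (r : R) : R := \int[P]_w G (r *: th w).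

Lemma bm_smean r : 0 <= r < 1 -> bm (fun w : B_ => G (r *: th w)).
Proof. by move=> r01; apply: (bm_sphere_cont mth th1 cG r01). Qed.

Lemma smean_unif s e : s < 1 -> 0 < e -> exists2 d : R, 0 < d &
  (forall x, enorm x <= s -> forall y, enorm (x - y) < d -> `|G x - G y| < e) /\
  (forall r, 0 <= r <= s -> forall r', 0 <= r' < 1 -> `|r - r'| < d -> `|smean r - smean r'| <= e).
Proof.
move=> s1 e0; have cs (x : E) : cball s x -> {for x, continuous G}.
  by move=> xs; apply: cG; exact: le_lt_trans xs s1.
have [d d0 hd] := compact_unif_cont (@compact_closed_ball _ n s) cs e0.
exists d => //; split=> [x xs y xy|r /andP[r0 rs] r' r'01 rr']; first exact: hd.
have r01 : 0 <= r < 1 by rewrite r0 (le_lt_trans rs).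
rewrite /smean -bm_intB; [|exact: bm_smean|exact: bm_smean].
apply: bm_int_norm_le; first by apply: bmB; exact: bm_smean.
move=> w; apply/ltW/hd.
  by rewrite /= enormZ th1 mulr1 ger0_norm.
by rewrite -scalerBl enormZ th1 mulr1.
Qed.

Lemma measurable_G : measurable_fun (unit_ball : set B_) (G : B_ -> R).
Proof. by apply: continuous_on_measurable => //; exact: open_unit_ball. Qed.

Lemma measurable_smean : measurable_fun (unit_ball : set B_) ((smean \o enorm) : B_ -> R).
Proof.
apply: continuous_on_measurable => [|x x1]; first exact: open_unit_ball.
apply/continuous_enormP => e e0.
pose s := (1 + enorm x) / 2.
have s1 : s < 1 by rewrite ltr_pdivrMr// mul1r -[2]/(1 + 1) ltrD2l.
have xs : enorm x < s by rewrite ltr_pdivlMr// mulr_natr mulr2n ltrD2r.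
have [d d0 [_ hd]] := smean_unif s1 (divr_gt0 e0 (ltr0n _ 2)).
exists (Num.min d (1 - enorm x)); first by rewrite lt_min d0 subr_gt0.
move=> y; rewrite lt_min => /andP[xy xy1].
have y1 : enorm y < 1.
  have := enormD (y - x) x; rewrite subrK enormB; lra.
apply: (@le_lt_trans _ _ (e / 2)); last by rewrite ltr_pdivrMr// ltr_pMr// ltr1n.
apply: hd; rewrite ?enorm_ge0 ?(ltW xs)//=.
exact: le_lt_trans (enorm_dist _ _) xy.
Qed.

Lemma polar_trunc s : 0 <= s < 1 ->
  [/\ bm (fun x : B_ => \1_(cball s) x * G x),
      bm (fun x : B_ => \1_(cball s) x * smean (enorm x)) &
  \int[nu]_x (\1_(cball s) x * G x) = \int[nu]_x (\1_(cball s) x * smean (enorm x)) ].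
Proof.
move=> /andP[s0 s1]; have ms := measurable_cball s.
have sB : cball s `<=` unit_ball by move=> x xs; exact: le_lt_trans xs s1.
have cs (x : E) : cball s x -> {for x, continuous G} by move=> /sB; exact: cG.
have [M hM] := compact_bounded_fun (@compact_closed_ball _ n s) cs.
have mB : measurable (unit_ball : set B_) by apply: measurable_open; exact: open_unit_ball.
have hM' r : 0 <= r <= s -> `|smean r| <= M.
  move=> /andP[r0 rs]; apply: bm_int_norm_le.
    by apply: bm_smean; rewrite r0 (le_lt_trans rs).
  by move=> w; apply: hM; rewrite /= enormZ th1 mulr1 ger0_norm.
have b1 : bm (fun x : B_ => \1_(cball s) x * G x).
  by apply: (@bm_restrict _ _ M) => //; exact: measurable_funS mB sB measurable_G.
have b2 : bm (fun x : B_ => \1_(cball s) x * smean (enorm x)).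
  apply: (@bm_restrict _ (fun x : B_ => smean (enorm x)) M) => //.
    exact: measurable_funS mB sB measurable_smean.
  by move=> x xs; apply: hM'; rewrite enorm_ge0.
split=> //.
suff key e : 0 < e -> `|\int[nu]_x (\1_(cball s) x * G x) -
    \int[nu]_x (\1_(cball s) x * smean (enorm x))| <= e + e.
  apply/eqP; rewrite -subr_eq0 -normr_eq0 eq_le normr_ge0 andbT.
  apply/ler_addgt0Pr => e e0; rewrite add0r.
  by apply: le_trans (key _ (divr_gt0 e0 (ltr0n _ 2))) _; rewrite -splitr.
move=> e0; have [d d0 [hG hm]] := smean_unif s1 e0.
pose N := (Num.truncn d^-1).+1.
have N0 : 0 < N%:R :> R by rewrite ltr0n.
have Nd : N%:R^-1 < d.
  by rewrite -[ltRHS]invrK ltf_pV2 ?posrE ?invr_gt0// truncnS_gt.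
pose A (k : 'I_N) : set E := [set x | k%:R / N%:R <= enorm x < k.+1%:R / N%:R].
pose c (k : 'I_N) (x : E) : R := \1_(cball s) x * \1_(A k) x.
have mA k : measurable (A k : set B_).
  rewrite (_ : A k = enorm @^-1` `[k%:R / N%:R, k.+1%:R / N%:R[).
    by rewrite -[X in measurable X]setTI; exact: measurable_enorm.
  by apply/seteqP; split => x; rewrite /A /= in_itv.
have bc k : bm (c k : B_ -> R) by apply: bmM; apply: bm_indic.
have kN (k : 'I_N) : 0 <= (k%:R / N%:R : R) < 1.
  by rewrite divr_ge0//= ltr_pdivrMr// mul1r ltr_nat.
have sum1 x : enorm x <= s -> \sum_k c k x = 1.
  move=> xs; have Nx : 0 <= N%:R * enorm x by rewrite mulr_ge0 ?enorm_ge0.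
  have /andP[k1 k2] := truncn_itv Nx; set k := Num.truncn _ in k1 k2.
  have kN' : (k < N)%N.
    rewrite -(ltr_nat R); apply: le_lt_trans k1 _.
    by rewrite -[ltRHS]mulr1 ltr_pM2l// (le_lt_trans xs).
  rewrite (bigD1 (Ordinal kN'))//= big1 ?addr0.
    rewrite /c !indicE mem_set// mul1r mem_set//.
    by rewrite /A /= ler_pdivrMr// mulrC k1 /= ltr_pdivlMr// mulrC.
  move=> j jk; rewrite /c [X in _ * X](_ : _ = 0) ?mulr0// indicE memNset//.
  rewrite /A /= ler_pdivrMr// ltr_pdivlMr// (mulrC (enorm x)) => /andP[j1 j2].
  move/negP: jk; apply; apply/eqP/val_inj => /=; apply/eqP; rewrite eqn_leq.
  have h1 : (j < k.+1)%N by rewrite -(ltr_nat R) (le_lt_trans j1).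
  have h2 : (k < j.+1)%N by rewrite -(ltr_nat R) (le_lt_trans k1).
  by rewrite -ltnS h1 -ltnS h2.
have sum0 x : ~ enorm x <= s -> forall k, c k x = 0.
  by move=> xs k; rewrite /c indicE memNset ?mul0r.
have approx (F : E -> R) (Fk : 'I_N -> E -> R) :
    bm (fun x : B_ => \1_(cball s) x * F x) -> (forall k, bm (fun x : B_ => Fk k x)) ->
    (forall k x, enorm x <= s -> A k x -> `|F x - Fk k x| <= e) ->
    `|\int[nu]_x (\1_(cball s) x * F x) - \sum_k \int[nu]_x (c k x * Fk k x)| <= e.
  move=> bF bFk hF; have bcF k : bm (fun x : B_ => c k x * Fk k x) by exact: bmM.
  rewrite -bm_int_sum// -bm_intB//; last exact: bm_sum.
  apply: bm_int_norm_le; first by apply: bmB => //; exact: bm_sum.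
  move=> x; have [xs|xs] := pselect (enorm x <= s); last first.
    rewrite indicE memNset// mul0r sub0r normrN big1 ?normr0 ?(ltW e0)// => k _.
    by rewrite sum0 ?mul0r.
  rewrite indicE mem_set//= -(sum1 x xs) mulr_suml -sumrB.
  apply: le_trans (ler_norm_sum _ _ _) _.
  rewrite -[leRHS]mul1r -(sum1 x xs) mulr_suml; apply: ler_sum => k _.
  rewrite -mulrBr normrM ger0_norm; last by rewrite mulr_ge0// indicE.
  have [Ax|Ax] := pselect (A k x).
    by apply: ler_wpM2l (hF k x xs Ax); rewrite mulr_ge0// indicE.
  have -> : c k x = 0 by rewrite /c [X in _ * X](_ : _ = 0) ?mulr0// indicE memNset.
  by rewrite !mul0r.
have Ad (k : 'I_N) x : A k x -> `|enorm x - k%:R / N%:R| < d.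
  move=> /andP[k1 k2]; rewrite ger0_norm ?subr_ge0//; apply: lt_trans Nd.
  rewrite ltrBlDr; apply: lt_le_trans k2 _.
  by rewrite -natr1 mulrDl mul1r addrC.
have a1 : `|\int[nu]_x (\1_(cball s) x * G x) -
    \sum_k \int[nu]_x (c k x * G (k%:R / N%:R *: th x))| <= e.
  apply: (@approx G (fun k x => G (k%:R / N%:R *: th x)) b1 (fun k => bm_smean (kN k))) => k x xs Ax.
  apply/ltW/hG => //; rewrite -[X in X - _](dirK i0 x) -scalerBl enormZ th1 mulr1.
  exact: Ad.
have a2 : `|\int[nu]_x (\1_(cball s) x * smean (enorm x)) -
    \sum_k \int[nu]_x (c k x * smean (k%:R / N%:R))| <= e.
  apply: (@approx (fun x => smean (enorm x)) (fun k x => smean (k%:R / N%:R)) b2 (fun k => bm_cst _)) => k x xs Ax; apply: hm => //; first by rewrite enorm_ge0.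
  exact: Ad.
have eq k : \int[nu]_x (c k x * G (k%:R / N%:R *: th x)) =
    \int[nu]_x (c k x * smean (k%:R / N%:R)).
  have [k0|k0] := eqVneq (k : nat) 0%N.
    congr Rintegral; apply/funext => x; congr (_ * _).
    rewrite /smean k0 mul0r; rewrite (_ : (fun w => _) = (fun=> G 0)).
      by rewrite bm_int_cst scale0r.
    by apply/funext => w; rewrite scale0r.
  rewrite [RHS](_ : _ = \int[nu]_x (smean (k%:R / N%:R) * c k x)); last first.
    by congr Rintegral; apply/funext => x; rewrite mulrC.
  rewrite bm_intZ// [RHS]mulrC.
  apply: (@polar_base _ _ nu P i0 n_gt0 nu_inv P_inv (c k) (fun z => G (k%:R / N%:R *: z))) => //.
  - move=> x x0; rewrite /c [X in _ * X](_ : _ = 0) ?mulr0// indicE memNset//.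
    by rewrite /A /= x0 leNgt divr_gt0// ltr0n lt0n.
  - move=> O x OO; rewrite /c !indicE; have xO := enorm_orth x OO.
    by congr (_%:R * _%:R); congr nat_of_bool; apply/idP/idP => /set_mem h;
      apply/mem_set; move: h; rewrite /cball /A /= xO.
  - exact: bm_smean (kN k).
  - move=> e' e'0; have /andP[kN0 kN1] := kN k.
    have [d' d'0 [hd' _]] := smean_unif kN1 e'0.
    exists d' => // z z' z1 z'1 zz'.
    apply: hd'; first by rewrite enormZ z1 mulr1 ger0_norm.
    rewrite -scalerBr enormZ ger0_norm// (le_lt_trans _ zz')// ler_piMl ?enorm_ge0//.
    exact: ltW.
rewrite (eq_bigr _ (fun k _ => eq k)) in a1.
set S := \sum_k _ in a1 a2.
rewrite (_ : _ - _ = (\int[nu]_x (\1_(cball s) x * G x) - S) -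
  (\int[nu]_x (\1_(cball s) x * smean (enorm x)) - S)); last by ring.
by rewrite (le_trans (ler_normB _ _))// lerD.
Qed.

Lemma polar_integral : (forall x, enorm x < 1 -> 0 <= G x) ->
  (\int[nu]_(x in unit_ball) (G x)%:E = \int[nu]_(x in unit_ball) (smean (enorm x))%:E)%E.
Proof.
move=> G0; pose s (m : nat) : R := 1 - m.+1%:R^-1.
have s01 m : 0 <= s m < 1.
  rewrite subr_ge0 invf_le1 ?ltr0n// ler1n /= ltrBlDr ltrDl invr_gt0 ltr0n//.
have sm0 (x : E) : enorm x < 1 -> 0 <= smean (enorm x).
  move=> x1; apply: Rintegral_ge0 => w _; apply: G0.
  by apply: poisson_near => //; rewrite enorm_ge0.
have UE : unit_ball = \bigcup_m cball (s m).
  apply/seteqP; split=> [x /= x1|x [m _]]; last first.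
    by move=> /le_lt_trans; apply; case/andP: (s01 m).
  have x1' : 0 < 1 - enorm x by rewrite subr_gt0.
  exists (Num.truncn (1 - enorm x)^-1) => //; rewrite /cball /= lerBrDr -lerBrDl.
  rewrite -[leRHS]invrK lef_pV2 ?posrE ?invr_gt0 ?ltr0n//.
  exact/ltW/truncnS_gt.
have sB m : cball (s m) `<=` unit_ball by move=> x /le_lt_trans; apply; case/andP: (s01 m).
have nd : nondecreasing_seq (fun m => cball (s m)).
  move=> m k mk; apply/subsetPset => x /le_trans; apply.
  by rewrite lerD2l lerN2 lef_pV2 ?posrE ?ltr0n// ler_nat ltnS.
have mB : measurable (unit_ball : set B_) by apply: measurable_open; exact: open_unit_ball.
have eqm m : (\int[nu]_(x in cball (s m)) (G x)%:E =
              \int[nu]_(x in cball (s m)) (smean (enorm x))%:E)%E.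
  have [b1 b2 h] := polar_trunc (s01 m).
  have restr (F : E -> R) : bm (fun x : B_ => \1_(cball (s m)) x * F x) ->
    (\int[nu]_(x in cball (s m)) (F x)%:E = (\int[nu]_x (\1_(cball (s m)) x * F x))%:E)%E.
    move=> bF; rewrite -bm_int_EFin// integral_mkcond; apply: eq_integral => x _.
    by rewrite patchE indicE; case: (x \in _); rewrite ?mul1r ?mul0r.
  by rewrite (restr _ b1) (restr _ b2) h.
have lim (F : E -> R) : measurable_fun (unit_ball : set B_) (F : B_ -> R) ->
    (forall x, enorm x < 1 -> 0 <= F x) ->
    (\int[nu]_(x in cball (s m)) (F x)%:E @[m --> \oo] --> \int[nu]_(x in unit_ball) (F x)%:E)%E.
  move=> mF F0; rewrite UE; apply: ge0_nondecreasing_set_cvg_integral => //.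
  - by move=> m; exact: measurable_cball.
  - by move=> m; apply/measurable_EFinP; exact: measurable_funS mB (sB m) mF.
  - by move=> m x /sB /F0; rewrite lee_fin.
have l1 := lim _ measurable_G G0.
have l2 := lim _ measurable_smean sm0.
rewrite (_ : (fun m => _) = (fun m => \int[nu]_(x in cball (s m)) (smean (enorm x))%:E)%E) in l1.
  exact: (cvg_unique _ l1 l2).
by apply/funext => m; exact: eqm.
Qed.

End polar_coordinates.

(** * Quadratic estimates for harmonic functions *)

Section energy.
Context {R : realType} {n : nat} {d : measure_display} {T : measurableType d}.
Local Notation E := 'rV[R]_n.
Local Notation B_ := (borel_rV R n).
Variables (nu : probability B_ R) (P : probability T R) (th : T -> E).
Hypothesis mth : measurable_fun setT (th : T -> B_).
Hypothesis th1 : forall w, enorm (th w) = 1.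
Hypothesis n_gt0 : (0 < n)%N.
Hypothesis th_inv : forall O, O *m O^T = 1%:M -> forall g : E -> R,
  bm (fun w => g (th w)) -> \int[P]_w g (th w *m O) = \int[P]_w g (th w).
Hypothesis nu_bd : charges_boundary nu.
Hypothesis polar : forall G : E -> R,
  (forall x, enorm x < 1 -> {for x, continuous G}) ->
  (forall x, enorm x < 1 -> 0 <= G x) ->
  measurable_fun (unit_ball : set B_) (fun x : B_ => \int[P]_w G (enorm x *: th w)) /\
  (\int[nu]_(x in unit_ball) (G x)%:E =
   \int[nu]_(x in unit_ball) (\int[P]_w G (enorm x *: th w))%:E)%E.

Definition energy (u : E -> R) : \bar R := (\int[nu]_(x in unit_ball) (u x ^+ 2)%:E)%E.
Definition mean2 (u : E -> R) (r : R) : R := \int[P]_w (u (r *: th w) ^+ 2).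
Definition annulus (s : R) : set E := [set x | unit_ball x /\ (s <= enorm x)%R].
Local Notation harm := (rharmonic_on (@unit_ball R n)).

Let mB : measurable (unit_ball : set B_).
Proof. by apply: measurable_open; exact: open_unit_ball. Qed.

Lemma harm_cont u x : harm u -> enorm x < 1 -> {for x, continuous u}.
Proof. by move=> /rharmonic_elim[[cu _ _ _] _]; exact: cu. Qed.

Lemma harm_sqr_cont u x : harm u -> enorm x < 1 -> {for x, continuous (fun x => u x ^+ 2)}.
Proof.
move=> hu x1; rewrite (_ : (fun x => u x ^+ 2) = (fun x => u x * u x)).
  by apply: continuous_at_mul; exact: harm_cont.
by apply/funext => y; rewrite expr2.
Qed.

Lemma mean2_ge0 u r : 0 <= mean2 u r.
Proof. by apply: Rintegral_ge0 => w _; exact: sqr_ge0. Qed.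

Lemma mean2_le u a b : harm u -> 0 <= b -> b <= a -> a < 1 -> mean2 u b <= mean2 u a.
Proof. by move=> hu b0 ba a1; apply: (sphere_mean_le mth th1 n_gt0 th_inv hu b0 ba a1). Qed.

Lemma measurable_mean2 u : harm u ->
  measurable_fun (unit_ball : set B_) (fun x : B_ => mean2 u (enorm x)).
Proof.
move=> hu; have [|x _|] := polar (G := fun x => u x ^+ 2) => //.
- by move=> x; exact: harm_sqr_cont.
- exact: sqr_ge0.
Qed.

Lemma energyE u : harm u ->
  energy u = (\int[nu]_(x in unit_ball) (mean2 u (enorm x))%:E)%E.
Proof.
move=> hu; have [|x _|] := polar (G := fun x => u x ^+ 2) => //.
- by move=> x; exact: harm_sqr_cont.
- exact: sqr_ge0.
Qed.

Lemma energy_ge0 u : (0 <= energy u)%E.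
Proof. by apply: integral_ge0 => x _; rewrite lee_fin sqr_ge0. Qed.

Lemma measurable_annulus s : measurable (annulus s : set B_).
Proof.
rewrite (_ : annulus s = unit_ball `&` (enorm @^-1` `[s, +oo[)).
  apply: measurableI; first exact: mB.
  by rewrite -[X in measurable X]setTI; exact: measurable_enorm.
by apply/seteqP; split => x /= [xB]; rewrite in_itv /= andbT.
Qed.

Definition rim (s : R) : R := fine (nu (annulus s)).

Lemma rimE s : nu (annulus s) = (rim s)%:E.
Proof.
rewrite fineK// ge0_fin_numE//; apply: le_lt_trans (ltry 1).
by apply: probability_le1; exact: measurable_annulus.
Qed.

Lemma rim_gt0 s : 0 < s < 1 -> 0 < rim s.
Proof. by move=> s01; rewrite -lte_fin -rimE; exact: nu_bd. Qed.

Lemma energy_annulus u s : harm u -> 0 < s < 1 -> ((mean2 u s * rim s)%:E <= energy u)%E.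
Proof.
move=> hu /andP[s0 s1]; have mA := measurable_annulus s.
have AB : annulus s `<=` unit_ball by move=> x [].
have mm := measurable_mean2 hu.
rewrite energyE//; apply: (@le_trans _ _ (\int[nu]_(x in annulus s) (mean2 u (enorm x))%:E)%E).
  rewrite EFinM -rimE -(integral_cst _ mA); apply: ge0_le_integral => //.
  - by move=> x _; rewrite lee_fin mean2_ge0.
  - by apply/measurable_EFinP; exact: measurable_funS mB AB mm.
  - by move=> x [xB sx]; rewrite lee_fin mean2_le// ltW.
apply: ge0_subset_integral => //.
- by apply/measurable_EFinP.
- by move=> x _; rewrite lee_fin mean2_ge0.
Qed.

Lemma mean2_energy u s N : harm u -> 0 < s < 1 -> (energy u <= N%:E)%E ->
  mean2 u s <= N / rim s.
Proof.
move=> hu s01 uN; rewrite ler_pdivlMr; last exact: rim_gt0.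
by rewrite -lee_fin; apply: le_trans uN; exact: energy_annulus.
Qed.

Lemma int_sqr_le (k f : T -> R) D : bm k -> bm f -> (forall w, `|k w| <= D) ->
  (\int[P]_w (k w * f w)) ^+ 2 <= D ^+ 2 * \int[P]_w (f w ^+ 2).
Proof.
move=> bk bf kD; apply: le_trans (bm_int_cs bk bf) _.
apply: ler_wpM2r; first by apply: Rintegral_ge0 => w _; exact: sqr_ge0.
rewrite -(bm_int_cst (P := P) (D ^+ 2)); apply: bm_int_le; [exact: bmX|exact: bm_cst|].
move=> w; rewrite -real_normK ?num_real// ler_pXn2r ?nnegrE// (le_trans _ (kD w))//.
Qed.

Lemma poisson_at (u : E -> R) s x : harm u -> 0 < s < 1 -> enorm x < s ->
  enorm (s^-1 *: x) < 1 /\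
  u x = \int[P]_w (poisson (s^-1 *: x) (th w) * u (s *: th w)).
Proof.
move=> hu /andP[s0 s1] xs.
have x1 : enorm (s^-1 *: x) < 1.
  by rewrite enormZ gtr0_norm ?invr_gt0// ltr_pdivrMl// mulr1.
split=> //; rewrite -[LHS](_ : u (s *: (s^-1 *: x)) = _).
  by apply: (poisson_formula mth th1 n_gt0 th_inv hu _ x1); rewrite ltW.
by rewrite scalerA divff ?scale1r// gt_eqF.
Qed.

Lemma half_point r : 0 <= r < 1 -> let s : R := (1 + r) / 2 in 0 < s < 1 /\ r < s.
Proof.
by move=> /andP[r0 r1] s; rewrite /s; split; [apply/andP; split|]; lra.
Qed.

Lemma sup_bound r : 0 <= r < 1 -> exists2 C : R, 0 <= C & forall u N, harm u ->
  (energy u <= N%:E)%E -> forall x, enorm x <= r -> u x ^+ 2 <= C * N.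
Proof.
move=> r01; have [s01 rs] := half_point r01; set s := _ / _ in s01 rs.
have /andP[s0 s1] := s01.
have rs1 : 0 < 1 - r / s by rewrite subr_gt0 ltr_pdivrMr// mul1r.
pose D := ((1 - r / s) ^+ 2) `^ (- (n%:R / 2)) : R.
have D0 : 0 <= D by exact: powR_ge0.
exists (D ^+ 2 / rim s).
  by rewrite divr_ge0 ?sqr_ge0// ltW// rim_gt0.
move=> u N hu uN x xr; have [x1 ->] := poisson_at hu s01 (le_lt_trans xr rs).
have xrs : enorm (s^-1 *: x) <= r / s.
  by rewrite enormZ gtr0_norm ?invr_gt0// mulrC ler_pM2r ?invr_gt0.
rewrite -mulrA [_^-1 * N]mulrC.
apply: le_trans (ler_wpM2l (sqr_ge0 D) (mean2_energy hu s01 uN)).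
apply: int_sqr_le.
- exact: bm_poisson.
- by apply: (bm_sphere mth th1 hu); rewrite ltW.
move=> w; rewrite ger0_norm; last by apply: poisson_ge0; exact: ltW.
apply: le_trans (poisson_far rs1 _ (ltW x1)) _.
  have := enorm_dist (th w) (s^-1 *: x); rewrite enormB th1.
  by have := ler_norm (1 - enorm (s^-1 *: x)); lra.
rewrite -/D -[leRHS]mul1r ler_wpM2r// gerBl dot_ge0//.
Qed.

Lemma poisson_unif r e : 0 <= r < 1 -> 0 < e -> exists2 s : R, 0 < s &
  forall x y, enorm x <= r -> enorm (x - y) < s -> enorm y < 1 /\
    forall z : E, enorm z = 1 -> `|poisson x z - poisson y z| <= e.
Proof.
move=> /andP[r0 r1] e0; pose K : E -> R := radial_pow (- (n%:R / 2)).
have cK (y : E) : y != 0 -> {for y, continuous K} by exact: continuous_radial_pow.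
have r10 : 0 < 1 - r by rewrite subr_gt0.
have [M hM] := @compact_bounded_fun _ _ (shell (1 - r)) K (@compact_shell _ _ _)
  (fun y Ay => cK y (shell_neq0 r10 Ay)).
pose M1 := `|M| + 1; have M10 : 0 < M1 by rewrite ltr_wpDl.
have [s s0 hs] := kernel_unif cK r1 (divr_gt0 e0 (ltr0n _ 2)).
exists (Num.min (Num.min s (1 - r)) (e / (4 * M1))).
  by rewrite !lt_min s0 r10 divr_gt0// mulr_gt0.
move=> x y xr; rewrite !lt_min => /andP[/andP[xys xyr] xye].
have y1 : enorm y < 1 by have := enormD (y - x) x; rewrite subrK enormB; lra.
split=> // z z1; rewrite /poisson -/(K (x - z)) -/(K (y - z)).
rewrite (_ : _ - _ = (dot y y - dot x x) * K (x - z) +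
  (1 - dot y y) * (K (x - z) - K (y - z))); last by ring.
apply: le_trans (ler_normD _ _) _; rewrite !normrM (splitr e) lerD//.
  apply: (@le_trans _ _ (2 * (e / (4 * M1)) * M1)); last first.
    by rewrite le_eqVlt; apply/orP; left; apply/eqP; field; rewrite gt_eqF.
  apply: ler_pM => //.
    rewrite -!enorm_sqr subr_sqr normrM mulrC.
    have h1 : `|enorm y - enorm x| <= e / (4 * M1).
      by apply: le_trans (enorm_dist _ _) _; rewrite enormB ltW.
    apply: ler_pM => //; rewrite ger0_norm ?addr_ge0 ?enorm_ge0//.
    by rewrite -[2]/(1 + 1) lerD// ?(ltW y1)// (le_trans xr) ?ltW.
  apply: (@le_trans _ _ M); first by apply: hM; exact: shell_sub.
  by rewrite (le_trans (ler_norm M))// lerDl.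
rewrite -[leRHS]mul1r; apply: ler_pM => //; last by rewrite ltW// hs.
rewrite ger0_norm ?gerBl ?dot_ge0// subr_ge0 -enorm_sqr.
by rewrite expr_le1 ?enorm_ge0// ltW.
Qed.

Lemma equicontinuity r e : 0 <= r < 1 -> 0 < e -> exists2 t : R, 0 < t &
  forall u N, harm u -> (energy u <= N%:E)%E ->
  forall x y, enorm x <= r -> enorm (x - y) < t -> (u x - u y) ^+ 2 <= e ^+ 2 * N.
Proof.
move=> r01 e0; have [s01 rs] := half_point r01; set s := _ / _ in s01 rs.
have /andP[r0 r1] := r01; have /andP[s0 s1] := s01; have rim0 := rim_gt0 s01.
have rs1 : 0 <= r / s < 1 by rewrite divr_ge0 ?(ltW s0)//= ltr_pdivrMr// mul1r.
pose D := e * Num.sqrt (rim s).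
have D0 : 0 < D by rewrite mulr_gt0 ?sqrtr_gt0.
have [t t0 ht] := poisson_unif rs1 D0.
exists (Num.min (t * s) (s - r)); first by rewrite lt_min mulr_gt0// subr_gt0.
move=> u N hu uN x y xr; rewrite lt_min => /andP[xyt xyr].
have ys : enorm y < s by have := enormD (y - x) x; rewrite subrK enormB; lra.
have [x1 xE] := poisson_at hu s01 (le_lt_trans xr rs).
have [y1 yE] := poisson_at hu s01 ys.
have bu : bm (fun w => u (s *: th w)) by apply: (bm_sphere mth th1 hu); rewrite ltW.
have bx : bm (fun w => poisson (s^-1 *: x) (th w)) by exact: bm_poisson.
have by_ : bm (fun w => poisson (s^-1 *: y) (th w)) by exact: bm_poisson.
have -> : u x - u y = \int[P]_w ((poisson (s^-1 *: x) (th w) - poisson (s^-1 *: y) (th w)) * u (s *: th w)).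
  rewrite xE yE -bm_intB; [|exact: bmM|exact: bmM].
  by congr Rintegral; apply/funext => w; rewrite mulrBl.
apply: le_trans (int_sqr_le (D := D) (bmB bx by_) bu _) _.
  have h1 : enorm (s^-1 *: x) <= r / s.
    by rewrite enormZ gtr0_norm ?invr_gt0// mulrC ler_pM2r ?invr_gt0.
  have h2 : enorm (s^-1 *: x - s^-1 *: y) < t.
    by rewrite -scalerBr enormZ gtr0_norm ?invr_gt0// ltr_pdivrMl// mulrC.
  by move=> w; have [_ /(_ (th w) (th1 w))] := ht _ _ h1 h2.
rewrite /D exprMn sqr_sqrtr ?(ltW rim0)// -mulrA ler_wpM2l ?sqr_ge0//.
by rewrite mulrC -ler_pdivlMr// mean2_energy.
Qed.

Lemma harm_dil u s : harm u -> 0 <= s <= 1 -> harm (fun x => u (s *: x)).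
Proof.
move=> hu /andP[s0 s1]; have := rharmonic_affine s 0 (@open_unit_ball R n) hu.
rewrite (_ : (fun y => u (s *: y + 0)) = (fun y => u (s *: y))); last first.
  by apply/funext => y; rewrite addr0.
apply: rharmonic_sub => y /= y1; rewrite /unit_ball /= addr0 enormZ ger0_norm//.
by rewrite (le_lt_trans _ y1)// ler_piMl ?enorm_ge0.
Qed.

Lemma mean2_dil u s r : mean2 (fun x => u (s *: x)) r = mean2 u (s * r).
Proof. by congr Rintegral; apply/funext => w; rewrite scalerA. Qed.

Lemma energy_dil u s : harm u -> 0 <= s <= 1 -> (energy (fun x => u (s *: x)) <= energy u)%E.
Proof.
move=> hu s01; have /andP[s0 s1] := s01; have hs := harm_dil hu s01.
rewrite (energyE hs) (energyE hu); apply: ge0_le_integral => //.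
- by move=> x _; rewrite lee_fin mean2_ge0.
- by apply/measurable_EFinP; exact: measurable_mean2.
- by apply/measurable_EFinP; exact: measurable_mean2.
- move=> x xB; rewrite lee_fin mean2_dil; apply: mean2_le => //.
    by rewrite mulr_ge0 ?enorm_ge0.
  by rewrite ler_piMl ?enorm_ge0.
Qed.

Lemma harm_bounded u r : harm u -> r < 1 -> exists M, forall x, enorm x <= r -> `|u x| <= M.
Proof.
move=> hu r1; apply: (@compact_bounded_fun _ _ [set x | enorm x <= r] u).
  exact: compact_closed_ball.
by move=> x /= xr; apply: harm_cont => //; exact: le_lt_trans r1.
Qed.

Lemma cvg_dil (u : E -> R) x (s : nat -> R) : {for x, continuous u} ->
  s @ \oo --> (1 : R) -> u (s m *: x) @[m --> \oo] --> u x.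
Proof.
move=> cu s1; have h : s m *: x @[m --> \oo] --> x.
  by rewrite -[X in _ --> X]scale1r; exact: cvgZr_tmp.
exact: cvg_comp h cu.
Qed.

Definition near1 (m : nat) : R := 1 - (m.+2%:R)^-1.

Lemma near1_itv m : 0 < near1 m < 1.
Proof.
rewrite /near1 subr_gt0 gtrBl invr_gt0 ltr0n andbT invf_lt1 ?ltr0n//.
by rewrite ltr1n.
Qed.

Lemma near1_cvg : near1 @ \oo --> (1 : R).
Proof.
rewrite -[X in _ --> X]subr0; apply: cvgB; first exact: cvg_cst.
have := @cvg_harmonic R; rewrite -(cvg_shiftS (@harmonic R)); exact.
Qed.

Lemma mean2_sub_le (a b : T -> R) : bm a -> bm b ->
  \int[P]_w ((a w - b w) ^+ 2) <= 2 * \int[P]_w (a w ^+ 2) + 2 * \int[P]_w (b w ^+ 2).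
Proof.
move=> ba bb; have ba2 := bmX 2 ba; have bb2 := bmX 2 bb.
have b2 : bm (fun _ : T => 2 : R) by exact: bm_cst.
rewrite -(bm_intZ 2 ba2) -(bm_intZ 2 bb2) -bm_intD; [|exact: bmM|exact: bmM].
apply: bm_int_le => [||w].
- by apply: bmX; exact: bmB.
- by apply: bmD; exact: bmM.
- by have := sqr_ge0 (a w + b w); rewrite !sqrrD sqrrN; nra.
Qed.

Lemma energy_dil_cvg u e : harm u -> (energy u < +oo)%E -> 0 < e ->
  exists2 s, 0 < s < 1 & (energy (fun x => (u (s *: x) - u x)%R) <= e%:E)%E.
Proof.
move=> hu uoo e0; pose D m x := u (near1 m *: x) - u x.
have n01 m : 0 <= near1 m <= 1 by have /andP[a b] := near1_itv m; rewrite !ltW.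
have hd m : harm (fun x => u (near1 m *: x)) by exact: harm_dil.
have hD m : harm (D m) := rharmonicB (@open_unit_ball R n) (hd m) hu.
suff : energy (D m) @[m --> \oo] --> 0%E.
  move=> /fine_cvgP[[N1 _ fin1]].
  move=> /(pseudometric_normed_Zmodule.cvgr_dist_lt _ _) /(_ _ e0)[N2 _ hN].
  pose N := maxn N1 N2; exists (near1 N); first exact: near1_itv.
  have := hN N (leq_maxr _ _); rewrite /= sub0r normrN => h.
  rewrite -[leLHS]fineK; last exact: fin1 (leq_maxl _ _).
  by rewrite lee_fin (le_trans (ler_norm _))// ltW.
rewrite (_ : (fun m => energy (D m)) = (fun m =>
  (\int[nu]_(x in unit_ball) (mean2 (D m) (enorm x))%:E)%E)); last first.
  by apply/funext => m; exact: (energyE (hD m)).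
rewrite -(@integral0 _ _ _ nu unit_ball).
apply: (@dominated_cvg _ _ _ nu unit_ball mB
  (fun m x => (mean2 (D m) (enorm x))%:E) _ (fun x => (4 * mean2 u (enorm x))%:E)).
- by move=> m; apply/measurable_EFinP; exact: (measurable_mean2 (hD m)).
- move=> x xB; apply: cvg_EFin; first exact: nearW.
  rewrite (_ : 0 = \int[P]_w (fun _ : T => 0) w); last by rewrite bm_int_cst.
  have [M hM] := harm_bounded hu xB.
  apply: (@bm_int_cvg _ _ _ P _ _ ((M + M) ^+ 2)) => [m|m w|w].
  + have [] // : bm (fun w => D m (enorm x *: th w) ^+ 2).
    by apply: bmX; apply: (bm_sphere mth th1 (hD m)); rewrite enorm_ge0.
  + rewrite ger0_norm ?sqr_ge0// -real_normK ?num_real//.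
    have nx : enorm (enorm x *: th w) <= enorm x.
      by rewrite enormZ th1 mulr1 ger0_norm ?enorm_ge0.
    apply: lerXn2r; rewrite ?nnegrE//.
      by rewrite (le_trans _ (lerD (hM _ nx) (hM _ nx)))// addr_ge0.
    apply: le_trans (ler_normB _ _) _; apply: lerD; last exact: hM.
    apply: hM; rewrite enormZ ger0_norm; last by case/andP: (n01 m).
    by rewrite (le_trans _ nx)// ler_piMl ?enorm_ge0//; case/andP: (n01 m).
  + have cx : {for enorm x *: th w, continuous u}.
      by apply: harm_cont => //; rewrite enormZ th1 mulr1 ger0_norm ?enorm_ge0.
    rewrite (_ : 0 = (u (enorm x *: th w) - u (enorm x *: th w)) ^+ 2).
      under eq_fun do rewrite expr2.
      have h : D m (enorm x *: th w) @[m --> \oo] --> u (enorm x *: th w) - u (enorm x *: th w).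
        by apply: cvgB; [exact: cvg_dil cx near1_cvg|exact: cvg_cst].
      by rewrite expr2; apply: (cvgM h); exact: h.
    by rewrite subrr expr0n.
- by move=> x _.
- rewrite (_ : (fun x => _) = (fun x => 4%:E * (mean2 u (enorm x))%:E)%E).
    apply: integrableZl => //; apply/integrableP; split.
      by apply/measurable_EFinP; exact: measurable_mean2.
    under eq_integral do rewrite gee0_abs ?lee_fin ?mean2_ge0//.
    by rewrite -energyE.
  by apply/funext => x; rewrite EFinM.
- move=> m x xB; rewrite gee0_abs ?lee_fin ?mean2_ge0//.
  have x01 : 0 <= enorm x < 1 by rewrite enorm_ge0.
  apply: le_trans (mean2_sub_le (bm_sphere mth th1 (hd m) x01) (bm_sphere mth th1 hu x01)) _.
  rewrite -[\int[P]_w (u (near1 m *: _) ^+ 2)]/(mean2 (fun x => u (near1 m *: x)) (enorm x)).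
  rewrite mean2_dil -[\int[P]_w (u _ ^+ 2)]/(mean2 u (enorm x)).
  have : mean2 u (near1 m * enorm x) <= mean2 u (enorm x).
    have /andP[a b] := n01 m; have ex := enorm_ge0 x; have x1 : enorm x < 1 by [].
    by apply: mean2_le => //; [exact: mulr_ge0|exact: ler_piMl].
  by lra.
Qed.

Lemma cauchy_real_cvg (a : nat -> R) : (forall e, 0 < e -> exists N, forall k l,
  (N <= k)%N -> (N <= l)%N -> `|a k - a l| < e) -> cvgn a.
Proof.
move=> h; apply/cauchy_cvgP/cauchy_exP => e e0; have [N hN] := h e e0.
by exists (a N), N => // k Nk; exact: hN.
Qed.

Lemma fatou_le (f : nat -> E -> R) (g : E -> R) c :
  (forall k, measurable_fun (unit_ball : set B_) (f k : B_ -> R)) ->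
  (forall k x, 0 <= f k x) ->
  (forall x, enorm x < 1 -> f k x @[k --> \oo] --> g x) ->
  (forall k, (\int[nu]_(x in unit_ball) (f k x)%:E <= c%:E)%E) ->
  (\int[nu]_(x in unit_ball) (g x)%:E <= c%:E)%E.
Proof.
move=> mf f0 fg fc.
have := @fatou _ _ _ nu _ mB (fun k (x : B_) => (f k x)%:E).
move=> /(_ _ _)/le_trans; rewrite (_ : (\int[nu]_(x in unit_ball) _)%E =
  (\int[nu]_(x in unit_ball) (g x)%:E)%E); last first.
  apply: eq_integral => x /set_mem xB.
  have gx : (f k x)%:E @[k --> \oo] --> (g x)%:E.
    by apply: cvg_EFin; [exact: nearW|exact: fg].
  by rewrite is_cvg_limn_einfE; [exact/cvg_lim|exact: cvgP gx].
apply => [k|k x _|].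
- by apply/measurable_EFinP; exact: mf.
- by rewrite lee_fin.
rewrite limn_einf_lim; apply: lime_le; first exact: is_cvg_einfs.
apply: nearW => k; apply: le_trans (fc k).
by apply: ereal_inf_lbound; exists k => //=.
Qed.

Lemma energy_complete (u : nat -> E -> R) : (forall k, harm (u k)) ->
  (forall e, 0 < e -> exists N, forall k l, (N <= k)%N -> (N <= l)%N ->
     (energy (fun x => (u k x - u l x)%R) <= e%:E)%E) ->
  exists2 v, harm v & forall e, 0 < e -> exists N, forall k, (N <= k)%N ->
     (energy (fun x => (u k x - v x)%R) <= e%:E)%E.
Proof.
move=> hu uC; have oB := @open_unit_ball R n.
have hd k l : harm (fun x => u k x - u l x) := rharmonicB oB (hu k) (hu l).
have unif r : 0 <= r < 1 -> forall e, 0 < e -> exists N, forall k l, (N <= k)%N ->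
    (N <= l)%N -> forall x, enorm x <= r -> `|u k x - u l x| < e.
  move=> r01 e e0; have [C C0 hC] := sup_bound r01.
  have [|N hN] := uC (e ^+ 2 / (C + 1)); first by rewrite divr_gt0 ?exprn_gt0// ltr_wpDl.
  exists N => k l Nk Nl x xr; have := hC _ _ (hd k l) (hN k l Nk Nl) x xr.
  rewrite -[(_ - _) ^+ 2]real_normK ?num_real// => h.
  rewrite -(@ltr_pXn2r _ 2) ?nnegrE ?(ltW e0)//; apply: le_lt_trans h _.
  have C1 : 0 < C + 1 by rewrite ltr_wpDl.
  by rewrite mulrCA gtr_pMr ?exprn_gt0// ltr_pdivrMr// mul1r ltrDl.
pose v x := lim (u k x @[k --> \oo]).
have uv x : enorm x < 1 -> u k x @[k --> \oo] --> v x.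
  move=> x1; apply/cvg_ex; exists (v x); rewrite -/(cvg_to _ _).
  have x01 : 0 <= enorm x < 1 by rewrite enorm_ge0.
  apply: cauchy_real_cvg => e e0; have [N hN] := unif _ x01 _ e0.
  by exists N => k l Nk Nl; exact: hN.
exists v; last first.
  move=> e e0; have [N hN] := uC e e0; exists N => k Nk.
  apply: (@fatou_le (fun l x => (u k x - u (l + N)%N x) ^+ 2)) => [l|l x|x x1|l].
  - apply: continuous_on_measurable; first exact: open_unit_ball.
    by move=> x xB; exact: harm_sqr_cont.
  - exact: sqr_ge0.
  - rewrite expr2; under eq_fun do rewrite expr2.
    have : u (l + N)%N x @[l --> \oo] --> v x by rewrite (cvg_shiftn N (u ^~ x)); exact: uv.
    by move=> h; apply: cvgM; apply: cvgB => //; exact: cvg_cst.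
  - by apply: hN => //; rewrite leq_addl.
apply: (rharmonic_of_poisson (P := P) mth th1) => s s01.
have sth w : enorm (s *: th w) <= s.
  by have /andP[s0 _] := s01; rewrite enormZ th1 mulr1 ger0_norm.
have sth1 w : enorm (s *: th w) < 1 by have /andP[_ s1] := s01; exact: le_lt_trans s1.
have [N hN] := unif _ s01 1 ltr01.
have [M hM] := harm_bounded (hu N) (let: conj _ h := andP s01 in h).
have cv w : u (k + N)%N (s *: th w) @[k --> \oo] --> v (s *: th w).
  by rewrite (cvg_shiftn N (u ^~ (s *: th w))); exact: uv.
have bu k : bm (fun w => u (k + N)%N (s *: th w)) by exact: bm_sphere.
have uM k w : `|u (k + N)%N (s *: th w)| <= M + 1.
  rewrite -[u _ _](subrK (u N (s *: th w))) addrC; apply: le_trans (ler_normD _ _) _.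
  by apply: lerD; [exact: hM|rewrite ltW// hN// leq_addl].
split=> [|x x1]; first by apply: (bm_lim (fun k => (bu k).1) uM).
have [mp [M' pM']] := bm_poisson mth th1 x1.
have sx : enorm (s *: x) < 1.
  have /andP[s0 s1] := s01; rewrite enormZ ger0_norm//.
  by rewrite (le_lt_trans _ x1)// ler_piMl ?enorm_ge0// ltW.
have : u (k + N)%N (s *: x) @[k --> \oo] --> v (s *: x).
  by rewrite (cvg_shiftn N (u ^~ (s *: x))); exact: uv.
rewrite (_ : (fun k => _) = (fun k => pois_int P th (fun w => u (k + N)%N (s *: th w)) x)); last first.
  by apply/funext => k; rewrite (poisson_formula mth th1 n_gt0 th_inv).
move=> h; apply: (cvg_unique (@Rhausdorff R) h).
apply: (@bm_int_cvg _ _ _ P _ _ (M' * (M + 1))) => [k|k w|w].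
- by have [] := bm_pois_int mth th1 (bu k) x1.
- by rewrite normrM; apply: ler_pM => //.
- by apply: cvgM => //; exact: cvg_cst.
Qed.

Definition coord_mul (f : T -> R) (j : 'I_n) (w : T) : R := th w ord0 j * f w.
Local Notation rt f j := (conv P th (riesz j) f).

Lemma bm_coord_mul f j : bm f -> bm (coord_mul f j).
Proof. by move=> bf; apply: bmM => //; exact: bm_coord_sphere. Qed.

Lemma harm_riesz f j : bm f -> harm (rt f j).
Proof. by apply: (rharmonic_conv P mth th1); exact: rharmonic_riesz. Qed.

Lemma harm_newton f : bm f -> harm (conv P th (@newton R n) f).
Proof. by apply: (rharmonic_conv P mth th1); exact: rharmonic_newton. Qed.

Lemma riesz_split f j x : bm f -> enorm x < 1 -> x ord0 j * pois_int P th f x =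
  pois_int P th (coord_mul f j) x - (1 - dot x x) * rt f j x.
Proof.
move=> bf x1; rewrite /pois_int /conv.
have b1 := bm_pois_int mth th1 bf x1.
have b2 := bm_pois_int mth th1 (bm_coord_mul j bf) x1.
have b3 := bm_conv mth th1 (@riesz_cont R n j) bf x1.
rewrite -(bm_intZ _ b1) -(bm_intZ _ b3) -bm_intB//; last first.
  by apply: bmM => //; exact: bm_cst.
congr Rintegral; apply/funext => w; rewrite /coord_mul /poisson /riesz !mxE.
by ring.
Qed.

Lemma riesz_newton f x : bm f -> enorm x < 1 ->
  \sum_j (x ord0 j * rt f j x) = (pois_int P th f x - conv P th (@newton R n) f x) / 2.
Proof.
move=> bf x1; rewrite /pois_int /conv.
have b1 := bm_pois_int mth th1 bf x1.
have b2 := bm_conv mth th1 (@newton_cont R n) bf x1.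
have b3 j := bm_conv mth th1 (@riesz_cont R n j) bf x1.
have b4 j : bm (fun w => x ord0 j * (riesz j (x - th w) * f w)).
  by apply: bmM => //; exact: bm_cst.
rewrite -bm_intB// mulrC -bm_intZ; last exact: bmB.
under eq_bigr do rewrite -(bm_intZ _ (b3 _)).
rewrite -bm_int_sum//; congr Rintegral; apply/funext => w.
have xz := sub_sphere_neq0 x1 (th1 w).
rewrite /newton /poisson (radial_powS (1 - n%:R / 2) xz) (_ : 1 - n%:R / 2 - 1 = - (n%:R / 2)); last by ring.
set k := radial_pow _ _; rewrite (_ : dot (x - th w) (x - th w) = dot x x - 2 * dot x (th w) + 1); last first.
  rewrite !dotBl !dotBr (dotC (th w) x) -(enorm_sqr (th w)) th1; ring.
rewrite (_ : \sum_j _ = - (dot x x - dot x (th w)) * k * f w); first by field.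
rewrite -dotBr /dot -sumrN !mulr_suml; apply: eq_bigr => j _.
by rewrite /riesz -/k; ring.
Qed.

Lemma sphere_cvg (F G : E -> R) a : harm F -> harm G -> 0 <= a < 1 ->
  \int[P]_w (F (a *: th w) * G (near1 m *: (a *: th w))) @[m --> \oo] -->
  \int[P]_w (F (a *: th w) * G (a *: th w)).
Proof.
move=> hF hG a01; have /andP[a0 a1] := a01.
have [M hM] := harm_bounded hF a1; have [M' hM'] := harm_bounded hG a1.
have ea w : enorm (a *: th w) = a by rewrite enormZ th1 mulr1 ger0_norm.
apply: (@bm_int_cvg _ _ _ P _ _ (M * M')) => [m|m w|w].
- have /andP[m0 m1] := near1_itv m.
  have hd : harm (fun x => G (near1 m *: x)) by apply: harm_dil => //; rewrite !ltW.
  by have [] := bmM (bm_sphere mth th1 hF a01) (bm_sphere mth th1 hd a01).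
- have /andP[m0 m1] := near1_itv m; rewrite normrM.
  apply: ler_pM => //; first by apply: hM; rewrite ea.
  by apply: hM'; rewrite enormZ ea gtr0_norm// ler_piMl// ltW.
- apply: cvgM; first exact: cvg_cst.
  by apply: cvg_dil near1_cvg; apply: harm_cont => //; rewrite ea.
Qed.

Section riesz_system.
Variables (u w : E -> R) (h V : 'I_n -> E -> R).
Hypotheses (hu : harm u) (hw : harm w) (hh : forall j, harm (h j)) (hV : forall j, harm (V j)).
Hypothesis splitE : forall j x, enorm x < 1 ->
  x ord0 j * u x = V j x - (1 - dot x x) * h j x.
Hypothesis sumE : forall x, enorm x < 1 -> \sum_j (x ord0 j * h j x) = w x.

Let enorm_th c t : 0 < c -> enorm (c *: th t) = c.
Proof. by move=> c0; rewrite enormZ th1 mulr1 gtr0_norm. Qed.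

Let bs F c : harm F -> 0 < c < 1 -> bm (fun t => F (c *: th t)).
Proof. by move=> hF /andP[c0 c1]; apply: (bm_sphere mth th1 hF); rewrite ltW. Qed.

Let hp j : harm (fun x => V j x - h j x) := rharmonicB (@open_unit_ball R n) (hV j) (hh j).

Let side c e : 0 < c < 1 -> 0 < e < 1 ->
  \sum_j \int[P]_t ((V j (c *: th t) - h j (c *: th t)) * h j (e *: th t)) =
  c / e * (\int[P]_t (u (c *: th t) * w (e *: th t))) -
  c ^+ 2 * \sum_j \int[P]_t (h j (c *: th t) * h j (e *: th t)).
Proof.
move=> c01 e01; have [/andP[c0 c1] /andP[e0 e1]] := (c01, e01).
have B1 j := bmM (bs (hp j) c01) (bs (hh j) e01).
have B2 := bmM (bs hu c01) (bs hw e01).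
have B3 j := bmM (bs (hh j) c01) (bs (hh j) e01).
rewrite -bm_int_sum// -bm_int_sum// -(bm_intZ _ B2) -bm_intZ; last exact: bm_sum.
rewrite -bm_intB; [|by apply: bmM => //; exact: bm_cst|
                    by apply: bmM; [exact: bm_cst|exact: bm_sum]].
congr Rintegral; apply/funext => t.
have ec := enorm_th t c0; have ee := enorm_th t e0.
rewrite -sumE ?ee// (_ : c / e * _ = \sum_j c * th t ord0 j * u (c *: th t) * h j (e *: th t)).
  rewrite mulr_sumr -sumrB; apply: eq_bigr => j _.
  have := @splitE j (c *: th t); rewrite ec => /(_ c1).
  rewrite -enorm_sqr ec mxE => E1.
  rewrite E1; ring.
rewrite (_ : \sum_j (e *: th t) ord0 j * h j (e *: th t) =
  e * \sum_j th t ord0 j * h j (e *: th t)); last first.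
  by rewrite mulr_sumr; apply: eq_bigr => j _; rewrite mxE mulrA.
transitivity (c * u (c *: th t) * \sum_j th t ord0 j * h j (e *: th t)).
  by field; exact: lt0r_neq0.
by rewrite mulr_sumr; apply: eq_bigr => j _; ring.
Qed.

(* V_j - h_j, the Kelvin transform of h_j up to sign, is harmonic and
   x_j u = (V_j - h_j) + |x|^2 h_j; the identity is the symmetry of the two
   pairings of V_j - h_j with h_j and of u with w. *)
Lemma riesz_pairing a b : 0 < a < 1 -> 0 < b < 1 -> a != b ->
  \int[P]_t (u (a *: th t) * w (b *: th t)) =
  a * b * \sum_j \int[P]_t (h j (a *: th t) * h j (b *: th t)).
Proof.
move=> a01 b01 ab; have [/andP[a0 a1] /andP[b0 b1]] := (a01, b01).
have a01' : 0 <= a < 1 by rewrite ltW.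
have b01' : 0 <= b < 1 by rewrite ltW.
have : \sum_j \int[P]_t ((V j (a *: th t) - h j (a *: th t)) * h j (b *: th t)) =
    \sum_j \int[P]_t ((V j (b *: th t) - h j (b *: th t)) * h j (a *: th t)).
  by apply: eq_bigr => j _; exact: (sphere_sym mth th1 n_gt0 th_inv (hp j) (hh j)).
have symS : \sum_j \int[P]_t (h j (b *: th t) * h j (a *: th t)) =
    \sum_j \int[P]_t (h j (a *: th t) * h j (b *: th t)).
  by apply: eq_bigr => j _; congr Rintegral; apply/funext => t; rewrite mulrC.
have symW : \int[P]_t (u (b *: th t) * w (a *: th t)) = \int[P]_t (u (a *: th t) * w (b *: th t)).
  exact: (sphere_sym mth th1 n_gt0 th_inv hu hw).
rewrite (side a01 b01) (side b01 a01) symS symW.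
move: (\int[P]_t _) (\sum_j _) => W S eqS.
have ab2 : a ^+ 2 - b ^+ 2 != 0.
  by rewrite subr_sqr mulf_neq0 ?subr_eq0// gt_eqF// addr_gt0.
apply: (mulfI ab2); have a0' := lt0r_neq0 a0; have b0' := lt0r_neq0 b0.
have : a * b * (a / b * W - a ^+ 2 * S) = a * b * (b / a * W - b ^+ 2 * S) by rewrite eqS.
rewrite !mulrBr (_ : a * b * (a / b * W) = a ^+ 2 * W); last by field.
rewrite (_ : a * b * (b / a * W) = b ^+ 2 * W); last by field.
by move=> E1; nra.
Qed.

Lemma riesz_sphere a : 0 < a < 1 -> a ^+ 2 * \sum_j mean2 (h j) a <= mean2 u a.
Proof.
move=> a01; have /andP[a0 a1] := a01; have a01' : 0 <= a < 1 by rewrite ltW.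
pose S := \sum_j mean2 (h j) a.
have WE : \int[P]_t (u (a *: th t) * w (a *: th t)) = a ^+ 2 * S.
  apply: (cvg_unique (@Rhausdorff R) (sphere_cvg hu hw a01')).
  rewrite (_ : (fun m => _) = (fun m => a * (near1 m * a) *
    \sum_j \int[P]_t (h j (a *: th t) * h j (near1 m *: (a *: th t))))); last first.
    apply/funext => m; have /andP[m0 m1] := near1_itv m.
    have sE t : near1 m *: (a *: th t) = (near1 m * a) *: th t by rewrite scalerA.
    under eq_Rintegral do rewrite sE.
    rewrite (riesz_pairing a01).
    - congr (_ * _); apply: eq_bigr => j _.
      by apply: eq_Rintegral => t _; rewrite sE.
    - rewrite mulr_gt0//=; apply: le_lt_trans a1; rewrite ler_piMl//; exact: ltW.
    - by rewrite gt_eqF// gtr_pMl.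
  rewrite (_ : a ^+ 2 * S = a * (1 * a) * S); last by ring.
  apply: cvgM.
    apply: cvgM; first exact: cvg_cst.
    by apply: cvgM; [exact: near1_cvg|exact: cvg_cst].
  by apply: cvg_big => [|j _]; [exact: add_continuous|exact: (sphere_cvg (hh j) (hh j) a01')].
have S0 : 0 <= S by apply: sumr_ge0 => j _; exact: mean2_ge0.
have wS : mean2 w a <= a ^+ 2 * S.
  have bh j : bm (fun t => h j (a *: th t) ^+ 2) := bmX 2 (bs (hh j) a01).
  rewrite /S /mean2 -bm_int_sum// -bm_intZ; last exact: bm_sum.
  apply: bm_int_le => [||t].
  - exact: (bmX 2 (bs hw a01)).
  - by apply: bmM; [exact: bm_cst|exact: bm_sum].
  have ea := enorm_th t a0; pose v : E := \row_j h j (a *: th t).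
  rewrite (_ : w (a *: th t) = dot (a *: th t) v); last first.
    rewrite -sumE ?ea//; apply: eq_bigr => j _; by rewrite /v !mxE.
  rewrite (_ : \sum_i _ = dot v v); last first.
    by apply: eq_bigr => j _; rewrite /v mxE expr2.
  have := dot_cs (a *: th t) v.
  rewrite ea => E1; rewrite -enorm_sqr -exprMn -real_normK ?num_real//.
  by apply: lerXn2r => //; rewrite nnegrE ?normr_ge0// mulr_ge0 ?enorm_ge0// ltW.
have := bm_int_cs (P := P) (bs hu a01) (bs hw a01); rewrite WE -/S.
rewrite -[\int[P]_w0 (u _ ^+ 2)]/(mean2 u a) -[\int[P]_w0 (w _ ^+ 2)]/(mean2 w a).
have [->|Sn0] := eqVneq S 0; first by rewrite mulr0 mean2_ge0.
have aS : 0 < a ^+ 2 * S by rewrite mulr_gt0 ?exprn_gt0// lt0r Sn0.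
move=> E1; rewrite -(ler_pM2r aS) -expr2; apply: le_trans E1 _.
by apply: ler_wpM2l wS; exact: mean2_ge0.
Qed.

Lemma riesz_energy j : (energy (h j) <= (4 + 4 / rim 2^-1)%:E * energy u)%E.
Proof.
have h01 : ((0 : R) < 2^-1) && (2^-1 < (1 : R)) by apply/andP; split; lra.
have r0 := rim_gt0 h01.
have C0 : 0 < 4 + 4 / rim 2^-1 by rewrite addr_gt0// divr_gt0.
have big a : 2^-1 <= a -> a < 1 -> mean2 (h j) a <= 4 * mean2 u a.
  move=> ha a1; have a0 : 0 < a by apply: lt_le_trans ha; rewrite invr_gt0.
  have a01 : 0 < a < 1 by rewrite a0.
  have := riesz_sphere a01; rewrite (bigD1 j)//= => E1.
  have S0 : 0 <= \sum_(i < n | i != j) mean2 (h i) a by apply: sumr_ge0 => i _; exact: mean2_ge0.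
  have m0 := mean2_ge0 (h j) a; have : 4^-1 <= a ^+ 2.
    by rewrite (_ : 4^-1 = 2^-1 ^+ 2 :> R) ?ler_pXn2r ?nnegrE ?invr_ge0// ?(ltW a0)//; field.
  by nra.
have [/eqP->|uoo] := boolP (energy u == +oo)%E; first by rewrite gt0_muley// ?leey// lte_fin.
have uf : energy u \is a fin_num by rewrite ge0_fin_numE ?energy_ge0// lt_neqAle uoo leey.
pose N := fine (energy u); have NE : energy u = N%:E by rewrite /N fineK.
have N0 : 0 <= N by rewrite -lee_fin -NE energy_ge0.
have small : 4 * mean2 u 2^-1 <= 4 / rim 2^-1 * N.
  by rewrite -mulrA ler_pM2l// [_^-1 * N]mulrC; apply: mean2_energy => //; rewrite NE.
rewrite (energyE (hh j)); apply: (@le_trans _ _ (\int[nu]_(x in unit_ball)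
    ((4 * mean2 u (enorm x))%:E + (4 / rim 2^-1 * N)%:E))%E).
  apply: ge0_le_integral => //.
  - by move=> x _; rewrite lee_fin mean2_ge0.
  - by apply/measurable_EFinP; exact: (measurable_mean2 (hh j)).
  - apply: emeasurable_funD; apply/measurable_EFinP; last exact: measurable_cst.
    by apply: measurable_funM; [exact: measurable_cst|exact: (measurable_mean2 hu)].
  move=> x xB; rewrite -EFinD lee_fin.
  have [x2|x2] := leP 2^-1 (enorm x).
    by apply: le_trans (big _ x2 xB) _; rewrite lerDl mulr_ge0// divr_ge0// ltW.
  have mx := mean2_ge0 u (enorm x).
  apply: le_trans (mean2_le (hh j) (enorm_ge0 x) (ltW x2) _) _; first by case/andP: h01.
  have /andP[_ h1] := h01; apply: le_trans (big _ (lexx _) h1) _.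
  by apply: le_trans small _; rewrite lerDr mulr_ge0.
rewrite ge0_integralD//; last 3 first.
- by move=> x _; rewrite lee_fin mulr_ge0// mean2_ge0.
- by apply/measurable_EFinP; apply: measurable_funM; [exact: measurable_cst|exact: (measurable_mean2 hu)].
- by move=> x _; rewrite lee_fin mulr_ge0// divr_ge0// ltW.
under eq_integral do rewrite EFinM.
rewrite ge0_integralZl//; last 2 first.
- by apply/measurable_EFinP; exact: (measurable_mean2 hu).
- by move=> x _; rewrite lee_fin mean2_ge0.
rewrite -(energyE hu) integral_cst// NE -EFinM.
have : (nu unit_ball <= 1)%E by exact: probability_le1.
have c0 : (0 <= (4 / rim 2^-1 * N)%:E)%E by rewrite lee_fin mulr_ge0// divr_ge0// ltW.
move=> /(lee_wpmul2l c0) le1; apply: le_trans (leeD2l _ le1) _.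
by rewrite mule1 -EFinD -EFinM lee_fin [leRHS]mulrDl lexx.
Qed.

End riesz_system.

Lemma energy_bounded u M : harm u -> (forall x, enorm x < 1 -> `|u x| <= M) ->
  (energy u < +oo)%E.
Proof.
move=> hu uM; apply: (@le_lt_trans _ _ (\int[nu]_(x in unit_ball) (M ^+ 2)%:E)%E).
  apply: ge0_le_integral => //.
  - by move=> x _; rewrite lee_fin sqr_ge0.
  - apply/measurable_EFinP; apply: continuous_on_measurable; first exact: open_unit_ball.
    by move=> x; exact: harm_sqr_cont.
  - move=> x xB; rewrite lee_fin -real_normK ?num_real//.
    by rewrite ler_pXn2r ?nnegrE ?uM// (le_trans _ (uM x xB)).
rewrite integral_cst//; apply: le_lt_trans (ltry (M ^+ 2)).
rewrite -[leRHS]mule1 lee_wpmul2l ?lee_fin ?sqr_ge0//.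
exact: probability_le1.
Qed.

Lemma coord_hankel u (j : 'I_n) e : harm u -> (energy u < +oo)%E -> 0 < e ->
  exists s h V, [/\ 0 < s < 1, harm h, harm V,
    (energy h <= (4 + 4 / rim 2^-1)%:E * energy u)%E & (energy V < +oo)%E] /\
    (energy (fun x => (u (s *: x) - u x)%R) <= e%:E)%E /\
    forall x, enorm x < 1 -> x ord0 j * u (s *: x) = V x - (1 - dot x x) * h x.
Proof.
move=> hu uoo e0; have oB := @open_unit_ball R n.
have [s s01 us] := energy_dil_cvg hu uoo e0; have /andP[s0 s1] := s01.
pose f w := u (s *: th w).
have bf : bm f by apply: (bm_sphere mth th1 hu); rewrite ltW.
pose w x := 2^-1 * (u (s *: x) - conv P th (@newton R n) f x).
have hd : harm (fun x => u (s *: x)) by apply: harm_dil => //; rewrite !ltW.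
have hw : harm w := rharmonicZ _ oB (rharmonicB oB hd (harm_newton bf)).
pose V j := pois_int P th (coord_mul f j).
have hV i : harm (V i) := rharmonic_pois_int P mth th1 (bm_coord_mul i bf).
have uE x : enorm x < 1 -> u (s *: x) = pois_int P th f x.
  by move=> x1; apply: (poisson_formula mth th1 n_gt0 th_inv hu _ x1); rewrite ltW.
have sE i x : enorm x < 1 -> x ord0 i * u (s *: x) = V i x - (1 - dot x x) * rt f i x.
  by move=> x1; rewrite uE//; exact: riesz_split.
have wE x : enorm x < 1 -> \sum_i (x ord0 i * rt f i x) = w x.
  by move=> x1; rewrite riesz_newton// /w uE// mulrC.
exists s, (rt f j), (V j); split; last by split=> // x; exact: sE.
split; [exact: s01|exact: (harm_riesz j bf)|exact: hV| |].
- apply: le_trans (riesz_energy hd hw (fun i => harm_riesz i bf) hV sE wE j) _.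
  apply: lee_wpmul2l; first by rewrite lee_fin addr_ge0// divr_ge0// fine_ge0.
  by apply: energy_dil => //; rewrite !ltW.
- have [_ [M fM]] := bm_coord_mul j bf.
  apply: (energy_bounded (M := M) (hV j)) => x x1.
  have [bp bc] := (bm_poisson mth th1 x1, bm_coord_mul j bf).
  have M0 : 0 <= M by exact: le_trans (normr_ge0 _) (fM point).
  rewrite /V /pois_int; apply: le_trans (bm_int_abs (bmM bp bc)) _.
  rewrite -[leRHS]mulr1 -(int_poisson mth th1 n_gt0 th_inv x1) -bm_intZ//.
  apply: bm_int_le => [||t]; [exact/bm_abs/bmM|by apply: bmM => //; exact: bm_cst|].
  have p0 : 0 <= poisson x (th t) by apply: poisson_ge0; exact: ltW.
  by rewrite normrM (ger0_norm p0) mulrC ler_wpM2r.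
Qed.

End energy.

(** * The Bergman space and its Toeplitz operators *)

Section square_integrable.
Context {R : realType} {n : nat} (nu : probability (borel_rV R n) R).
Local Notation E := 'rV[R]_n.
Local Notation B_ := (borel_rV R n).
Local Notation Re := (@complex.Re R).
Local Notation Im := (@complex.Im R).
Local Notation L2 := (in_L2 nu).
Implicit Types h k : E -> R[i].

Definition rdot (z w : R[i]) : R := Re z * Re w + Im z * Im w.

Lemma normc_sqr z : normc z ^+ 2 = rdot z z.
Proof. by case: z => a b; rewrite /rdot /= -!expr2 sqr_sqrtr// addr_ge0 ?sqr_ge0. Qed.

Lemma rdotC z w : rdot z w = rdot w z.
Proof. by rewrite /rdot; ring. Qed.

Lemma rdot_mul a z w : rdot (a * z) w = rdot z (conjc a * w).
Proof. by case: a z w => [a b] [x y] [p q]; rewrite /rdot /=; ring. Qed.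

Lemma rdot_le z w : `|rdot z w| <= normc z ^+ 2 + normc w ^+ 2.
Proof.
rewrite !normc_sqr; case: z w => [a b] [p q]; rewrite /rdot /= ler_norml; apply/andP; split.
  by have := sqr_ge0 (a + p); have := sqr_ge0 (b + q); nra.
by have := sqr_ge0 (a - p); have := sqr_ge0 (b - q); nra.
Qed.

Definition nrm h : R := fine (L2norm nu h).
Definition rip h k : R := \int[nu]_x rdot (h x) (k x).

Lemma nrm_ge0 h : 0 <= nrm h.
Proof. by apply: fine_ge0; exact: Lnorm_ge0. Qed.

Lemma cmeasurable_rdot h k : cmeasurable_on setT h -> cmeasurable_on setT k ->
  measurable_fun setT ((fun x => rdot (h x) (k x)) : B_ -> R).
Proof. by move=> [hr hi] [kr ki]; apply: measurable_funD; exact: measurable_funM. Qed.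

Lemma in_L2P h : L2 h <-> cmeasurable_on setT h /\
  (\int[nu]_x (normc (h x) ^+ 2)%:E < +oo)%E.
Proof.
rewrite /in_L2 L2normE.
under eq_integral do rewrite (powR_mulrn 2) ?normc_ge0//.
split=> -[mh hoo]; split => //; last exact: poweR_lty.
by apply: lty_poweRy hoo; rewrite invr_neq0.
Qed.

Lemma integrable_sqr h : L2 h -> nu.-integrable setT (EFin \o (fun x => normc (h x) ^+ 2)).
Proof.
move=> /in_L2P[mh hoo]; apply/integrableP; split.
  by apply/measurable_EFinP; apply: measurable_funX; exact: cmeasurable_normc.
by under eq_integral do rewrite gee0_abs ?lee_fin ?sqr_ge0//.
Qed.

Lemma integrable_rdot h k : L2 h -> L2 k ->
  nu.-integrable setT (EFin \o (fun x => rdot (h x) (k x))).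
Proof.
move=> hL kL; apply: (le_integrable measurableT _ _
  (integrableD measurableT (integrable_sqr hL) (integrable_sqr kL))).
  by apply/measurable_EFinP; apply: cmeasurable_rdot; [exact: hL.1|exact: kL.1].
move=> x _; rewrite /= lee_fin [leRHS]ger0_norm ?addr_ge0 ?sqr_ge0//.
exact: rdot_le.
Qed.

Lemma nrm_sqr h : L2 h -> nrm h ^+ 2 = rip h h.
Proof.
move=> hL; have /in_L2P[mh hoo] := hL.
rewrite /nrm L2normE.
under eq_integral do rewrite (powR_mulrn 2) ?normc_ge0//.
rewrite /rip /Rintegral; under [in RHS]eq_integral do rewrite -normc_sqr.
set I := (\int[nu]_x _)%E in hoo *.
have I0 : (0 <= I)%E by apply: integral_ge0 => x _; rewrite lee_fin sqr_ge0.
have If : I \is a fin_num by rewrite ge0_fin_numE.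
rewrite -(fineK If) poweR_EFin /= powR12_sqrt ?fine_ge0// sqr_sqrtr ?fine_ge0//.
Qed.

Lemma ripC h k : rip h k = rip k h.
Proof. by congr Rintegral; apply/funext => x; exact: rdotC. Qed.

Lemma rip_mul (f : E -> R[i]) h k :
  rip (fun x => f x * h x) k = rip h (fun x => conjc (f x) * k x).
Proof. by congr Rintegral; apply/funext => x; exact: rdot_mul. Qed.

Lemma ripDl h1 h2 k : L2 h1 -> L2 h2 -> L2 k ->
  rip (fun x => h1 x + h2 x) k = rip h1 k + rip h2 k.
Proof.
move=> L1 L2_ Lk; rewrite -RintegralD; [|exact: measurableT|exact: integrable_rdot|exact: integrable_rdot].
congr Rintegral; apply/funext => x.
by case: (h1 x) (h2 x) (k x) => [a b] [c d] [p q]; rewrite /rdot /=; ring.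
Qed.

Lemma ripBl h1 h2 k : L2 h1 -> L2 h2 -> L2 k ->
  rip (fun x => h1 x - h2 x) k = rip h1 k - rip h2 k.
Proof.
move=> L1 L2_ Lk; rewrite -RintegralB; [|exact: measurableT|exact: integrable_rdot|exact: integrable_rdot].
congr Rintegral; apply/funext => x.
by case: (h1 x) (h2 x) (k x) => [a b] [c d] [p q]; rewrite /rdot /=; ring.
Qed.

Lemma ripZl (t : R) h k : L2 h -> L2 k -> rip (fun x => t%:C * h x) k = t * rip h k.
Proof.
move=> Lh Lk; rewrite -RintegralZl//; last exact: integrable_rdot.
congr Rintegral; apply/funext => x.
by case: (h x) (k x) => [a b] [p q]; rewrite /rdot /=; ring.
Qed.

Lemma inner_eq0 h k : inner nu h k = 0 <->
  rip h k = 0 /\ rip h (fun x => 'i * k x) = 0.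
Proof.
have E1 : \int[nu]_x complex.Re (h x * conjc (k x)) = rip h k.
  congr Rintegral; apply/funext => x.
  by case: (h x) (k x) => [a b] [p q]; rewrite /rdot /=; ring.
have E2 : \int[nu]_x complex.Im (h x * conjc (k x)) = rip h (fun x => 'i * k x).
  congr Rintegral; apply/funext => x.
  by case: (h x) (k x) => [a b] [p q]; rewrite /rdot /=; ring.
rewrite /inner E1 E2; split=> [[-> ->]//|[-> ->]//].
Qed.

Lemma L2_ZD (c : R[i]) h k : L2 h -> L2 k -> L2 (fun x => c * h x + k x).
Proof. exact: in_L2_ZD. Qed.

Lemma L2D h k : L2 h -> L2 k -> L2 (fun x => h x + k x).
Proof.
move=> hL kL; rewrite (_ : (fun x => _) = (fun x => 1 * h x + k x)); first exact: L2_ZD.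
by apply/funext => x; rewrite mul1r.
Qed.

Lemma L2Z c h : L2 h -> L2 (fun x => c * h x).
Proof.
move=> hL; rewrite (_ : (fun x => _) = (fun x => c * h x + 0)).
  by apply: L2_ZD => //; exact: in_L2_0.
by apply/funext => x; rewrite addr0.
Qed.

Lemma L2B h k : L2 h -> L2 k -> L2 (fun x => h x - k x).
Proof.
move=> hL kL; rewrite (_ : (fun x => _) = (fun x => -1 * k x + h x)); first exact: L2_ZD.
by apply/funext => x; rewrite mulN1r addrC.
Qed.

Lemma nrm_tri h k1 k2 : L2 h -> L2 k1 -> L2 k2 ->
  (forall x, normc (h x) <= normc (k1 x) + normc (k2 x)) -> nrm h <= nrm k1 + nrm k2.
Proof.
move=> [mh hoo] [m1 oo1] [m2 oo2] le; rewrite -lee_fin EFinD !fineK ?L2norm_fin//.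
exact: L2norm_triangle.
Qed.

Lemma nrmZ c h : L2 h -> nrm (fun x => c * h x) = normc c * nrm h.
Proof. by move=> [mh hoo]; rewrite /nrm L2normZ// fineM ?L2norm_fin. Qed.

Lemma nrm0 : nrm (fun=> 0) = 0.
Proof.
rewrite (_ : (fun=> 0) = (fun x => 0 * 0 : R[i])); last by apply/funext => x; rewrite mul0r.
by rewrite (nrmZ 0 (in_L2_0 nu)) normc0 mul0r.
Qed.

Lemma nrmD h k : L2 h -> L2 k -> nrm (fun x => h x + k x) <= nrm h + nrm k.
Proof. by move=> hL kL; apply: nrm_tri => //; [exact: L2D|move=> x; exact: le_normcD]. Qed.

Lemma nrmB h k : L2 h -> L2 k -> nrm (fun x => h x - k x) <= nrm h + nrm k.
Proof.
move=> hL kL; apply: nrm_tri => //; first exact: L2B.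
by move=> x; rewrite -[normc (k x)]normcN; exact: le_normcD.
Qed.

Lemma nrm_le h k : L2 h -> L2 k -> (forall x, normc (h x) <= normc (k x)) -> nrm h <= nrm k.
Proof.
move=> hL kL le; rewrite -[leRHS]addr0 -nrm0; apply: nrm_tri => //; first exact: in_L2_0.
by move=> x; rewrite normc0 addr0.
Qed.

Lemma nrm_dom c h k : 0 <= c -> L2 h -> L2 k ->
  (forall x, normc (h x) <= c * normc (k x)) -> nrm h <= c * nrm k.
Proof.
move=> c0 hL kL le; have cE : normc c%:C = c by rewrite /= expr0n addr0 sqrtr_sqr ger0_norm.
rewrite -[X in X * nrm k]cE -nrmZ//; apply: nrm_le => //; first exact: L2Z.
by move=> x; rewrite normcM cE.
Qed.

Lemma cmeasurable_cst (D : set E) c : cmeasurable_on D (fun=> c).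
Proof. by split; exact: measurable_cst. Qed.

Lemma L2_cst c : L2 (fun=> c).
Proof.
apply/in_L2P; split; first exact: cmeasurable_cst.
by rewrite (bm_int_EFin (P := nu) (bm_cst (normc c ^+ 2))) ltry.
Qed.

Lemma nrm_cst c : nrm (fun=> c) = normc c.
Proof.
have : nrm (fun=> c) ^+ 2 = normc c ^+ 2.
  rewrite nrm_sqr; last exact: L2_cst.
  rewrite /rip normc_sqr (bm_int_cst (P := nu)); first by [].
move=> /eqP; rewrite eqrXn2 ?nrm_ge0 ?normc_ge0// => /eqP; exact.
Qed.

Lemma L2_dom h k : cmeasurable_on setT h -> L2 k ->
  (forall x, normc (h x) <= normc (k x)) -> L2 h.
Proof.
move=> mh /in_L2P[mk koo] le; apply/in_L2P; split=> //.
apply: le_lt_trans koo; apply: ge0_le_integral => //.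
- by move=> x _; rewrite lee_fin sqr_ge0.
- by apply/measurable_EFinP; apply: measurable_funX; exact: cmeasurable_normc.
- by apply/measurable_EFinP; apply: measurable_funX; exact: cmeasurable_normc.
- by move=> x _; rewrite lee_fin ler_pXn2r ?nnegrE ?normc_ge0.
Qed.

Lemma rip_cs h k : L2 h -> L2 k -> rip h k <= nrm h * nrm k.
Proof.
move=> hL kL; have DL := L2D hL kL.
have := nrmD hL kL; rewrite -(@ler_pXn2r _ 2) ?nnegrE ?addr_ge0 ?nrm_ge0//.
rewrite (nrm_sqr DL) sqrrD (ripDl hL kL DL) (ripC h) (ripC k).
rewrite (ripDl hL kL hL) (ripDl hL kL kL) (ripC k h) !nrm_sqr//.
by lra.
Qed.

Definition mult (f : E -> R[i]) := cmeasurable_on unit_ball f /\ bounded_on unit_ball f.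
Definition L2ball h := L2 h /\ forall x, ~ unit_ball x -> h x = 0.

Lemma mB : measurable (unit_ball : set B_).
Proof. by apply: measurable_open; exact: open_unit_ball. Qed.

Lemma cmeasurableM (D : set E) h k : cmeasurable_on D h -> cmeasurable_on D k ->
  cmeasurable_on D (fun x => h x * k x).
Proof.
move=> [hr hi] [kr ki]; split.
  rewrite (_ : _ \o _ = (fun x => Re (h x) * Re (k x) - Im (h x) * Im (k x))).
    by apply: measurable_funB; exact: measurable_funM.
  by apply/funext => x /=; case: (h x) (k x) => [a b] [c d].
rewrite (_ : _ \o _ = (fun x => Re (h x) * Im (k x) + Im (h x) * Re (k x))).
  by apply: measurable_funD; exact: measurable_funM.
by apply/funext => x /=; case: (h x) (k x) => [a b] [c d].
Qed.

Lemma cmeasurableD (D : set E) h k : cmeasurable_on D h -> cmeasurable_on D k ->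
  cmeasurable_on D (fun x => h x + k x).
Proof.
move=> [hr hi] [kr ki]; split.
  rewrite (_ : _ \o _ = (fun x => Re (h x) + Re (k x))); first exact: measurable_funD.
  by apply/funext => x /=; case: (h x) (k x) => [a b] [c d].
rewrite (_ : _ \o _ = (fun x => Im (h x) + Im (k x))); first exact: measurable_funD.
by apply/funext => x /=; case: (h x) (k x) => [a b] [c d].
Qed.

Lemma cmeasurable_conj (D : set E) h : cmeasurable_on D h ->
  cmeasurable_on D (fun x => conjc (h x)).
Proof.
move=> [hr hi]; split.
  by rewrite (_ : _ \o _ = (fun x => Re (h x)))//; apply/funext => x /=; case: (h x).
rewrite (_ : _ \o _ = (fun x => - Im (h x))); first exact: measurableT_comp.
by apply/funext => x /=; case: (h x).
Qed.

Lemma cmeasurable_setT h : cmeasurable_on unit_ball h ->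
  (forall x, ~ unit_ball x -> h x = 0) -> cmeasurable_on setT h.
Proof.
move=> [hr hi] h0; split.
  rewrite (_ : _ \o _ = ((Re \o h) \_ unit_ball)).
    exact: (measurable_restrictT _ mB).1.
  by apply/funext => x; rewrite patchE; case: ifPn => // /negP xB /=;
    rewrite h0// => xB'; apply: xB; rewrite inE.
rewrite (_ : _ \o _ = ((Im \o h) \_ unit_ball)).
  exact: (measurable_restrictT _ mB).1.
by apply/funext => x; rewrite patchE; case: ifPn => // /negP xB /=;
  rewrite h0// => xB'; apply: xB; rewrite inE.
Qed.

Lemma cmeasurable_sub (D D' : set E) h : measurable (D : set B_) -> D' `<=` D ->
  cmeasurable_on D h -> cmeasurable_on D' h.
Proof. by move=> mD DD [hr hi]; split; apply: measurable_funS; eauto. Qed.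

Lemma L2ball_mul f h : mult f -> L2ball h -> L2ball (fun x => f x * h x).
Proof.
move=> [mf [M fM]] [[mh hoo] h0]; have hf0 x : ~ unit_ball x -> f x * h x = 0.
  by move=> xB; rewrite h0// mulr0.
split=> //; have M0 : 0 <= `|M| by [].
have cE : normc (`|M|%:C) = `|M| by rewrite /= expr0n addr0 sqrtr_sqr ger0_norm.
apply: (@L2_dom _ (fun x => `|M|%:C * h x)).
- apply: cmeasurable_setT => //; apply: cmeasurableM => //.
  by apply: cmeasurable_sub mh.
- exact: L2Z.
move=> x; rewrite !normcM cE; have [xB|xB] := pselect (unit_ball x); last first.
  by rewrite h0// normc0 !mulr0.
by rewrite ler_wpM2r ?normc_ge0// (le_trans (fM x xB))// ler_norm.
Qed.

Lemma L2ball_B h k : L2ball h -> L2ball k -> L2ball (fun x => h x - k x).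
Proof.
move=> [hL h0] [kL k0]; split; first exact: L2B.
by move=> x xB; rewrite h0// k0// subr0.
Qed.

Lemma nrm_domB c h k : 0 <= c -> L2ball h -> L2ball k ->
  (forall x, unit_ball x -> normc (h x) <= c * normc (k x)) -> nrm h <= c * nrm k.
Proof.
move=> c0 [hL h0] [kL k0] le; apply: nrm_dom => // x.
have [xB|xB] := pselect (unit_ball x); first exact: le.
by rewrite h0// normc0 mulr_ge0// normc_ge0.
Qed.

Lemma L2ball_b2 (u : b2 nu) : L2ball u.
Proof. by have := b2_funP u; rewrite inE => -[_ uL u0]; split. Qed.

Lemma multM f g : mult f -> mult g -> mult (fun x => f x * g x).
Proof.
move=> [mf [M fM]] [mg [N gN]]; split; first exact: cmeasurableM.
exists (M * N) => x xB; rewrite normcM ler_pM ?normc_ge0//; [exact: fM|exact: gN].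
Qed.

Lemma multD f g : mult f -> mult g -> mult (fun x => f x + g x).
Proof.
move=> [mf [M fM]] [mg [N gN]]; split; first exact: cmeasurableD.
exists (M + N) => x xB; apply: le_trans (le_normcD _ _) _.
by apply: lerD; [exact: fM|exact: gN].
Qed.

Lemma mult_cst c : mult (fun=> c).
Proof. by split; [exact: cmeasurable_cst|exists (normc c)]. Qed.

Lemma mult_conj f : mult f -> mult (fun x => conjc (f x)).
Proof.
move=> [mf [M fM]]; split; first exact: cmeasurable_conj.
exists M => x /fM; by case: (f x) => a b /=; rewrite sqrrN.
Qed.

Lemma multZ c f : mult f -> mult (fun x => c * f x).
Proof. by move=> hf; apply: multM => //; exact: mult_cst. Qed.

Lemma multB f g : mult f -> mult g -> mult (fun x => f x - g x).
Proof.
move=> hf hg; rewrite (_ : (fun x => _) = (fun x => f x + -1 * g x)).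
  by apply: multD => //; exact: multZ.
by apply/funext => x; rewrite mulN1r.
Qed.

End square_integrable.

Section planar_powers.
Context {R : realType} {n : nat}.
Local Notation E := 'rV[R]_n.
Local Notation d_ i := (delta_mx ord0 i : E).
Variables i1 i2 : 'I_n.
Hypothesis i12 : i1 != i2.

(* Real and imaginary parts of (x_{i1} + i x_{i2})^k. *)
Fixpoint planar (k : nat) (x : E) : R * R :=
  if k is k'.+1 then
    (x ord0 i1 * (planar k' x).1 - x ord0 i2 * (planar k' x).2,
     x ord0 i1 * (planar k' x).2 + x ord0 i2 * (planar k' x).1)
  else (1, 0).

Lemma planarZ k s x : planar k (s *: x) = (s ^+ k * (planar k x).1, s ^+ k * (planar k x).2).
Proof.
elim: k => [|k IH]; first by rewrite /= mul1r mulr0.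
by rewrite /= IH !mxE exprS /=; congr pair; ring.
Qed.

Lemma planar_delta k : planar k (d_ i1) = (1, 0).
Proof.
elim: k => [//|k IH]; rewrite /= IH /= !delta_coord eqxx (negbTE i12).
by rewrite mulr1n mulr0n; congr pair; ring.
Qed.

Let D1 k i x : R := k%:R * ((i == i1)%:R * (planar k.-1 x).1 - (i == i2)%:R * (planar k.-1 x).2).
Let D2 k i x : R := k%:R * ((i == i1)%:R * (planar k.-1 x).2 + (i == i2)%:R * (planar k.-1 x).1).

Lemma is_derive_planar k i x : has_derive x (d_ i) (fun y => (planar k y).1) (D1 k i x) /\
  has_derive x (d_ i) (fun y => (planar k y).2) (D2 k i x).
Proof.
have c1 := is_derive_coord x (d_ i) i1; have c2 := is_derive_coord x (d_ i) i2.
elim: k => [|k [IH1 IH2]].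
  by split; rewrite /D1 /D2 mul0r; exact: is_derive_cst.
have m11 := is_derive_mul c1 IH1; have m12 := is_derive_mul c1 IH2.
have m21 := is_derive_mul c2 IH1; have m22 := is_derive_mul c2 IH2.
have dE (j : 'I_n) : (d_ i) ord0 j = (i == j)%:R by rewrite delta_coord.
rewrite !dE in m11 m12 m21 m22.
split.
  apply: (is_derive_ext (is_derive_add m11 (is_derive_scal (-1) m22))) => [y|].
    by rewrite /= mulN1r.
  rewrite /D1 /D2 -[k.+1%:R]natr1 /=.
  by case: k {IH1 IH2 m11 m12 m21 m22} => [|k] /=; rewrite ?mul0r; ring.
apply: (is_derive_ext (is_derive_add m12 m21)) => [y|]; first by [].
rewrite /D1 /D2 -[k.+1%:R]natr1 /=.
by case: k {IH1 IH2 m11 m12 m21 m22} => [|k] /=; rewrite ?mul0r; ring.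
Qed.

Lemma continuous_planar k x : {for x, continuous (fun y => (planar k y).1)} /\
  {for x, continuous (fun y => (planar k y).2)}.
Proof.
have cc j : {for x, continuous (fun y : E => y ord0 j)} by exact: coord_continuous.
elim: k => [|k [IH1 IH2]]; first by split; exact: cst_continuous.
split; last by apply: continuous_at_add; exact: continuous_at_mul.
rewrite (_ : (fun y => _) = (fun y : E => y ord0 i1 * (planar k y).1 +
    -1 * (y ord0 i2 * (planar k y).2))).
  apply: continuous_at_add; first exact: continuous_at_mul.
  by apply: continuous_at_mul; [exact: continuous_at_cst|exact: continuous_at_mul].
by apply/funext => y; rewrite mulN1r.
Qed.

Lemma rharmonic_planar k : rharmonic_on unit_ball (fun x => (planar k x).1).
Proof.
pose D11 i j x : R := k%:R * ((j == i1)%:R * D1 k.-1 i x + - (j == i2)%:R * D2 k.-1 i x).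
have cD k' i x : {for x, continuous (D1 k' i)} /\ {for x, continuous (D2 k' i)}.
  have [c1 c2] := continuous_planar k'.-1 x.
  have cm (c : R) f : {for x, continuous f} -> {for x, continuous (fun y : E => c * f y : R)}.
    by move=> cf; apply: continuous_at_mul => //; exact: continuous_at_cst.
  split; last by apply: (cm); apply: continuous_at_add; exact: cm.
  apply: (cm); rewrite (_ : (fun y => _) = (fun y : E => (i == i1)%:R * (planar k'.-1 y).1 +
     - (i == i2)%:R * (planar k'.-1 y).2)); first by apply: continuous_at_add; exact: cm.
  by apply/funext => y; rewrite mulNr.
apply: (@rharmonic_intro _ _ _ _ (D1 k) D11).
- exact: open_unit_ball.
- by move=> x _; have [] := continuous_planar k x.
- by move=> i x _; have [] := is_derive_planar k i x.
- by move=> i x _; have [] := cD k i x.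
- move=> i j x _; have [h1 h2] := is_derive_planar k.-1 i x.
  apply: (is_derive_ext (is_derive_scal k%:R (is_derive_add
    (is_derive_scal (j == i1)%:R h1) (is_derive_scal (- (j == i2)%:R) h2)))) => [y|]; last by [].
  by rewrite /D1 mulNr.
- move=> i j x _; have [h1 h2] := cD k.-1 i x.
  by apply: continuous_at_mul; [exact: continuous_at_cst|apply: continuous_at_add;
     apply: continuous_at_mul => //; exact: continuous_at_cst].
move=> x _; rewrite -mulr_sumr big_split/= sum_delta.
rewrite (eq_bigr (fun i => - ((i == i2)%:R * D2 k.-1 i x))) => [|i _]; last by rewrite mulNr.
rewrite sumrN sum_delta /D1 /D2 !eqxx (negbTE i12) eq_sym (negbTE i12).
by rewrite mulr1n mulr0n; ring.
Qed.

End planar_powers.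

Section bergman_geometry.
Context {R : realType} {n : nat} (nu : probability (borel_rV R n) R).
Local Notation E := 'rV[R]_n.
Local Notation B_ := (borel_rV R n).
Local Notation Re := (@complex.Re R).
Local Notation Im := (@complex.Im R).
Local Notation L2 := (in_L2 nu).
Local Notation nrm := (nrm nu).
Local Notation rip := (rip nu).
Local Notation b2 := (b2 nu).
Local Notation harm := (rharmonic_on (@unit_ball R n)).
Hypothesis n_gt0 : (0 < n)%N.
Hypothesis nu_inv : orthogonal_invariant nu.
Hypothesis nu_bd : charges_boundary nu.

Let i0 : 'I_n := Ordinal n_gt0.
Let P := away nu.
Let mth := @measurable_dir R n i0.
Let th1 := @enorm_dir R n i0.
Let th_inv := dir_inv nu_inv nu_bd (i0 := i0).

Let polar (G : E -> R) :
  (forall x, enorm x < 1 -> {for x, continuous G}) ->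
  (forall x, enorm x < 1 -> 0 <= G x) ->
  measurable_fun (unit_ball : set B_) (fun x : B_ => \int[P]_w G (enorm x *: dir i0 w)) /\
  (\int[nu]_(x in unit_ball) (G x)%:E =
   \int[nu]_(x in unit_ball) (\int[P]_w G (enorm x *: dir i0 w))%:E)%E.
Proof.
move=> cG G0; split; first exact: (measurable_smean P i0 cG).
exact: (polar_integral n_gt0 nu_inv th_inv cG G0).
Qed.

Lemma ball_sup r : 0 <= r < 1 -> exists2 C : R, 0 <= C & forall u N, harm u ->
  (energy nu u <= N%:E)%E -> forall x, enorm x <= r -> u x ^+ 2 <= C * N.
Proof. exact: (sup_bound mth th1 n_gt0 th_inv nu_bd polar). Qed.

Lemma ball_equi r e : 0 <= r < 1 -> 0 < e -> exists2 t : R, 0 < t &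
  forall u N, harm u -> (energy nu u <= N%:E)%E ->
  forall x y, enorm x <= r -> enorm (x - y) < t -> (u x - u y) ^+ 2 <= e ^+ 2 * N.
Proof. exact: (equicontinuity mth th1 n_gt0 th_inv nu_bd polar). Qed.

Lemma ball_complete (u : nat -> E -> R) : (forall k, harm (u k)) ->
  (forall e, 0 < e -> exists N, forall k l, (N <= k)%N -> (N <= l)%N ->
     (energy nu (fun x => (u k x - u l x)%R) <= e%:E)%E) ->
  exists2 v, harm v & forall e, 0 < e -> exists N, forall k, (N <= k)%N ->
     (energy nu (fun x => (u k x - v x)%R) <= e%:E)%E.
Proof. exact: (energy_complete mth th1 n_gt0 th_inv nu_bd polar). Qed.

Lemma ball_hankel u (j : 'I_n) e : harm u -> (energy nu u < +oo)%E -> 0 < e ->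
  exists s h V, [/\ 0 < s < 1, harm h, harm V,
    (energy nu h <= (4 + 4 / rim nu 2^-1)%:E * energy nu u)%E & (energy nu V < +oo)%E] /\
    (energy nu (fun x => (u (s *: x) - u x)%R) <= e%:E)%E /\
    forall x, enorm x < 1 -> x ord0 j * u (s *: x) = V x - (1 - dot x x) * h x.
Proof. exact: (coord_hankel mth th1 n_gt0 th_inv nu_bd polar). Qed.

Lemma b2D (u v : b2) x : (u + v : b2) x = u x + v x. Proof. by []. Qed.
Lemma b2B (u v : b2) x : (u - v : b2) x = u x - v x. Proof. by []. Qed.
Lemma b2Z (c : R[i]) (u : b2) x : (c *: u : b2) x = c * u x. Proof. by []. Qed.
Lemma b2_0 x : (0 : b2) x = 0. Proof. by []. Qed.

Lemma b2_ext (u v : b2) : (forall x, unit_ball x -> u x = v x) -> u = v.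
Proof.
move=> uv; apply: val_inj; apply/funext => x /=.
have [xB|xB] := pselect (unit_ball x); first exact: uv.
by rewrite (L2ball_b2 u).2 ?(L2ball_b2 v).2.
Qed.

Lemma b2_Re (u : b2) : harm (fun x => Re (u x)).
Proof. by have := b2_funP u; rewrite inE => -[[h _] _ _]; exact: h. Qed.

Lemma b2_Im (u : b2) : harm (fun x => Im (u x)).
Proof. by have := b2_funP u; rewrite inE => -[[_ h] _ _]; exact: h. Qed.

Lemma b2norm_ge0 (u : b2) : 0 <= b2norm u. Proof. exact: nrm_ge0. Qed.

Lemma measurable_harm_sqr (a : E -> R) : harm a ->
  measurable_fun (unit_ball : set B_) (fun x : B_ => (a x ^+ 2)%:E).
Proof.
move=> ha; apply/measurable_EFinP; apply: continuous_on_measurable.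
  exact: open_unit_ball.
by move=> x; exact: harm_sqr_cont.
Qed.

Lemma energy_eq (u v : E -> R) : (forall x, unit_ball x -> u x = v x) ->
  energy nu u = energy nu v.
Proof. by move=> uv; apply: eq_integral => x /set_mem xB; rewrite uv. Qed.

Lemma energy_sub_fin (a c : E -> R) : harm a -> harm c -> (energy nu a < +oo)%E ->
  (energy nu (fun x => (a x - c x)%R) < +oo)%E -> (energy nu c < +oo)%E.
Proof.
move=> ha hc aoo doo; have hd := rharmonicB (@open_unit_ball R n) ha hc.
have ma := measurable_harm_sqr ha; have md := measurable_harm_sqr hd.
have p (b : E -> R) x : (0 <= (b x ^+ 2)%:E)%E by rewrite lee_fin sqr_ge0.
have m2 (b : E -> R) : measurable_fun (unit_ball : set B_) (fun x : B_ => (b x ^+ 2)%:E) ->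
    measurable_fun (unit_ball : set B_) (fun x : B_ => (2%:E * (b x ^+ 2)%:E)%E).
  by move=> mb; apply: emeasurable_funM => //; exact: measurable_cst.
apply: (@le_lt_trans _ _ (\int[nu]_(x in unit_ball)
   (2%:E * (a x ^+ 2)%:E + 2%:E * ((a x - c x) ^+ 2)%:E))%E).
  apply: ge0_le_integral.
  - exact: mB.
  - by move=> x _; exact: p.
  - exact: (measurable_harm_sqr hc).
  - exact: (emeasurable_funD (m2 _ ma) (m2 _ md)).
  - move=> x _; rewrite -!EFinM -EFinD lee_fin.
    by have := sqr_ge0 (2 * a x - c x); rewrite !expr2; nra.
rewrite ge0_integralD; [|exact: mB|by move=> x _; rewrite mule_ge0// p|exact: m2
  |by move=> x _; rewrite mule_ge0// (p (fun x => a x - c x))|exact: (m2 _ md)].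
rewrite ge0_integralZl; [|exact: mB|exact: ma|by move=> x _; exact: p|by []].
rewrite ge0_integralZl; [|exact: mB|exact: md|by move=> x _; exact: (p (fun x => a x - c x))|by []].
by apply: lte_add_pinfty; apply: lte_mul_pinfty.
Qed.

Lemma energyE_b2 (u : E -> R[i]) : harm (fun x => Re (u x)) -> harm (fun x => Im (u x)) ->
  (forall x, ~ unit_ball x -> u x = 0) ->
  (\int[nu]_x (normc (u x) ^+ 2)%:E =
   energy nu (fun x => Re (u x)) + energy nu (fun x => Im (u x)))%E.
Proof.
move=> hr hi u0; rewrite /energy -ge0_integralD//; last 5 first.
- exact: mB.
- by move=> x _; rewrite lee_fin sqr_ge0.
- exact: (measurable_harm_sqr hr).
- by move=> x _; rewrite lee_fin sqr_ge0.
- exact: (measurable_harm_sqr hi).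
rewrite [RHS]integral_mkcond; apply: eq_integral => x _; rewrite patchE.
case: ifPn => [_|/negP xB].
  by rewrite normc_sqr /rdot -EFinD -!expr2.
by rewrite u0 ?normc0 ?expr0n// => xB'; apply: xB; rewrite inE.
Qed.

Lemma b2norm_energy (u : b2) : ((b2norm u ^+ 2)%:E =
  energy nu (fun x => Re (u x)) + energy nu (fun x => Im (u x)))%E.
Proof.
have [uL u0] := L2ball_b2 u.
rewrite -(energyE_b2 (b2_Re u) (b2_Im u) u0) -[b2norm u]/(nrm u) nrm_sqr//.
rewrite /rip /Rintegral fineK.
  by apply: eq_integral => x _; rewrite normc_sqr.
apply: integrable_fin_num => //; exact: integrable_rdot.
Qed.

Lemma b2_energy_Re (u : b2) : (energy nu (fun x => Re (u x)) <= (b2norm u ^+ 2)%:E)%E.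
Proof. by rewrite b2norm_energy leeDl// energy_ge0. Qed.

Lemma b2_energy_Im (u : b2) : (energy nu (fun x => Im (u x)) <= (b2norm u ^+ 2)%:E)%E.
Proof. by rewrite b2norm_energy leeDr// energy_ge0. Qed.

Lemma b2_of_harm (a b : E -> R) : harm a -> harm b ->
  (energy nu a < +oo)%E -> (energy nu b < +oo)%E ->
  exists u : b2, forall x, unit_ball x -> u x = a x +i* b x.
Proof.
move=> ha hb aoo boo; have oB := @open_unit_ball R n.
pose u (x : E) : R[i] := if x \in unit_ball then a x +i* b x else 0.
have uB x : unit_ball x -> u x = a x +i* b x by move=> xB; rewrite /u mem_set.
have u0 x : ~ unit_ball x -> u x = 0 by move=> xB; rewrite /u memNset.
have hr : harm (fun x => Re (u x)).
  by apply: (rharmonic_ext oB _ ha) => x xB; rewrite uB.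
have hi : harm (fun x => Im (u x)).
  by apply: (rharmonic_ext oB _ hb) => x xB; rewrite uB.
have mu : cmeasurable_on setT u.
  apply: cmeasurable_setT => //; split.
    exact: (continuous_on_measurable oB (fun x xB => harm_cont hr xB)).
  exact: (continuous_on_measurable oB (fun x xB => harm_cont hi xB)).
have Pu : u \in b2_pred nu.
  rewrite inE; split; [split; [exact: hr|exact: hi]| |exact: u0].
  apply/in_L2P; split; first exact: mu.
  rewrite (energyE_b2 hr hi u0) (energy_eq (v := a)) => [|x xB]; last by rewrite uB.
  rewrite [X in (_ + X)%E](energy_eq (v := b)) => [|x xB]; last by rewrite uB.
  exact: lte_add_pinfty.
by exists (B2 Pu).
Qed.

Lemma b2_sup r : 0 <= r < 1 -> exists2 C : R, 0 <= C & forall (u : b2) x,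
  enorm x <= r -> normc (u x) <= C * b2norm u.
Proof.
move=> r01; have [C C0 hC] := ball_sup r01.
exists (Num.sqrt (2 * C)) => [|u x xr]; first exact: sqrtr_ge0.
rewrite -(@ler_pXn2r _ 2) ?nnegrE ?normc_ge0 ?mulr_ge0 ?sqrtr_ge0 ?b2norm_ge0//.
rewrite exprMn sqr_sqrtr ?mulr_ge0// normc_sqr /rdot -!expr2.
have := hC _ _ (b2_Re u) (b2_energy_Re u) x xr.
have := hC _ _ (b2_Im u) (b2_energy_Im u) x xr.
by lra.
Qed.

Lemma b2_equi r e : 0 <= r < 1 -> 0 < e -> exists2 t : R, 0 < t &
  forall (u : b2) x y, enorm x <= r -> enorm (x - y) < t -> normc (u x - u y) <= e * b2norm u.
Proof.
move=> r01 e0; have e20 : 0 < e / 2 by rewrite divr_gt0.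
have [t t0 ht] := ball_equi r01 e20; exists t => // u x y xr xy.
rewrite -(@ler_pXn2r _ 2) ?nnegrE ?normc_ge0 ?mulr_ge0 ?(ltW e0) ?b2norm_ge0//.
have hr := ht _ _ (b2_Re u) (b2_energy_Re u) x y xr xy.
have hi := ht _ _ (b2_Im u) (b2_energy_Im u) x y xr xy.
rewrite (_ : normc _ ^+ 2 = (Re (u x) - Re (u y)) ^+ 2 + (Im (u x) - Im (u y)) ^+ 2); last first.
  by case: (u x) (u y) => [a b] [c d]; rewrite normc_sqr /rdot /= -!expr2.
rewrite exprMn; move: hr hi; rewrite exprMn.
have : 0 <= e ^+ 2 * b2norm u ^+ 2 by rewrite -exprMn sqr_ge0.
by move: (e ^+ 2) (b2norm u ^+ 2) => p q pq; lra.
Qed.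

Lemma b2norm_eq0 (u : b2) : b2norm u = 0 -> u = 0.
Proof.
move=> u0; apply: b2_ext => x xB.
have x01 : 0 <= enorm x < 1 by rewrite enorm_ge0.
have [C _ /(_ u x (lexx _))] := b2_sup x01; rewrite u0 mulr0 => h.
by apply/eq0_normc/eqP; rewrite eq_le h normc_ge0.
Qed.

Lemma b2_complete (u : nat -> b2) :
  (forall e : R, 0 < e -> exists N, forall k l, (N <= k)%N -> (N <= l)%N ->
     b2norm (u k - u l) <= e) ->
  exists v, forall e : R, 0 < e -> exists N, forall k, (N <= k)%N -> b2norm (u k - v) <= e.
Proof.
move=> uC.
have sub (F : {additive R[i] -> R}) : (forall w : b2, (energy nu (fun x => F (w x)) <= (b2norm w ^+ 2)%:E)%E) ->
    forall e, 0 < e -> exists N, forall k l, (N <= k)%N -> (N <= l)%N ->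
     (energy nu (fun x => (F (u k x) - F (u l x))%R) <= e%:E)%E.
  move=> hF e e0; have [|N hN] := uC (Num.sqrt e); first by rewrite sqrtr_gt0.
  exists N => k l Nk Nl.
  rewrite (energy_eq (v := fun x => F ((u k - u l : b2) x))) => [|x _]; last first.
    by rewrite b2B raddfB.
  apply: le_trans (hF _) _; rewrite lee_fin -(@sqr_sqrtr _ e) ?(ltW e0)//.
  by rewrite ler_pXn2r ?nnegrE ?b2norm_ge0 ?sqrtr_ge0// hN.
have [a ha ca] := ball_complete (fun k => b2_Re (u k)) (sub _ b2_energy_Re).
have [b hb cb] := ball_complete (fun k => b2_Im (u k)) (sub _ b2_energy_Im).
have [Na /(_ Na (leqnn Na)) fa] := ca 1 ltr01; have [Nb /(_ Nb (leqnn Nb)) fb] := cb 1 ltr01.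
have aoo := energy_sub_fin (b2_Re (u Na)) ha (le_lt_trans (b2_energy_Re _) (ltry _)) (le_lt_trans fa (ltry _)).
have boo := energy_sub_fin (b2_Im (u Nb)) hb (le_lt_trans (b2_energy_Im _) (ltry _)) (le_lt_trans fb (ltry _)).
have [v hv] := b2_of_harm ha hb aoo boo.
exists v => e e0.
have e20 : 0 < e ^+ 2 / 2 by rewrite divr_gt0 ?exprn_gt0.
have [N1 h1] := ca _ e20; have [N2 h2] := cb _ e20.
exists (maxn N1 N2) => k; rewrite geq_max => /andP[k1 k2].
rewrite -(@ler_pXn2r _ 2) ?nnegrE ?b2norm_ge0 ?(ltW e0)// -lee_fin b2norm_energy.
rewrite (splitr (e ^+ 2)) EFinD; apply: leeD.
  apply: le_trans (h1 k k1); rewrite (energy_eq (v := fun x => Re (u k x) - a x))// => x xB.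
  by rewrite b2B raddfB /= hv.
apply: le_trans (h2 k k2); rewrite (energy_eq (v := fun x => Im (u k x) - b x))// => x xB.
by rewrite b2B raddfB /= hv.
Qed.

Lemma nrm_sqrB (t : R) h k : L2 h -> L2 k ->
  nrm (fun x => h x - t%:C * k x) ^+ 2 = nrm h ^+ 2 - 2 * t * rip h k + t ^+ 2 * nrm k ^+ 2.
Proof.
move=> hL kL; have tL := L2Z t%:C kL; have dL := L2B hL tL.
rewrite !nrm_sqr// (ripBl hL tL dL) (ripC nu h) (ripC nu (fun x => _ * k x)).
rewrite (ripBl hL tL hL) (ripBl hL tL tL) (ripZl _ kL hL) (ripC nu h) !(ripZl _ kL)//.
by rewrite (ripC nu k (fun x => _ * k x)) (ripZl _ kL)// (ripC nu k h); ring.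
Qed.

Lemma nrm_sqrZB (c : R[i]) h : L2 h -> nrm (fun x => c * h x) ^+ 2 = normc c ^+ 2 * nrm h ^+ 2.
Proof. by move=> hL; rewrite nrmZ// exprMn. Qed.

Lemma parallelogram h k : L2 h -> L2 k -> nrm (fun x => h x - k x) ^+ 2 =
  2 * nrm h ^+ 2 + 2 * nrm k ^+ 2 - nrm (fun x => h x + k x) ^+ 2.
Proof.
move=> hL kL.
rewrite (_ : (fun x => h x - k x) = (fun x => h x - 1%:C * k x)); last first.
  by apply/funext => x; rewrite mul1r.
rewrite (_ : (fun x => h x + k x) = (fun x => h x - (-1)%:C * k x)); last first.
  by apply/funext => x; rewrite rmorphN rmorph1 mulN1r opprK.
by rewrite !nrm_sqrB//; ring.
Qed.

Lemma orthogonal_min h (w : b2) : L2 h ->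
  (forall w' : b2, nrm (fun x => h x - w x) ^+ 2 <= nrm (fun x => h x - w' x) ^+ 2) ->
  forall v : b2, rip (fun x => h x - w x) v = 0.
Proof.
move=> hL wmin v; have [wL _] := L2ball_b2 w; have [vL _] := L2ball_b2 v.
have gL := L2B hL wL; set r := rip _ _; pose N := nrm v ^+ 2 + 1.
have N0 : 0 < N by rewrite ltr_wpDl// sqr_ge0.
have := wmin (w + (r / N)%:C *: v).
rewrite (_ : (fun x => h x - (w + (r / N)%:C *: v) x) =
  (fun x => (h x - w x) - (r / N)%:C * v x)); last first.
  by apply/funext => x; rewrite b2D b2Z opprD addrA.
rewrite (nrm_sqrB _ gL vL) -/r -addrA lerDl => h0.
have [//|r0] := eqVneq r 0.
have : r ^+ 2 / N ^+ 2 * (nrm v ^+ 2 - 2 * N) >= 0.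
  rewrite (_ : _ * _ = - (2 * (r / N) * r) + (r / N) ^+ 2 * nrm v ^+ 2) //.
  by field; exact: lt0r_neq0.
rewrite pmulr_rge0; last first.
  by apply: divr_gt0; [rewrite lt0r sqrf_eq0 r0 sqr_ge0|exact: exprn_gt0].
have : 0 <= nrm v ^+ 2 by exact: sqr_ge0.
by rewrite /N; lra.
Qed.

Lemma best_approximation h : L2 h -> exists w : b2,
  forall w' : b2, nrm (fun x => h x - w x) ^+ 2 <= nrm (fun x => h x - w' x) ^+ 2.
Proof.
move=> hL; pose D := [set nrm (fun x => h x - w x) ^+ 2 | w in @setT b2].
have D0 : has_inf D.
  split; first by exists (nrm (fun x => h x - (0 : b2) x) ^+ 2), 0.
  by exists 0 => _ [w _ <-]; exact: sqr_ge0.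
have dle (w : b2) : inf D <= nrm (fun x => h x - w x) ^+ 2.
  by apply: ge_inf; [exact: D0.2|exists w].
have bL (w : b2) : L2 (fun x => h x - w x) by exact: (L2B hL (L2ball_b2 w).1).
have ex (k : nat) : exists w : b2, nrm (fun x => h x - w x) ^+ 2 < inf D + k.+1%:R^-1.
  have k0 : 0 < k.+1%:R^-1 :> R by rewrite invr_gt0 ltr0n.
  by have [_ [w _ <-] lt] := inf_adherent k0 D0; exists w.
pose u k := projT1 (cid (ex k)).
have hu k : nrm (fun x => h x - u k x) ^+ 2 < inf D + k.+1%:R^-1 := projT2 (cid (ex k)).
have small (e : R) : 0 < e -> exists N : nat, forall k, (N <= k)%N -> k.+1%:R^-1 < e.
  move=> e0; exists (Num.truncn e^-1).+1 => k Nk.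
  rewrite invf_plt ?posrE ?ltr0n//; apply: lt_le_trans (truncnS_gt _) _.
  by rewrite ler_nat (leq_trans Nk).
have uC (e : R) : 0 < e -> exists N, forall k l, (N <= k)%N -> (N <= l)%N ->
    b2norm (u k - u l) <= e.
  move=> e0; have [|N hN] := small (e ^+ 2 / 4); first by rewrite divr_gt0 ?exprn_gt0.
  exists N => k l Nk Nl; have := parallelogram (bL (u k)) (bL (u l)).
  rewrite (_ : nrm (fun x => _ - _) = b2norm (u l - u k)); last first.
    by congr nrm; apply/funext => x; rewrite b2B; ring.
  rewrite (_ : (fun x => h x - u k x + (h x - u l x)) =
    (fun x => 2%:C * (h x - (2^-1%:C *: (u k + u l)) x))); last first.
    apply/funext => x; rewrite b2Z b2D mulrBr mulrA -rmorphM mulfV ?pnatr_eq0// rmorph1 mul1r.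
    by rewrite rmorph_nat; ring.
  rewrite nrm_sqrZB; last exact: bL.
  have -> : normc (2%:C : R[i]) ^+ 2 = 4.
    by rewrite normc_sqr /rdot /=; ring.
  move=> E1; rewrite -b2normN opprB -(@ler_pXn2r _ 2) ?nnegrE ?b2norm_ge0 ?(ltW e0)// E1.
  have := dle (2^-1%:C *: (u k + u l)); have := hu k; have := hu l.
  have := hN k Nk; have := hN l Nl; rewrite /=.
  by move: (k.+1%:R^-1 : R) (l.+1%:R^-1 : R) (nrm _ ^+ 2) (nrm _ ^+ 2) (nrm _ ^+ 2) => p q *; lra.
have [w hw] := b2_complete uC; exists w => w'; apply: le_trans (dle w').
have [h1|h1] := leP (nrm (fun x => h x - w x)) 0.
  have /eqP -> : nrm (fun x => h x - w x) == 0 by rewrite eq_le h1 nrm_ge0.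
  rewrite expr0n /=; apply: lb_le_inf; first exact: D0.1.
  by move=> _ [v _ <-]; exact: sqr_ge0.
have [d0|d0] := leP (nrm (fun x => h x - w x) ^+ 2) (inf D); first by [].
pose s := Num.sqrt (inf D); have infD0 : 0 <= inf D.
  by apply: lb_le_inf; [exact: D0.1|move=> _ [v _ <-]; exact: sqr_ge0].
have s0 : 0 <= s by exact: sqrtr_ge0.
have ss : s ^+ 2 = inf D by rewrite sqr_sqrtr.
have ls : s < nrm (fun x => h x - w x).
  by rewrite -(@ltr_pXn2r _ 2) ?nnegrE ?nrm_ge0// ss.
pose e := (nrm (fun x => h x - w x) - s) / 2.
have e0 : 0 < e by rewrite divr_gt0// subr_gt0.
have [N1 hN1] := hw e e0; have [|N2 hN2] := small (e ^+ 2); first by rewrite exprn_gt0.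
pose k := maxn N1 N2.
have a1 := hN1 k (leq_maxl _ _); have a2 := hN2 k (leq_maxr _ _).
have a3 : nrm (fun x => h x - u k x) < s + e.
  rewrite -(@ltr_pXn2r _ 2) ?nnegrE ?nrm_ge0 ?addr_ge0 ?(ltW e0)//.
  apply: lt_trans (hu k) _; rewrite sqrrD ss.
  have : 0 <= s * e *+ 2 by rewrite mulrn_wge0// mulr_ge0// ltW.
  by move: a2; move: (_ *+ 2) (_^-1) (e ^+ 2) => p q z; lra.
have := nrmD (bL (u k)) (L2ball_b2 (u k - w)).1.
rewrite (_ : (fun x => _ + _) = (fun x => h x - w x)); last first.
  by apply/funext => x; rewrite b2B addrA subrK.
rewrite -[nrm (u k - w)]/(b2norm (u k - w)) => a4.
exfalso; have : e + e = nrm (fun x => h x - w x) - s by rewrite /e -splitr.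
by lra.
Qed.

Let oproj := @orthoproj R n nu.

Lemma orthoproj_inner h : L2 h -> forall v : b2, inner nu (fun x => h x - oproj h x) v = 0.
Proof.
move=> hL; have [w wmin] := best_approximation hL.
have ex : exists w : b2, [set w : b2 | forall v : b2, inner nu (fun x => h x - w x) v = 0] w.
  exists w => v /=; apply/inner_eq0; split; first exact: orthogonal_min.
  exact: (orthogonal_min hL wmin ('i *: v)).
by have := xgetPex 0 ex.
Qed.

Lemma orthoproj_rip h (v : b2) : L2 h -> rip (fun x => h x - oproj h x) v = 0.
Proof. by move=> hL; have /inner_eq0[] := orthoproj_inner hL v. Qed.

Lemma orthoproj_uniq h (w : b2) : L2 h -> (forall v : b2, rip (fun x => h x - w x) v = 0) ->
  oproj h = w.
Proof.
move=> hL wo; apply/eqP; rewrite -subr_eq0; apply/eqP/b2norm_eq0.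
set v := oproj h - w; apply/eqP; rewrite -(@sqrf_eq0 R); apply/eqP.
have [wL _] := L2ball_b2 w; have [qL _] := L2ball_b2 (oproj h); have [vL _] := L2ball_b2 v.
rewrite -[b2norm v]/(nrm v) nrm_sqr//.
rewrite (_ : rip v v = rip (fun x => (h x - w x) - (h x - oproj h x)) v).
  by rewrite ripBl ?wo ?orthoproj_rip ?subr0//; exact: L2B.
by congr Rintegral; apply/funext => x; congr rdot; rewrite /v b2B; ring.
Qed.

Lemma orthoproj_id (w : b2) : oproj w = w.
Proof.
apply: orthoproj_uniq; first exact: (L2ball_b2 w).1.
move=> v; rewrite (_ : (fun x => _) = (fun x => 0%:C * v x)); last first.
  by apply/funext => x; rewrite subrr mul0r.
by rewrite ripZl ?mul0r//; exact: (L2ball_b2 v).1.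
Qed.

Lemma ripZc (c : R[i]) h (v : b2) :
  rip (fun x => c * h x) v = rip h (conjc c *: v : b2).
Proof. exact: (rip_mul nu (fun=> c)). Qed.

Lemma orthoprojZD (c : R[i]) h k : L2 h -> L2 k ->
  oproj (fun x => c * h x + k x) = c *: oproj h + oproj k.
Proof.
move=> hL kL; apply: orthoproj_uniq; first exact: L2_ZD.
move=> v; have qh := L2B hL (L2ball_b2 (oproj h)).1; have qk := L2B kL (L2ball_b2 (oproj k)).1.
rewrite (_ : (fun x => _) = (fun x => c * (h x - oproj h x) + (k x - oproj k x))); last first.
  by apply/funext => x; rewrite b2D b2Z; ring.
rewrite (ripDl (L2Z c qh) qk (L2ball_b2 v).1) ripZc (orthoproj_rip _ hL).
by rewrite (orthoproj_rip _ kL) addr0.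
Qed.

Lemma orthoprojB h k : L2 h -> L2 k -> oproj (fun x => h x - k x) = oproj h - oproj k.
Proof.
move=> hL kL; rewrite (_ : (fun x => _) = (fun x => -1 * k x + h x)); last first.
  by apply/funext => x; rewrite mulN1r addrC.
by rewrite orthoprojZD// scaleN1r addrC.
Qed.

Lemma orthoproj_best h (w : b2) : L2 h ->
  nrm (fun x => h x - oproj h x) <= nrm (fun x => h x - w x).
Proof.
move=> hL; have [wL _] := L2ball_b2 w; have [qL _] := L2ball_b2 (oproj h).
have dL := L2B hL qL; have vL := (L2ball_b2 (w - oproj h)).1.
rewrite -(@ler_pXn2r _ 2) ?nnegrE ?nrm_ge0//.
rewrite [in leRHS](_ : (fun x => h x - w x) =
  (fun x => (h x - oproj h x) - 1%:C * (w - oproj h : b2) x)); last first.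
  by apply/funext => x; rewrite b2B mul1r; ring.
by rewrite nrm_sqrB// orthoproj_rip// mulr0 subr0 lerDl mulr_ge0// sqr_ge0.
Qed.

Lemma orthoproj_le h : L2 h -> b2norm (oproj h) <= nrm h.
Proof.
move=> hL; have [qL _] := L2ball_b2 (oproj h); have dL := L2B hL qL.
rewrite -(@ler_pXn2r _ 2) ?nnegrE ?nrm_ge0 ?b2norm_ge0//.
rewrite [in leRHS](_ : h = (fun x => (h x - oproj h x) - (-1)%:C * oproj h x)); last first.
  by apply/funext => x; rewrite rmorphN rmorph1; ring.
rewrite (nrm_sqrB _ dL qL) orthoproj_rip// mulr0 subr0 sqrrN expr1n mul1r lerDr.
exact: sqr_ge0.
Qed.

Lemma orthoproj_res_le h : L2 h -> nrm (fun x => h x - oproj h x) <= nrm h.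
Proof.
move=> hL; apply: le_trans (orthoproj_best 0 hL) _.
by rewrite (_ : (fun x => _) = h)//; apply/funext => x; rewrite b2_0 subr0.
Qed.

Local Notation T_ := (toeplitz nu).

Lemma L2_mul f (u : b2) : mult f -> L2 (fun x => f x * u x).
Proof. by move=> mf; have [] := L2ball_mul mf (L2ball_b2 u). Qed.

Lemma normcR (a : R) : normc a%:C = `|a|.
Proof. by rewrite /= expr0n addr0 sqrtr_sqr. Qed.

Lemma nrm_mul f M (u : b2) : mult f -> 0 <= M ->
  (forall x, unit_ball x -> normc (f x) <= M) ->
  nrm (fun x => f x * u x) <= M * b2norm u.
Proof.
move=> mf M0 fM; apply: nrm_domB => //; [exact: (L2ball_mul mf (L2ball_b2 u))|exact: L2ball_b2|].
by move=> x xB; rewrite normcM ler_wpM2r ?normc_ge0// fM.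
Qed.

Lemma mult_bound (f : E -> R[i]) : mult f -> exists2 M : R, 0 < M & forall x, unit_ball x -> normc (f x) <= M.
Proof.
move=> [_ [M fM]]; exists (`|M| + 1) => [|x xB]; first by rewrite ltr_wpDl.
by rewrite (le_trans (fM x xB))// (le_trans (ler_norm M))// lerDl.
Qed.

Lemma toeplitz_linear f : mult f -> linear (T_ f).
Proof.
move=> mf c u v; rewrite -orthoprojZD; [|exact: L2_mul|exact: L2_mul].
by congr oproj; apply/funext => x; rewrite b2D b2Z mulrDr mulrCA.
Qed.

Lemma toeplitz_bounded f : mult f -> bounded_operator (T_ f).
Proof.
move=> mf; split; first exact: toeplitz_linear.
have [M M0 fM] := mult_bound mf; exists M => u.
apply: le_trans (orthoproj_le (L2_mul u mf)) _.
by apply: nrm_mul => //; exact: ltW.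
Qed.

Definition hank f (u : b2) : R := nrm (fun x => f x * u x - T_ f u x).

Lemma hank_ge0 f u : 0 <= hank f u. Proof. exact: nrm_ge0. Qed.

Lemma hank_best f u (w : b2) : mult f -> hank f u <= nrm (fun x => f x * u x - w x).
Proof. by move=> mf; exact: (orthoproj_best w (L2_mul u mf)). Qed.

(* Total boundedness of the unit ball for the seminorm p, in terms of finite colourings;
   when p u = |A u| this is the compactness of A. *)
Definition tb (p : b2 -> R) := forall r e : R, 0 < e ->
  exists (K : finType) (c : b2 -> K), forall u v : b2,
    b2norm u <= r -> b2norm v <= r -> c u = c v -> p (u - v) <= e.

Lemma linearBb (A : b2 -> b2) : linear A -> forall u v, A (u - v) = A u - A v.
Proof. by move=> lA u v; rewrite -scaleN1r addrC lA scaleN1r addrC. Qed.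

Lemma linear0b (A : b2 -> b2) : linear A -> A 0 = 0.
Proof. by move=> lA; rewrite -[X in A X](subrr 0) linearBb// subrr. Qed.

Lemma b2normB (u v : b2) : b2norm (u - v) <= b2norm u + b2norm v.
Proof. by apply: le_trans (b2normD _ _) _; rewrite b2normN. Qed.

Lemma b2normZ (c : R[i]) (u : b2) : b2norm (c *: u) = normc c * b2norm u.
Proof. exact: (nrmZ c (L2ball_b2 u).1). Qed.

Lemma tb_dom (C : R) p q : 0 <= C -> (forall u, p u <= C * q u) -> tb q -> tb p.
Proof.
move=> C0 pq tq r e e0; have C1 : 0 < C + 1 by rewrite ltr_wpDl.
have [|K [c hc]] := tq r (e / (C + 1)); first by rewrite divr_gt0.
exists K, c => u v ur vr cuv; apply: le_trans (pq _) _.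
apply: le_trans (ler_wpM2l C0 (hc u v ur vr cuv)) _.
by rewrite mulrCA ler_piMr ?(ltW e0)// ler_pdivrMr// mul1r lerDl.
Qed.

Lemma tb_le p q : (forall u, p u <= q u) -> tb q -> tb p.
Proof. by move=> pq; apply: (@tb_dom 1) => // u; rewrite mul1r. Qed.

Lemma tb_add p q : tb p -> tb q -> tb (fun u => p u + q u).
Proof.
move=> tp tq r e e0; have e20 : 0 < e / 2 by rewrite divr_gt0.
have [K [c hc]] := tp r _ e20; have [K' [c' hc']] := tq r _ e20.
exists (K * K')%type, (fun u => (c u, c' u)) => u v ur vr [cc cc'].
by rewrite (splitr e); apply: lerD; [exact: hc|exact: hc'].
Qed.

Lemma tb_approx p : (forall e, 0 < e -> exists2 q, tb q & forall u, p u <= q u + e * b2norm u) ->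
  tb p.
Proof.
move=> h r e e0; pose r1 := `|r| + 1; have r10 : 0 < r1 by rewrite ltr_wpDl.
have rr1 : r <= r1 by rewrite (le_trans (ler_norm r))// lerDl.
have [|q tq pq] := h (e / (4 * r1)); first by rewrite divr_gt0// mulr_gt0.
have [|K [c hc]] := tq r (e / 2); first by rewrite divr_gt0.
exists K, c => u v ur vr cuv; apply: le_trans (pq _) _; rewrite [leRHS](splitr e).
apply: lerD; first exact: hc.
have uv : b2norm (u - v) <= r1 + r1.
  by apply: le_trans (b2normB _ _) _; apply: lerD; exact: le_trans rr1.
have k0 : 0 <= e / (4 * r1) by rewrite divr_ge0 ?(ltW e0)// mulr_ge0// ltW.
apply: le_trans (ler_wpM2l k0 uv) _.
by rewrite le_eqVlt; apply/orP; left; apply/eqP; field; exact: lt0r_neq0.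
Qed.

Lemma tb_comp (A : b2 -> b2) q : bounded_operator A -> tb q -> tb (fun u => q (A u)).
Proof.
move=> [lA [M AM]] tq r e e0; have [K [c hc]] := tq (`|M| * `|r|) e e0.
have bd u : b2norm u <= r -> b2norm (A u) <= `|M| * `|r|.
  move=> ur; apply: le_trans (AM u) _; apply: le_trans (ler_norm _) _.
  rewrite normrM; apply: ler_wpM2l => //; rewrite ger0_norm ?b2norm_ge0//.
  exact: le_trans (ler_norm r).
exists K, (c \o A) => u v ur vr cuv; rewrite linearBb//.
by apply: hc => //; exact: bd.
Qed.

Lemma tb_sqrt (C : R) p q : 0 <= C -> (forall u, 0 <= p u) -> (forall u, 0 <= q u) ->
  (forall u, p u ^+ 2 <= C * b2norm u * q u) -> tb q -> tb p.
Proof.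
move=> C0 p0 q0 pq tq r e e0; pose r1 := `|r| + 1; have r10 : 0 < r1 by rewrite ltr_wpDl.
have rr1 : r <= r1 by rewrite (le_trans (ler_norm r))// lerDl.
have D0 : 0 < C * (r1 + r1) + 1 by rewrite ltr_wpDl// mulr_ge0// addr_ge0// ltW.
have [|K [c hc]] := tq r (e ^+ 2 / (C * (r1 + r1) + 1)).
  by rewrite divr_gt0// exprn_gt0.
exists K, c => u v ur vr cuv; have h := hc u v ur vr cuv.
rewrite -(@ler_pXn2r _ 2) ?nnegrE ?p0 ?(ltW e0)//; apply: le_trans (pq _) _.
have uv : C * b2norm (u - v) <= C * (r1 + r1).
  apply: ler_wpM2l => //; apply: le_trans (b2normB _ _) _.
  by apply: lerD; exact: le_trans rr1.
apply: (@le_trans _ _ ((C * (r1 + r1)) * (e ^+ 2 / (C * (r1 + r1) + 1)))).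
  by apply: ler_pM => //; rewrite mulr_ge0// b2norm_ge0.
by rewrite mulrCA ler_piMr ?sqr_ge0// ler_pdivrMr// mul1r lerDl.
Qed.

Lemma floor_colour (M d : R) : 0 < d -> exists (K : finType) (c : R -> K),
  forall a b, `|a| <= M -> `|b| <= M -> c a = c b -> `|a - b| <= d.
Proof.
move=> d0; pose m := Num.truncn ((M + M) / d).
pose c a : 'I_m.+1 := inord (Num.truncn ((a + M) / d)).
exists ('I_m.+1 : finType), c => a b aM bM cab.
have M0 : 0 <= M by exact: le_trans aM.
have pos x : `|x| <= M -> 0 <= (x + M) / d.
  by rewrite ler_norml => /andP[h1 h2]; rewrite divr_ge0 ?(ltW d0)//; lra.
have lt_m x : `|x| <= M -> (Num.truncn ((x + M) / d) < m.+1)%N.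
  move=> xM; rewrite ltnS; apply: le_truncn.
  by rewrite ler_pM2r ?invr_gt0// lerD2r; move: xM; rewrite ler_norml => /andP[].
have := congr1 val cab; rewrite /= !inordK ?lt_m// => E.
have /andP[a1 a2] := truncn_itv (pos a aM); have /andP[b1 b2] := truncn_itv (pos b bM).
have ab : `|(a + M) / d - (b + M) / d| <= 1.
  by move: a1 a2 b1 b2; rewrite E -natr1; move: (_%:R : R) => z; rewrite ler_norml => *; apply/andP; split; lra.
rewrite (_ : a - b = d * ((a + M) / d - (b + M) / d)); last by field; exact: lt0r_neq0.
by rewrite normrM (gtr0_norm d0) ler_piMr// ltW.
Qed.

Lemma normc_le_ReIm (z : R[i]) : normc z <= `|Re z| + `|Im z|.
Proof.
rewrite -(@ler_pXn2r _ 2) ?nnegrE ?normc_ge0 ?addr_ge0// normc_sqr /rdot -!expr2.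
rewrite sqrrD !real_normK ?num_real//.
have : 0 <= `|Re z| * `|Im z| *+ 2 by rewrite mulrn_wge0// mulr_ge0.
by lra.
Qed.

Lemma ReIm_le_normc (z : R[i]) : `|Re z| <= normc z /\ `|Im z| <= normc z.
Proof.
by split; rewrite -(@ler_pXn2r _ 2) ?nnegrE ?normc_ge0// real_normK ?num_real//;
  rewrite normc_sqr /rdot -!expr2 ?lerDl ?lerDr sqr_ge0.
Qed.

Lemma tb_eval s r e : 0 <= s < 1 -> 0 < e ->
  exists (K : finType) (c : b2 -> K), forall u v : b2,
    b2norm u <= r -> b2norm v <= r -> c u = c v ->
    forall x, enorm x <= s -> normc (u x - v x) <= e.
Proof.
move=> s01 e0; pose r1 := `|r| + 1; have r10 : 0 < r1 by rewrite ltr_wpDl.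
have rr1 : r <= r1 by rewrite (le_trans (ler_norm r))// lerDl.
have [C C0 hC] := b2_sup s01.
have [|t t0 ht] := b2_equi s01 (e := e / (4 * r1)); first by rewrite divr_gt0// mulr_gt0.
have [|K [c hc]] := @floor_colour (C * r1) (e / 4); first by rewrite divr_gt0.
have [xs [xsK xsN]] := compact_net (@compact_closed_ball R n s) t0.
pose x_ (i : 'I_(size xs)) := nth 0 xs i.
exists ({ffun 'I_(size xs) -> K * K} : finType),
  (fun u => [ffun i => (c (Re (u (x_ i))), c (Im (u (x_ i))))]).
move=> u v ur vr cuv x xs_; have [y yxs xy] := xsN x xs_.
have ys : enorm y <= s by exact: xsK.
pose i := Ordinal (etrans (index_mem y xs) yxs).
have yi : x_ i = y by rewrite /x_ /= nth_index.
have bd (w : b2) : b2norm w <= r -> normc (w y) <= C * r1.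
  move=> wr; apply: le_trans (hC w y ys) _.
  by apply: ler_wpM2l => //; exact: le_trans rr1.
have := congr1 (fun F : {ffun 'I_(size xs) -> K * K} => F i) cuv; rewrite !ffunE yi => -[cR cI].
have uy := bd u ur; have vy := bd v vr.
have [ur1 ui1] := ReIm_le_normc (u y); have [vr1 vi1] := ReIm_le_normc (v y).
have dR := hc _ _ (le_trans ur1 uy) (le_trans vr1 vy) cR.
have dI := hc _ _ (le_trans ui1 uy) (le_trans vi1 vy) cI.
have dy : normc (u y - v y) <= e / 4 + e / 4.
  by apply: le_trans (normc_le_ReIm _) _; rewrite !raddfB; apply: lerD.
have near_ (w : b2) : b2norm w <= r -> normc (w x - w y) <= e / 4.
  move=> wr; apply: le_trans (ht w x y xs_ xy) _.
  have k0 : 0 <= e / (4 * r1) by rewrite divr_ge0 ?(ltW e0)// mulr_ge0// ltW.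
  apply: le_trans (ler_wpM2l k0 (le_trans wr rr1)) _.
  by rewrite le_eqVlt; apply/orP; left; apply/eqP; field; exact: lt0r_neq0.
rewrite (_ : u x - v x = (u x - u y) + ((u y - v y) + (v y - v x))); last by ring.
apply: le_trans (le_normcD _ _) _; apply: le_trans (lerD (near_ u ur) (le_normcD _ _)) _.
have := near_ v vr; rewrite -normcN opprB => dv.
have e4 : e = e / 4 + (e / 4 + e / 4 + e / 4) by field.
by rewrite [leRHS]e4; apply: lerD => //; apply: lerD.
Qed.

Definition vanishes_at_boundary (f : E -> R[i]) := forall e : R, 0 < e ->
  exists2 s : R, s < 1 & forall x, unit_ball x -> s <= enorm x -> normc (f x) <= e.

Lemma tb_vanishing f : mult f -> vanishes_at_boundary f ->
  tb (fun u => nrm (fun x => f x * u x)).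
Proof.
move=> mf f0 r e e0; pose r1 := `|r| + 1; have r10 : 0 < r1 by rewrite ltr_wpDl.
have rr1 : r <= r1 by rewrite (le_trans (ler_norm r))// lerDl.
have [M M0 fM] := mult_bound mf; pose d := e / (4 * r1).
have d0 : 0 < d by rewrite divr_gt0// mulr_gt0.
have [s0 s01 fs] := f0 d d0; pose s := Num.max s0 0.
have s1 : 0 <= s < 1 by rewrite le_max lexx orbT gt_max s01 ltr01.
have [|K [c hc]] := @tb_eval s r (e / (2 * M)) s1; first by rewrite divr_gt0// mulr_gt0.
exists K, c => u v ur vr cuv; have uvx := hc u v ur vr cuv.
have uv : b2norm (u - v) <= r1 + r1.
  by apply: le_trans (b2normB _ _) _; apply: lerD; exact: le_trans rr1.
apply: (@le_trans _ _ (nrm (fun=> (e / 2)%:C) + nrm (fun x => d%:C * (u - v : b2) x))).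
  apply: nrm_tri; [exact: L2_mul|exact: L2_cst|exact: L2Z (L2ball_b2 _).1|].
  move=> x; rewrite normcM normcR ger0_norm ?divr_ge0 ?(ltW e0)// normcM normcR gtr0_norm//.
  have [xB|xB] := pselect (unit_ball x); last first.
    by rewrite ((L2ball_b2 _).2 x xB) normc0 !mulr0 addr0 divr_ge0// ltW.
  have [xs|xs] := leP (enorm x) s.
    apply: (@le_trans _ _ (M * (e / (2 * M)))); last first.
      rewrite (_ : M * _ = e / 2); last by field; exact: lt0r_neq0.
      by rewrite lerDl mulr_ge0 ?normc_ge0// ltW.
    by apply: ler_pM; rewrite ?normc_ge0//; [exact: fM|exact: uvx].
  apply: (@le_trans _ _ (d * normc ((u - v : b2) x))).
    rewrite ler_wpM2r ?normc_ge0//; apply: fs => //; apply: ltW.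
    by move: xs; rewrite gt_max => /andP[].
  by rewrite lerDr divr_ge0// ltW.
rewrite nrm_cst normcR ger0_norm ?divr_ge0 ?(ltW e0)// nrmZ; last exact: (L2ball_b2 _).1.
rewrite normcR gtr0_norm// [leRHS](splitr e); apply: lerD => //.
apply: le_trans (ler_wpM2l (ltW d0) uv) _.
by rewrite le_eqVlt; apply/orP; left; apply/eqP; rewrite /d; field; exact: lt0r_neq0.
Qed.

(* T_f - f is, up to sign, the Hankel operator of f; when it is compact for f and its
   conjugate, T_f commutes modulo compacts with all Toeplitz operators. *)
Definition esscomm f := mult f /\ tb (hank f).

Lemma tb0 : tb (fun=> 0).
Proof. by move=> r e e0; exists unit, (fun=> tt) => u v _ _ _; exact: ltW. Qed.

Lemma L2_res f (u : b2) : mult f -> L2 (fun x => f x * u x - T_ f u x).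
Proof. by move=> mf; apply: L2B (L2_mul u mf) (L2ball_b2 _).1. Qed.

Lemma esscomm_cst c : esscomm (fun=> c).
Proof.
split; first exact: mult_cst; apply: tb_le tb0 => u.
apply: le_trans (hank_best u (c *: u) (mult_cst c)) _.
rewrite (_ : (fun x => _) = (fun=> 0)) ?nrm0//.
by apply/funext => x; rewrite b2Z subrr.
Qed.

Lemma esscommD f g : esscomm f -> esscomm g -> esscomm (fun x => f x + g x).
Proof.
move=> [mf tf] [mg tg]; split; first exact: multD.
apply: tb_le (tb_add tf tg) => u; apply: le_trans (hank_best u (T_ f u + T_ g u) (multD mf mg)) _.
rewrite (_ : (fun x => _) =
  (fun x => (f x * u x - T_ f u x) + (g x * u x - T_ g u x))); last first.
  by apply/funext => x; rewrite b2D; ring.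
by apply: nrmD; exact: L2_res.
Qed.

Lemma esscommM f g : esscomm f -> esscomm g -> esscomm (fun x => f x * g x).
Proof.
move=> [mf tf] [mg tg]; split; first exact: multM.
have [M M0 fM] := mult_bound mf.
have tMg : tb (fun u => M * hank g u) by apply: (tb_dom (ltW M0) _ tg).
apply: tb_le (tb_add tMg (tb_comp (toeplitz_bounded mg) tf)) => u.
apply: le_trans (hank_best u (T_ f (T_ g u)) (multM mf mg)) _.
rewrite (_ : (fun x => _) = (fun x => f x * (g x * u x - T_ g u x) +
    (f x * T_ g u x - T_ f (T_ g u) x))); last by apply/funext => x; ring.
have gB : L2ball nu (fun x => g x * u x - T_ g u x).
  by apply: L2ball_B; [exact: L2ball_mul (L2ball_b2 u)|exact: L2ball_b2].
have fgB := L2ball_mul mf gB.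
apply: le_trans (nrmD fgB.1 (L2_res _ mf)) _; apply: lerD => //.
apply: nrm_domB => //; first exact: ltW.
by move=> x xB; rewrite normcM ler_wpM2r ?normc_ge0// fM.
Qed.

Lemma esscommZ c f : esscomm f -> esscomm (fun x => c * f x).
Proof. by move=> hf; exact: (esscommM (esscomm_cst c) hf). Qed.

Lemma esscomm_unif f : mult f -> (forall e : R, 0 < e -> exists2 g, esscomm g &
  forall x, unit_ball x -> normc (f x - g x) <= e) -> esscomm f.
Proof.
move=> mf h; split=> //; apply: tb_approx => e e0; have [g [mg tg] fg] := h e e0.
exists (hank g) => // u; apply: le_trans (hank_best u (T_ g u) mf) _.
rewrite (_ : (fun x => _) =
  (fun x => (g x * u x - T_ g u x) + (f x - g x) * u x)); last first.
  by apply/funext => x; ring.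
have md := multB mf mg; apply: le_trans (nrmD (L2_res u mg) (L2_mul u md)) _.
by apply: lerD => //; apply: nrm_mul => //; exact: ltW.
Qed.

Lemma mult_continuous (a : E -> R) (M : R) :
  (forall x, unit_ball x -> {for x, continuous a}) ->
  (forall x, unit_ball x -> `|a x| <= M) -> mult (fun x => (a x)%:C).
Proof.
move=> ca aM; split; last by exists M => x xB; rewrite normcR aM.
split; last exact: measurable_cst.
exact: (continuous_on_measurable (@open_unit_ball R n) ca).
Qed.

Definition coordC (j : 'I_n) (x : E) : R[i] := (x ord0 j)%:C.
Definition defectC (x : E) : R[i] := (1 - dot x x)%:C.

Lemma mult_coord j : mult (coordC j).
Proof.
apply: (@mult_continuous _ 1) => [x _|x xB]; first exact: coord_continuous.
by apply: le_trans (coord_le x j) _; exact: ltW.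
Qed.

Lemma dot_ball (x : E) : unit_ball x -> 0 <= dot x x < 1.
Proof.
by move=> xB; rewrite dot_ge0 -enorm_sqr expr_lt1 ?enorm_ge0.
Qed.

Lemma mult_defect : mult defectC.
Proof.
apply: (@mult_continuous (fun x => 1 - dot x x) 1) => [x _|x /dot_ball/andP[d0 d1]].
  by apply: continuousB; [exact: cst_continuous|exact: continuous_dot].
by rewrite ger0_norm; lra.
Qed.

Lemma defect_vanishing : vanishes_at_boundary defectC.
Proof.
move=> e e0; exists (1 - e / 2) => [|x xB xe]; first by rewrite gtrBl divr_gt0.
have x1 : enorm x < 1 := xB; have x0 := enorm_ge0 x.
rewrite normcR -enorm_sqr ger0_norm; nra.
Qed.

Lemma coord_split : exists2 C : R, 0 <= C & forall j (u : b2) e, 0 < e ->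
  exists h V : b2, b2norm h <= C * b2norm u /\
    nrm (fun x => coordC j x * u x - (V x - defectC x * h x)) <= e.
Proof.
pose C := 4 + 4 / rim nu 2^-1.
have C0 : 0 <= C by rewrite addr_ge0// divr_ge0// fine_ge0.
exists (Num.sqrt C) => [|j u e e0]; first exact: sqrtr_ge0.
have e20 : 0 < e ^+ 2 / 2 by rewrite divr_gt0 ?exprn_gt0.
have finR := le_lt_trans (b2_energy_Re u) (ltry _).
have finI := le_lt_trans (b2_energy_Im u) (ltry _).
have [s1 [h1 [V1 [[s101 hh1 hV1 eh1 eV1] [d1 E1]]]]] := ball_hankel j (b2_Re u) finR e20.
have [s2 [h2 [V2 [[s201 hh2 hV2 eh2 eV2] [d2 E2]]]]] := ball_hankel j (b2_Im u) finI e20.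
have efin (h a : E -> R) : (energy nu h <= C%:E * energy nu a)%E ->
    (energy nu a < +oo)%E -> (energy nu h < +oo)%E.
  by move=> le fin; apply: le_lt_trans le _; exact: lte_mul_pinfty.
have [h hE] := b2_of_harm hh1 hh2 (efin _ _ eh1 finR) (efin _ _ eh2 finI).
have [V VE] := b2_of_harm hV1 hV2 eV1 eV2.
have dil (a : E -> R) (s : R) : harm a -> 0 < s < 1 -> harm (fun x => a (s *: x)).
  by move=> ha /andP[p q]; apply: harm_dil => //; rewrite !ltW.
have hd1 := dil _ _ (b2_Re u) s101; have hd2 := dil _ _ (b2_Im u) s201.
have fd (a b : E -> R) : harm a -> harm b -> (energy nu b < +oo)%E ->
   (energy nu (fun x => (a x - b x)%R) <= (e ^+ 2 / 2)%:E)%E -> (energy nu a < +oo)%E.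
  move=> ha hb bf ab; apply: (energy_sub_fin hb ha bf).
  rewrite (_ : energy nu _ = energy nu (fun x => a x - b x)).
    exact: le_lt_trans ab (ltry _).
  by apply: eq_integral => x _; rewrite -sqrrN opprB.
have [w wE] := b2_of_harm hd1 hd2 (fd _ _ hd1 (b2_Re u) finR d1) (fd _ _ hd2 (b2_Im u) finI d2).
exists h, V; split.
  rewrite -(@ler_pXn2r _ 2) ?nnegrE ?mulr_ge0 ?sqrtr_ge0 ?b2norm_ge0//.
  rewrite exprMn sqr_sqrtr// -lee_fin [X in (_ <= X)%E]EFinM !b2norm_energy.
  rewrite (energy_eq (v := h1)) => [|x xB]; last by rewrite hE.
  rewrite [X in (_ + X <= _)%E](energy_eq (v := h2)) => [|x xB]; last by rewrite hE.
  by rewrite ge0_muleDr ?energy_ge0// leeD.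
rewrite (_ : (fun x => _) = (fun x => coordC j x * (u - w : b2) x)); last first.
  apply/funext => x; rewrite b2B mulrBr; congr (_ - _).
  have [xB|xB] := pselect (unit_ball x); last first.
    by rewrite !(L2ball_b2 _).2// !mulr0 subr0.
  rewrite hE// VE// wE// /coordC /defectC.
  have := E1 x xB; have := E2 x xB.
  move: (Im (u _)) (Re (u _)) => p q e2 e1.
  have -> : (x ord0 j)%:C * (q +i* p) = (x ord0 j * q) +i* (x ord0 j * p).
    by simpc.
  by rewrite e1 e2; simpc.
apply: le_trans (nrm_mul (M := 1) _ (mult_coord j) _ _) _ => //.
  by move=> x xB; rewrite normcR (le_trans (coord_le x j))// ltW.
rewrite mul1r -(@ler_pXn2r _ 2) ?nnegrE ?b2norm_ge0 ?(ltW e0)// -lee_fin b2norm_energy.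
rewrite (splitr (e ^+ 2)) EFinD; apply: leeD.
  apply: le_trans d1; rewrite (energy_eq (v := fun x => Re (u x) - Re (u (s1 *: x)))).
    by rewrite le_eqVlt; apply/orP; left; apply/eqP; apply: eq_integral => x _; rewrite -sqrrN opprB.
  by move=> x xB; rewrite b2B raddfB /= wE.
apply: le_trans d2; rewrite (energy_eq (v := fun x => Im (u x) - Im (u (s2 *: x)))).
  by rewrite le_eqVlt; apply/orP; left; apply/eqP; apply: eq_integral => x _; rewrite -sqrrN opprB.
by move=> x xB; rewrite b2B raddfB /= wE.
Qed.

Lemma esscomm_coord j : esscomm (coordC j).
Proof.
split=> [|r e e0]; first exact: mult_coord.
have [C C0 hC] := coord_split; have e40 : 0 < e / 4 by rewrite divr_gt0.
have e20 : 0 < e / 2 by rewrite divr_gt0.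
pose h u := projT1 (cid (hC j u _ e40)).
pose V u := projT1 (cid (projT2 (cid (hC j u _ e40)))).
have hV u : b2norm (h u) <= C * b2norm u /\
    nrm (fun x => coordC j x * u x - (V u x - defectC x * h u x)) <= e / 4.
  exact: projT2 (cid (projT2 (cid (hC j u _ e40)))).
have [K [c hc]] := tb_vanishing mult_defect defect_vanishing (C * r) e20.
exists K, (c \o h) => u v ur vr cuv.
apply: le_trans (hank_best (u - v) (V u - V v) (mult_coord j)) _.
have bd w : b2norm w <= r -> b2norm (h w) <= C * r.
  by move=> wr; apply: le_trans (hV w).1 _; exact: ler_wpM2l.
have hk := hc _ _ (bd u ur) (bd v vr) cuv.
have L (w : b2) : L2 (fun x => coordC j x * w x - (V w x - defectC x * h w x)).
  apply: L2B; first exact: (L2_mul w (mult_coord j)).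
  by apply: L2B; [exact: (L2ball_b2 _).1|exact: (L2_mul _ mult_defect)].
rewrite (_ : (fun x => _) = (fun x => ((coordC j x * u x - (V u x - defectC x * h u x)) -
   (coordC j x * v x - (V v x - defectC x * h v x))) - defectC x * (h u - h v : b2) x)); last first.
  by apply/funext => x; rewrite !b2B; ring.
apply: le_trans (nrmB (L2B (L u) (L v)) (L2_mul _ mult_defect)) _.
rewrite (splitr e); apply: lerD hk.
by apply: le_trans (nrmB (L u) (L v)) _; have := (hV u).2; have := (hV v).2; lra.
Qed.

Definition realess (a : E -> R) := esscomm (fun x => (a x)%:C).

Lemma realess_cst c : realess (fun=> c). Proof. exact: esscomm_cst. Qed.

Lemma realessD a b : realess a -> realess b -> realess (fun x => a x + b x).
Proof.
move=> ha hb; rewrite /realess (_ : (fun x => _) = (fun x => (a x)%:C + (b x)%:C)).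
  exact: (esscommD ha hb).
by apply/funext => x; rewrite rmorphD.
Qed.

Lemma realessM a b : realess a -> realess b -> realess (fun x => a x * b x).
Proof.
move=> ha hb; rewrite /realess (_ : (fun x => _) = (fun x => (a x)%:C * (b x)%:C)).
  exact: (esscommM ha hb).
by apply/funext => x; rewrite rmorphM.
Qed.

Lemma realessZ c a : realess a -> realess (fun x => c * a x).
Proof. by move=> ha; exact: (realessM (realess_cst c) ha). Qed.

Lemma realessB a b : realess a -> realess b -> realess (fun x => a x - b x).
Proof.
move=> ha hb; rewrite (_ : (fun x => _) = (fun x => a x + -1 * b x)).
  exact: (realessD ha (realessZ _ hb)).
by apply/funext => x; rewrite mulN1r.
Qed.

Lemma realess_sum (J : Type) (s : seq J) (a : J -> E -> R) : (forall j, realess (a j)) ->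
  realess (fun x => \sum_(j <- s) a j x).
Proof.
move=> ha; elim: s => [|j s IH].
  by rewrite (_ : (fun x => _) = (fun=> 0)); [exact: realess_cst|apply/funext => x; rewrite big_nil].
rewrite (_ : (fun x => _) = (fun x => a j x + \sum_(i <- s) a i x)).
  exact: (realessD (ha j) IH).
by apply/funext => x; rewrite big_cons.
Qed.

Lemma realess_unif (a : E -> R) : mult (fun x => (a x)%:C) ->
  (forall e : R, 0 < e -> exists2 b, realess b & forall x, unit_ball x -> `|a x - b x| <= e) ->
  realess a.
Proof.
move=> ma h; apply: esscomm_unif => // e e0; have [b hb ab] := h e e0.
by exists (fun x => (b x)%:C) => // x xB; rewrite -rmorphB normcR ab.
Qed.

(* Visser's iteration, a polynomial approximation of the absolute value. *)
Fixpoint abs_iter (t : R) (m : nat) : R :=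
  if m is m'.+1 then abs_iter t m' + (t ^+ 2 - abs_iter t m' ^+ 2) / 2 else 0.

Lemma abs_iterP t m : `|t| <= 1 -> 0 <= abs_iter t m <= `|t| /\
  (`|t| - abs_iter t m) * (2 + m%:R * `|t|) <= 2 * `|t|.
Proof.
move=> t1; have tt : t ^+ 2 = `|t| ^+ 2 by rewrite real_normK ?num_real.
have s0 : 0 <= `|t| by [].
elim: m => [|m [/andP[y0 ys] IH]]; first by rewrite /= lexx s0 subr0 mul0r addr0 mulrC lexx.
rewrite /= tt -[m.+1%:R]natr1; move: (`|t|) (abs_iter t m) t1 s0 y0 ys IH => s y s1 s0 y0 ys IH.
have m0 : 0 <= m%:R :> R by [].
move: (m%:R : R) m0 IH => k k0 IH; split.
  have p0 : 0 <= (s - y) * (s + y) by apply: mulr_ge0; [rewrite subr_ge0|exact: addr_ge0].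
  have p1 : 0 <= (s - y) * (2 - (s + y)) by apply: mulr_ge0; lra.
  by rewrite subr_sqr; apply/andP; split; lra.
have E1 : s - (y + (s ^+ 2 - y ^+ 2) / 2) = (s - y) * (1 - (s + y) / 2) by ring.
have d0 : 0 <= s - y by rewrite subr_ge0.
have le1 : (s - y) * (1 - (s + y) / 2) <= (s - y) * (1 - s / 2).
  by apply: ler_wpM2l => //; lra.
have f0 : 0 <= 2 + (k + 1) * s by rewrite addr_ge0// mulr_ge0// addr_ge0.
rewrite E1; apply: le_trans (ler_wpM2r f0 le1) _; apply: le_trans IH.
rewrite -mulrA; apply: ler_wpM2l => //.
have : 0 <= k * s ^+ 2 by rewrite mulr_ge0// sqr_ge0.
by have := sqr_ge0 s; rewrite !expr2; lra.
Qed.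

Lemma abs_iter_err t m : `|t| <= 1 -> `| `|t| - abs_iter t m.+1| <= 2 / m.+1%:R.
Proof.
move=> t1; have [/andP[y0 ys] h] := abs_iterP m.+1 t1.
rewrite ger0_norm ?subr_ge0// ler_pdivlMr ?ltr0n//.
have [t0|t0] := eqVneq `|t| 0.
  move: y0 ys; rewrite t0 => y0 ys.
  have -> : abs_iter t m.+1 = 0 by apply/eqP; rewrite eq_le y0 ys.
  by rewrite subr0 mul0r.
have s0 : 0 < `|t| by rewrite lt0r t0/=.
rewrite -(ler_pM2r s0); apply: le_trans h; rewrite -mulrA mulrDr lerDr.
by rewrite mulr_ge0 ?subr_ge0.
Qed.

Lemma mult_abs (a : E -> R) : mult (fun x => (a x)%:C) -> mult (fun x => (`|a x|)%:C).
Proof.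
move=> [[ma _] [M aM]]; split; last first.
  by exists M => x xB; have := aM x xB; rewrite !normcR normr_id.
split; last exact: measurable_cst.
have ma' : measurable_fun (unit_ball : set B_) (a : B_ -> R) by [].
exact: (measurableT_comp (@normr_measurable R setT) ma').
Qed.

Lemma realess_abs a : realess a -> realess (fun x => `|a x|).
Proof.
move=> ha; have [ma _] := ha; apply: realess_unif; first exact: mult_abs.
move=> e e0; have [M M0 aM] := mult_bound ma.
have aM' x : unit_ball x -> `|a x / M| <= 1.
  move=> xB; rewrite normrM normfV (gtr0_norm M0) ler_pdivrMr// mul1r.
  by have := aM x xB; rewrite normcR.
pose m := Num.truncn (2 * M / e).
have hy k : realess (fun x => abs_iter (a x / M) k).
  have ht : realess (fun x => a x / M).
    rewrite (_ : (fun x => _) = (fun x => M^-1 * a x)); first exact: realessZ.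
    by apply/funext => x; rewrite mulrC.
  elim: k => [|k IH]; first exact: realess_cst.
  rewrite (_ : (fun x => _) = (fun x => abs_iter (a x / M) k + 2^-1 *
     (a x / M * (a x / M) - abs_iter (a x / M) k * abs_iter (a x / M) k))).
    exact: (realessD IH (realessZ _ (realessB (realessM ht ht) (realessM IH IH)))).
  by apply/funext => x /=; rewrite -!expr2 [2^-1 * _]mulrC.
exists (fun x => M * abs_iter (a x / M) m.+1).
  exact: (realessZ M (hy m.+1)).
move=> x xB; have E1 : `|a x| = M * `|a x / M|.
  by rewrite normrM normfV (gtr0_norm M0) mulrC mulfVK// gt_eqF.
rewrite E1 -mulrBr normrM (gtr0_norm M0).
apply: le_trans (ler_wpM2l (ltW M0) (abs_iter_err m (aM' x xB))) _.
rewrite mulrA ler_pdivrMr ?ltr0n// -ler_pdivrMl// mulrC [M * 2]mulrC.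
by rewrite ltW// truncnS_gt.
Qed.

Lemma realess_min a b : realess a -> realess b -> realess (fun x => Num.min (a x) (b x)).
Proof.
move=> ha hb; rewrite (_ : (fun x => _) = (fun x => 2^-1 * (a x + b x - `|a x - b x|))).
  exact: (realessZ _ (realessB (realessD ha hb) (realess_abs (realessB ha hb)))).
by apply/funext => x; rewrite minr_absE mulrC.
Qed.

Lemma realess_bigmin (s : seq E) (F : E -> E -> R) c : (forall z, realess (F z)) ->
  realess (fun x => foldr (fun z m => Num.min (F z x) m) c s).
Proof.
move=> hF; elim: s => [|z s IH]; first exact: realess_cst.
exact: (realess_min (hF z) IH).
Qed.

Lemma foldr_min_le (s : seq E) (F : E -> R) c z : z \in s ->
  foldr (fun z m => Num.min (F z) m) c s <= F z.
Proof.
elim: s => //= y s IH; rewrite inE => /orP[/eqP <-|zs].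
  by rewrite ge_min lexx.
by rewrite ge_min IH ?orbT.
Qed.

Lemma foldr_min_ge (s : seq E) (F : E -> R) c b : b <= c -> (forall z, z \in s -> b <= F z) ->
  b <= foldr (fun z m => Num.min (F z) m) c s.
Proof.
move=> bc; elim: s => //= y s IH h; rewrite le_min h ?mem_head//=.
by apply: IH => z zs; apply: h; rewrite inE zs orbT.
Qed.

Lemma realess_sqdist z : realess (fun x => dot (x - z) (x - z)).
Proof.
rewrite (_ : (fun x => _) = (fun x : E => \sum_(j <- index_enum 'I_n)
   (x ord0 j - z ord0 j) * (x ord0 j - z ord0 j))); last first.
  by apply/funext => x; apply: eq_bigr => j _; rewrite !mxE.
apply: realess_sum => j.
have h := realessB (esscomm_coord j) (realess_cst (z ord0 j)).
exact: (realessM h h).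
Qed.

Lemma ball_net (d : R) : 0 < d -> exists s : seq E, (forall z, z \in s -> unit_ball z) /\
  forall x, unit_ball x -> exists2 z, z \in s & enorm (x - z) < d.
Proof.
move=> d0; pose t := Num.min (d / 2) 1.
have t0 : 0 < t by rewrite lt_min divr_gt0 ?ltr01.
have t1 : t <= 1 by rewrite ge_min lexx orbT.
have td : t <= d / 2 by rewrite ge_min lexx.
have d20 : 0 < d / 2 by rewrite divr_gt0.
have [s [sK sN]] := compact_net (@compact_closed_ball R n (1 - t)) d20.
exists s; split=> [z /sK/= zt|x xB].
  by apply: le_lt_trans zt _; rewrite gtrBl.
have x1 : enorm x < 1 := xB; have x0 := enorm_ge0 x.
have c0 : 0 <= 1 - t by rewrite subr_ge0.
have [|z zs xz] := sN ((1 - t) *: x).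
  by rewrite /= enormZ ger0_norm// ler_piMr// ltW.
exists z => //; rewrite (_ : x - z = t *: x + ((1 - t) *: x - z)); last first.
  by rewrite addrA -scalerDl (addrC t) subrK scale1r.
apply: le_lt_trans (enormD _ _) _; rewrite (splitr d); apply: ler_ltD => //.
rewrite enormZ gtr0_norm//; apply: le_trans td.
by rewrite ler_piMr ?(ltW t0)// ltW.
Qed.

Definition ball_unif (a : E -> R) := forall e : R, 0 < e -> exists2 d : R, 0 < d &
  forall x y, unit_ball x -> unit_ball y -> enorm (x - y) < d -> `|a x - a y| < e.

Lemma ball_unif_bounded a : ball_unif a ->
  exists2 M : R, 0 <= M & forall x, unit_ball x -> `|a x| <= M.
Proof.
move=> /(_ 1 ltr01)[d d0 ad]; have [s [sB sN]] := ball_net d0.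
exists (\sum_(z <- s) `|a z| + 1); first by rewrite addr_ge0// sumr_ge0.
move=> x xB; have [z zs xz] := sN x xB.
rewrite -[a x](subrK (a z)) addrC; apply: le_trans (ler_normD _ _) _.
apply: lerD; last by rewrite ltW// ad//; exact: sB.
by rewrite (big_rem z)//= lerDl sumr_ge0.
Qed.

Lemma ball_unif_mult a : ball_unif a -> mult (fun x => (a x)%:C).
Proof.
move=> ua; have [M _ aM] := ball_unif_bounded ua; apply: (mult_continuous _ aM) => x xB.
apply/continuous_enormP => e e0; have [d d0 ad] := ua e e0.
have x1 : enorm x < 1 := xB.
exists (Num.min d (1 - enorm x)) => [|y]; first by rewrite lt_min d0 subr_gt0.
rewrite lt_min => /andP[yd y1]; apply: ad => //.
by have := enormD (y - x) x; rewrite subrK enormB /unit_ball /=; lra.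
Qed.

Lemma realess_ball_unif a : ball_unif a -> realess a.
Proof.
move=> ua; apply: realess_unif; first exact: ball_unif_mult.
move=> e e0; have [M M0 aM] := ball_unif_bounded ua.
have [|d d0 ad] := ua (e / 2); first by rewrite divr_gt0.
pose C := (M + M) / d ^+ 2; have C0 : 0 <= C by rewrite divr_ge0 ?addr_ge0// sqr_ge0.
pose t := Num.min d (Num.sqrt (e / 2 / (C + 1))).
have C1 : 0 < C + 1 by rewrite ltr_wpDl.
have eC : 0 < e / 2 / (C + 1) by rewrite !divr_gt0.
have t0 : 0 < t by rewrite lt_min d0 sqrtr_gt0.
have [s [sB sN]] := ball_net t0.
pose F z x := a z + C * dot (x - z) (x - z).
exists (fun x => foldr (fun z m => Num.min (F z x) m) M s).
  apply: realess_bigmin => z; exact: (realessD (realess_cst (a z)) (realessZ C (realess_sqdist z))).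
move=> x xB; rewrite ler_norml; apply/andP; split.
  have [z zs xz] := sN x xB; rewrite lerBrDl lerBlDr.
  apply: le_trans (foldr_min_le (fun z => F z x) M zs) _.
  move: xz; rewrite lt_min => /andP[xzd xzt].
  have := ad x z xB (sB z zs) xzd; rewrite ltr_norml => /andP[h1 h2].
  have : C * dot (x - z) (x - z) <= e / 2.
    rewrite -enorm_sqr; apply: (@le_trans _ _ (C * (e / 2 / (C + 1)))).
      apply: ler_wpM2l => //; rewrite -[leRHS]sqr_sqrtr ?(ltW eC)//.
      by rewrite ler_pXn2r ?nnegrE ?enorm_ge0 ?sqrtr_ge0// ltW.
    by rewrite mulrCA ler_piMr ?divr_ge0 ?(ltW e0)// ler_pdivrMr// mul1r lerDl.
  by rewrite /F; lra.
rewrite lerBlDr -lerBlDl; apply: foldr_min_ge => [|z zs].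
  by have := aM x xB; rewrite ler_norml => /andP[_ ?]; have := e0; lra.
have zB := sB z zs; rewrite /F.
have q0 : 0 <= C * dot (x - z) (x - z) by rewrite mulr_ge0// dot_ge0.
have [xz|xz] := ltP (enorm (x - z)) d.
  by have := ad x z xB zB xz; rewrite ltr_norml => /andP[h1 h2]; lra.
have : M + M <= C * dot (x - z) (x - z).
  rewrite -enorm_sqr /C mulrAC ler_pdivlMr ?exprn_gt0//.
  by apply: ler_wpM2l; rewrite ?addr_ge0// ler_pXn2r ?nnegrE ?enorm_ge0// ltW.
have := aM x xB; have := aM z zB; rewrite !ler_norml => /andP[p1 p2] /andP[p3 p4].
by lra.
Qed.

Lemma unif_Re_Im f : unif_continuous_on unit_ball f ->
  ball_unif (fun x => Re (f x)) /\ ball_unif (fun x => Im (f x)).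
Proof.
move=> uf; split=> e e0; have [d d0 fd] := uf e e0; exists d => // x y xB yB xy.
  by rewrite -raddfB; apply: le_lt_trans (fd x y xB yB xy); exact: (ReIm_le_normc _).1.
by rewrite -raddfB; apply: le_lt_trans (fd x y xB yB xy); exact: (ReIm_le_normc _).2.
Qed.

Lemma esscomm_unif_continuous f : unif_continuous_on unit_ball f -> esscomm f.
Proof.
move=> /unif_Re_Im[ur ui].
rewrite (_ : f = (fun x => (Re (f x))%:C + 'i * (Im (f x))%:C)).
  exact: (esscommD (realess_ball_unif ur) (esscommZ _ (realess_ball_unif ui))).
by apply/funext => x; case: (f x) => a b; simpc.
Qed.

Lemma compact_of_tb (A : b2 -> b2) : linear A -> tb (fun u => b2norm (A u)) ->
  compact_operator A.
Proof.
move=> lA tA; split=> //; rewrite precompactE compact_ultra => F UF.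
set S := [set A u | u in _] => FA.
have PF : ProperFilter F by exact: ultra_proper.
have small (e : R) : 0 < e -> exists v : b2, F (b2ball v e).
  move=> e0; have e30 : 0 < e / 3 by rewrite divr_gt0.
  have [K [c hc]] := tA 1 _ e30.
  pose U k := [set w | exists u, [/\ b2norm u <= 1, c u = k & b2norm (w - A u) < e / 3]].
  have [k Uk] : exists k, F (U k).
    apply: contrapT => /forallNP nU.
    have nF k : F (~` U k) by have [/nU|] := in_ultra_setVsetC (U k) UF.
    have FI : F [set w | forall k, (~` U k) w] by exact: filter_forall.
    have [w [Sw nw]] := filter_ex (filterI FA FI).
    have wS : nbhs w (b2ball w (e / 3)) by exists (e / 3).
    have [_ [[u u1 <-] wu]] := Sw _ wS.
    by apply: (nw (c u)); exists u.
  have [w0 [u0 [u01 cu0 _]]] := filter_ex Uk.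
  exists (A u0); apply: filterS Uk => w [u [u1 cu wu]]; rewrite /b2ball /=.
  rewrite (_ : A u0 - w = A (u0 - u) - (w - A u)); last first.
    by rewrite (linearBb lA) opprB addrA subrK.
  apply: le_lt_trans (b2normB _ _) _.
  by have := hc u0 u u01 u1 (etrans cu0 (esym cu)); lra.
have k0 (k : nat) : 0 < (k.+1%:R)^-1 :> R by rewrite invr_gt0 ltr0n.
pose v k := projT1 (cid (small _ (k0 k))).
have Fv k : F (b2ball (v k) (k.+1%:R)^-1) := projT2 (cid (small _ (k0 k))).
have tail (e : R) : 0 < e -> exists N : nat, forall k, (N <= k)%N -> (k.+1%:R)^-1 < e.
  move=> e0; exists (Num.truncn e^-1).+1 => k Nk.
  rewrite invf_plt ?posrE ?ltr0n//; apply: lt_le_trans (truncnS_gt _) _.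
  by rewrite ler_nat (leq_trans Nk).
have [|w hw] := @b2_complete v.
  move=> e e0; have [|N hN] := tail (e / 2); first by rewrite divr_gt0.
  exists N => k l Nk Nl; have [x [xk xl]] := filter_ex (filterI (Fv k) (Fv l)).
  have := b2ball_triangle xk (b2ball_sym xl); rewrite /b2ball /= => h.
  apply/ltW/(lt_le_trans h).
  have := hN k Nk; have := hN l Nl.
  by move: (k.+1%:R^-1 : R) (l.+1%:R^-1 : R) => p q *; lra.
have Fw : F --> w.
  move=> X [e /= e0 wX]; have e20 : 0 < e / 2 by rewrite divr_gt0.
  have [N1 h1] := hw _ (divr_gt0 e20 (ltr0n _ 2)); have [N2 h2] := tail _ e20.
  pose k := maxn N1 N2; apply: filterS (Fv k) => x xk; apply: wX.
  have wk : b2norm (w - v k) <= e / 2 / 2.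
    by rewrite -b2normN opprB; exact: h1 (leq_maxl _ _).
  have vx : b2ball w (e / 2) (v k) by rewrite /b2ball /=; lra.
  have := b2ball_triangle vx xk; rewrite /b2ball /= => /lt_le_trans; apply.
  by have := h2 k (leq_maxr _ _); move: (k.+1%:R^-1 : R) => p *; lra.
exists w; split=> // X /nbhs_interior/Fw FX.
by have [x [xS xX]] := filter_ex (filterI FA FX); exact: xS.
Qed.

Lemma compact_finite_net (X : set b2) (d : R) : compact X -> 0 < d ->
  exists s : seq b2, forall x, X x -> exists2 y, y \in s & b2norm (y - x) < d.
Proof.
move=> /compact_near_coveringP cX d0.
pose F : set_system (seq b2) := [set Y | exists s0 : seq b2, forall s : seq b2, {subset s0 <= s} -> Y s].
have FF : Filter F.
  split=> [|Y Z [s sY] [t tZ]|Y Z YZ [s sY]]; first by exists [::].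
    exists (s ++ t) => r rs; split; [apply: sY|apply: tZ] => x xs; apply: rs.
      by rewrite mem_cat xs.
    by rewrite mem_cat xs orbT.
  by exists s => r rs; exact/YZ/sY.
have [|s0 hs0] := cX _ F (fun s x => exists2 y, y \in s & b2norm (y - x) < d) FF.
  move=> x Xx; exists (b2ball x d, [set s : seq b2 | x \in s]); last first.
    by move=> [x' s] /= [xx' xs]; exists x.
  split=> /=; first by exists d.
  by exists [:: x] => s; apply; rewrite mem_head.
by exists s0; exact: hs0.
Qed.

Lemma tb_of_compact (A : b2 -> b2) : compact_operator A -> tb (fun u => b2norm (A u)).
Proof.
move=> [lA]; rewrite precompactE; set S := [set A u | u in _] => cS r e e0.
pose r1 := `|r| + 1; have r10 : 0 < r1 by rewrite ltr_wpDl.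
have rr1 : r <= r1 by rewrite (le_trans (ler_norm r))// lerDl.
pose d := e / (4 * r1); have d0 : 0 < d by rewrite divr_gt0// mulr_gt0.
have [s SD] := compact_finite_net cS d0.
pose near_ (u w : b2) := `[< b2norm (w - A (r1^-1%:C *: u)) < d >].
pose c u : 'I_(size s).+1 := inord (find (near_ u) s).
have has_near u : b2norm u <= r -> has (near_ u) s.
  move=> ur; have uS : closure S (A (r1^-1%:C *: u)).
    apply: subset_closure; exists (r1^-1%:C *: u) => //=.
    by rewrite b2normZ normcR gtr0_norm ?invr_gt0// ler_pdivrMl// mulr1 (le_trans ur).
  by have [w ws wu] := SD _ uS; apply/hasP; exists w => //; apply/asboolP.
exists ('I_(size s).+1 : finType), c => u v ur vr cuv.
have := congr1 val cuv; rewrite /= !inordK ?ltnS ?find_size// => E1.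
have := nth_find 0 (has_near u ur); have := nth_find 0 (has_near v vr).
rewrite E1 => /asboolP hv /asboolP hu.
rewrite (_ : u - v = r1%:C *: (r1^-1%:C *: u - r1^-1%:C *: v)); last first.
  by rewrite -scalerBr scalerA -rmorphM mulfV ?scale1r// gt_eqF.
rewrite -[X in A X]addr0 lA linear0b// addr0 b2normZ normcR gtr0_norm// linearBb//.
set w := nth _ _ _ in hu hv.
rewrite (_ : _ - _ = (w - A (r1^-1%:C *: v)) - (w - A (r1^-1%:C *: u))); last first.
  by rewrite opprB [RHS]addrC subrKA.
apply: (@le_trans _ _ (r1 * (d + d))).
  by rewrite ler_pM2l//; apply: le_trans (b2normB _ _) _; apply: lerD; exact: ltW.
rewrite /d (_ : r1 * _ = e / 2); last by field; exact: lt0r_neq0.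
by rewrite ler_pdivrMr// mulr_natr mulr2n lerDl ltW.
Qed.

Lemma linear_comp (A B : b2 -> b2) : linear A -> linear B -> linear (A \o B).
Proof. by move=> lA lB c u v; rewrite /= lB lA. Qed.

Lemma linear_sub (A B : b2 -> b2) : linear A -> linear B -> linear (fun u => A u - B u).
Proof. by move=> lA lB c u v; rewrite lA lB scalerBr opprD addrACA. Qed.

Lemma bounded_sub (A B : b2 -> b2) : bounded_operator A -> bounded_operator B ->
  bounded_operator (fun u => A u - B u).
Proof.
move=> [lA [M AM]] [lB [N BN]]; split; first exact: linear_sub.
exists (M + N) => u; apply: le_trans (b2normB _ _) _.
by rewrite mulrDl; exact: lerD.
Qed.

Lemma bounded_comp (A B : b2 -> b2) : bounded_operator A -> bounded_operator B ->
  bounded_operator (A \o B).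
Proof.
move=> [lA [M AM]] [lB [N BN]]; split; first exact: linear_comp.
exists (`|M| * N) => u /=; apply: le_trans (AM _) _.
apply: (@le_trans _ _ (`|M| * b2norm (B u))).
  by apply: ler_wpM2r; [exact: b2norm_ge0|exact: ler_norm].
by rewrite -mulrA ler_wpM2l.
Qed.

Lemma toeplitz_mulr f g : mult g -> esscomm f ->
  tb (fun u => b2norm (T_ (fun x => g x * f x) u - T_ g (T_ f u))).
Proof.
move=> mg [mf tf]; have [M M0 gM] := mult_bound mg; apply: (tb_dom (ltW M0) _ tf) => u.
have rB : L2ball nu (fun x => f x * u x - T_ f u x).
  by apply: L2ball_B; [exact: L2ball_mul (L2ball_b2 u)|exact: L2ball_b2].
have gB := L2ball_mul mg rB.
rewrite (_ : _ - _ = oproj (fun x => g x * (f x * u x - T_ f u x))).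
  apply: le_trans (orthoproj_le gB.1) _; apply: nrm_domB => //; first exact: ltW.
  by move=> x xB; rewrite normcM ler_wpM2r ?normc_ge0// gM.
rewrite -orthoprojB; [|exact: (L2_mul u (multM mg mf))|exact: (L2_mul _ mg)].
by congr oproj; apply/funext => x; ring.
Qed.

(* With w = (I - Q)(g u) and v = T_gf u - T_f T_g u = Q(f w), |v|^2 = <w, conj f v>
   = <w, (I - Q)(conj f v)>. *)
Lemma toeplitz_mull f g : mult g -> mult f -> esscomm (fun x => conjc (f x)) ->
  tb (fun u => b2norm (T_ (fun x => g x * f x) u - T_ f (T_ g u))).
Proof.
move=> mg mf [mcf tcf]; have [M M0 gM] := mult_bound mg.
pose A u := T_ (fun x => g x * f x) u - T_ f (T_ g u).
have bA : bounded_operator A.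
  apply: bounded_sub; first exact: (toeplitz_bounded (multM mg mf)).
  exact: (bounded_comp (toeplitz_bounded mf) (toeplitz_bounded mg)).
apply: (tb_sqrt (C := M) (ltW M0) _ _ _ (tb_comp bA tcf)) => u.
- exact: b2norm_ge0.
- exact: hank_ge0.
rewrite -/(A u); pose w x := g x * u x - T_ g u x.
have wL : L2 w := L2_res u mg.
have wB : L2ball nu w.
  by apply: L2ball_B; [exact: L2ball_mul (L2ball_b2 u)|exact: L2ball_b2].
have fwL := (L2ball_mul mf wB).1.
have AE : A u = oproj (fun x => f x * w x).
  rewrite /A -orthoprojB; [|exact: (L2_mul u (multM mg mf))|exact: (L2_mul _ mf)].
  by congr oproj; apply/funext => x; rewrite /w; ring.
have [vL _] := L2ball_b2 (A u); have qL := (L2ball_b2 (T_ (fun x => conjc (f x)) (A u))).1.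
have w_orth : rip w (T_ (fun x => conjc (f x)) (A u)) = 0.
  exact: (orthoproj_rip _ (L2_mul u mg)).
have cL := L2_mul (A u) mcf.
have -> : b2norm (A u) ^+ 2 = rip w (fun x => conjc (f x) * A u x - T_ (fun x => conjc (f x)) (A u) x).
  rewrite ripC (ripBl cL qL wL) (ripC nu _ w) (ripC nu (T_ _ _)) w_orth subr0.
  rewrite -rip_mul -[b2norm (A u)]/(nrm (A u)) (nrm_sqr vL).
  apply/eqP; rewrite eq_sym -subr_eq0 -ripBl//; apply/eqP.
  by rewrite {1}AE; exact: orthoproj_rip.
apply: le_trans (rip_cs wL (L2_res _ mcf)) _.
apply: ler_wpM2r; first exact: hank_ge0.
apply: le_trans (orthoproj_res_le (L2_mul u mg)) _.
by apply: nrm_mul => //; exact: ltW.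
Qed.

Lemma harm_rot (a : E -> R) (U : 'M[R]_n) : U *m U^T = 1%:M -> harm a ->
  harm (fun x => a (x *m U)).
Proof.
move=> UU ha; apply: (rharmonic_of_poisson (P := P) mth th1) => s s01.
have ca (x : E) : enorm x < 1 -> {for x, continuous (fun y : E => a (y *m U))}.
  move=> x1; have cx : {for x, continuous (fun y : E => y *m U)} by exact: continuous_mulmx.
  by apply: (continuous_comp cx); apply: (harm_cont ha); rewrite enorm_orth.
have bs := bm_sphere_cont mth th1 ca s01; split=> [|x x1]; first exact: bs.
have xU1 : enorm (x *m U) < 1 by rewrite enorm_orth.
rewrite -scalemxAl (poisson_formula mth th1 n_gt0 th_inv ha s01 xU1).
pose g (z : E) : R := poisson (x *m U) z * a (s *: z).
have bg : bm (fun w : B_ => g (dir i0 w)).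
  by apply: bmM; [exact: (bm_poisson mth th1 xU1)|exact: (bm_sphere mth th1 ha s01)].
rewrite /pois_int -[LHS]/(\int[P]_w g (dir i0 w)) -(th_inv UU bg).
by apply: eq_Rintegral => w _; rewrite /g poisson_orth// scalemxAl.
Qed.

Lemma nrm_rot h (U : 'M[R]_n) : U *m U^T = 1%:M -> L2 h ->
  L2 (fun x => h (x *m U)) /\ nrm (fun x => h (x *m U)) = nrm h.
Proof.
move=> UU hL; have [mh hoo] := (in_L2P nu h).1 hL.
have mU : cmeasurable_on setT (fun x : E => h (x *m U)).
  by split; [exact: (measurableT_comp mh.1 (measurable_mulmx UU))|
             exact: (measurableT_comp mh.2 (measurable_mulmx UU))].
pose F (x : B_) := (rdot (h x) (h x))%:E.
have F0 x : (0 <= F x)%E by rewrite lee_fin -normc_sqr sqr_ge0.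
have mF : measurable_fun setT F by apply/measurable_EFinP; exact: cmeasurable_rdot.
have FE : (\int[nu]_x F (x *m U) = \int[nu]_x F x)%E := integral_orth nu_inv UU mF F0.
have UL : L2 (fun x => h (x *m U)).
  apply/in_L2P; split=> //; under eq_integral do rewrite normc_sqr.
  by rewrite FE; under eq_integral do rewrite /F -normc_sqr.
split=> //; apply/eqP; rewrite -(@eqrXn2 _ 2) ?nrm_ge0// !nrm_sqr//.
by rewrite /rip /Rintegral -/F FE.
Qed.

Lemma rotation (U : 'M[R]_n) : U *m U^T = 1%:M ->
  exists2 W : b2 -> b2, bounded_operator W & forall u x, W u x = u (x *m U).
Proof.
move=> UU; have ex (u : b2) : exists v : b2, forall x, v x = u (x *m U).
  have [uL u0] := L2ball_b2 u; have [UL _] := nrm_rot UU uL.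
  have Pv : (fun x => u (x *m U)) \in b2_pred nu.
    rewrite inE; split; [split; [exact: (harm_rot UU (b2_Re u))|exact: (harm_rot UU (b2_Im u))]
      |exact: UL|].
    by move=> x xB; apply: u0; rewrite /unit_ball /= enorm_orth.
  by exists (B2 Pv).
exists (fun u => projT1 (cid (ex u))) => [|u x]; last exact: (projT2 (cid (ex u)) x).
split=> [c u v|].
  apply: b2_ext => x _; rewrite b2D b2Z !(projT2 (cid (ex _))); exact: b2D.
exists 1 => u; rewrite mul1r le_eqVlt; apply/orP; left; apply/eqP.
rewrite -[RHS](nrm_rot UU (L2ball_b2 u).1).2; congr nrm; apply/funext => x.
exact: (projT2 (cid (ex u)) x).
Qed.

Definition small f := mult f /\ tb (fun u => nrm (fun x => f x * u x)).

Lemma smallD f g : small f -> small g -> small (fun x => f x + g x).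
Proof.
move=> [mf tf] [mg tg]; split; first exact: multD.
apply: tb_le (tb_add tf tg) => u; rewrite (_ : (fun x => _) = (fun x => f x * u x + g x * u x)).
  by apply: nrmD; exact: L2_mul.
by apply/funext => x; rewrite mulrDl.
Qed.

Lemma small_dom c f g : mult f -> small g -> 0 <= c ->
  (forall x, unit_ball x -> normc (f x) <= c * normc (g x)) -> small f.
Proof.
move=> mf [mg tg] c0 fg; split=> //; apply: (tb_dom c0 _ tg) => u.
apply: nrm_domB; [exact: c0|exact: (L2ball_mul mf (L2ball_b2 u))|exact: (L2ball_mul mg (L2ball_b2 u))|].
by move=> x xB; rewrite !normcM mulrA ler_wpM2r ?normc_ge0// fg.
Qed.

Definition bump (z : E) (d : R) (x : E) : R[i] := (\1_[set y | enorm (y - z) < d] x)%:C.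

Lemma mult_indic (A : set E) : measurable (A : set B_) -> mult (fun x => (\1_A x : R)%:C).
Proof.
move=> mA; split; last first.
  by exists 1 => x _; rewrite normcR indicE; case: (x \in A); rewrite ?normr1 ?normr0 ?ler01.
split; last exact: measurable_cst.
by apply: (@measurable_funS _ _ _ _ setT) => //; exact: measurable_indic.
Qed.

Lemma mult_bump z d : mult (bump z d).
Proof.
apply: mult_indic; apply: measurable_open.
rewrite (_ : mkset _ = (fun y => enorm (y - z)) @^-1` [set r | r < d])//.
apply: open_comp => [y _|]; last exact: open_lt.
apply/continuous_enormP => e e0; exists e => // y' yy'.
by apply: le_lt_trans (enorm_dist _ _) _; rewrite opprB addrA subrK.
Qed.

Lemma bump_in z d x : enorm (x - z) < d -> bump z d x = 1.
Proof. by move=> h; rewrite /bump indicE mem_set. Qed.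

Lemma bump_out z d x : ~ enorm (x - z) < d -> bump z d x = 0.
Proof. by move=> h; rewrite /bump indicE memNset. Qed.

Lemma small_bump_rot z d (U : 'M[R]_n) : U *m U^T = 1%:M ->
  small (bump z d) -> small (bump (z *m U) d).
Proof.
move=> UU [mb tz]; split; first exact: mult_bump.
have [W bW WE] := rotation UU; apply: tb_le (tb_comp bW tz) => u.
rewrite -(nrm_rot UU (L2_mul u (mult_bump (z *m U) d))).2 le_eqVlt; apply/orP; left; apply/eqP.
congr nrm; apply/funext => x; rewrite WE; congr (_ * _).
have E1 : enorm (x *m U - z *m U) = enorm (x - z) by rewrite -mulmxBl enorm_orth.
have [h|h] := pselect (enorm (x - z) < d); first by rewrite !bump_in// E1.
by rewrite !bump_out// E1.
Qed.

Lemma tb_norm_of_bump z d : enorm z = 1 -> 0 < d -> small (bump z d) -> tb (@b2norm R n nu).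
Proof.
move=> z1 d0 sz; pose e := Num.min (d / 2) (1 / 2).
have e0 : 0 < e by rewrite lt_min !divr_gt0.
have ed : e <= d / 2 by rewrite ge_min lexx.
have e1 : e <= 1 / 2 by rewrite ge_min lexx orbT.
have [s [sS sN]] := compact_net (@compact_sphere R n 1) (divr_gt0 d0 (ltr0n _ 2)).
pose k x : R[i] := (\1_[set y : E | enorm y < 1 - e] x : R)%:C + \sum_(y <- s) bump y d x.
have sk : small k.
  apply: smallD.
    have mk : mult (fun x : E => (\1_[set y : E | enorm y < 1 - e] x : R)%:C).
      apply: mult_indic; apply: measurable_open.
      rewrite (_ : mkset _ = (@enorm R n) @^-1` [set r | r < 1 - e])//.
      by apply: open_comp => [? _|]; [exact: continuous_enorm|exact: open_lt].
    split=> //; apply: tb_vanishing => // r r0; exists (1 - e); first by rewrite gtrBl.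
    move=> x _ xe; rewrite indicE memNset ?normc0 ?(ltW r0)//= => h.
    by move: xe; rewrite leNgt h.
  elim: s sS {sN k} => [_|y s IH sS].
    rewrite (_ : (fun x => _) = (fun=> 0)); last by apply/funext => x; rewrite big_nil.
    split; first exact: mult_cst; apply: tb_le tb0 => u.
    by rewrite (_ : (fun x => _) = (fun=> 0)) ?nrm0//; apply/funext => x; rewrite mul0r.
  rewrite (_ : (fun x => _) = (fun x => bump y d x + \sum_(y <- s) bump y d x)); last first.
    by apply/funext => x; rewrite big_cons.
  apply: smallD; last by apply: IH => y' y's; apply: sS; rewrite inE y's orbT.
  have y1 : enorm y = 1 by apply: sS; rewrite mem_head.
  have [U UU <-] : exists2 U, U *m U^T = 1%:M & z *m U = y.
    by apply: orth_transitive; rewrite z1 y1.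
  exact: small_bump_rot.
have kr x : exists2 r : R, k x = r%:C & (unit_ball x -> 1 <= r).
  exists (\1_[set y : E | enorm y < 1 - e] x + \sum_(y <- s) \1_[set y' | enorm (y' - y) < d] x).
    by rewrite /k rmorphD rmorph_sum.
  move=> xB; have x1 : enorm x < 1 := xB.
  have S0 (t : seq E) : 0 <= \sum_(y <- t) (\1_[set y' | enorm (y' - y) < d] x : R).
    by apply: sumr_ge0 => y _; rewrite indicE.
  have [xe|xe] := ltP (enorm x) (1 - e); first by rewrite indicE mem_set//= lerDl S0.
  rewrite indicE memNset /=; last by move=> h; move: xe; rewrite leNgt h.
  have x0 : 0 < enorm x by lra.
  have [|y ys yx] := sN ((enorm x)^-1 *: x).
    by rewrite /= enormZ gtr0_norm ?invr_gt0// mulVf// gt_eqF.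
  rewrite (big_rem y)//= add0r indicE mem_set ?lerDl ?S0//=.
  rewrite (_ : x - y = (x - (enorm x)^-1 *: x) + ((enorm x)^-1 *: x - y)); last first.
    by rewrite addrA subrK.
  apply: le_lt_trans (enormD _ _) _; rewrite (splitr d); apply: ler_ltD => //.
  rewrite -{1}[x]scale1r -scalerBl enormZ -[X in _ * X]gtr0_norm// -normrM mulrBl mul1r.
  by rewrite mulVf ?gt_eqF// distrC ger0_norm ?subr_ge0 ?(ltW x1)//; lra.
apply: tb_le sk.2 => u; apply: (@le_trans _ _ (1 * nrm (fun x => k x * u x))); last by rewrite mul1r.
apply: nrm_domB => //; [exact: L2ball_b2|exact: (L2ball_mul sk.1 (L2ball_b2 u))|].
move=> x xB; rewrite mul1r normcM ler_peMl ?normc_ge0//; have [r -> /(_ xB) r1] := kr x.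
by rewrite normcR (le_trans r1)// ler_norm.
Qed.

Lemma int_sqr_sub (f g : B_ -> R) : bm f -> bm g -> \int[P]_w (f w * g w) = 0 ->
  \int[P]_w ((f w - g w) ^+ 2) = \int[P]_w (f w ^+ 2) + \int[P]_w (g w ^+ 2).
Proof.
move=> bf bg fg; have b2f := bmX 2 bf; have b2g := bmX 2 bg; have bfg := bmM bf bg.
have bs : bm (fun w => 2 * (f w * g w)) by apply: bmM => //; exact: bm_cst.
transitivity (\int[P]_w ((f w ^+ 2 + g w ^+ 2) - 2 * (f w * g w))).
  by apply: eq_Rintegral => w _; ring.
by rewrite (bm_intB (bmD b2f b2g) bs) (bm_intD b2f b2g) (bm_intZ 2 bfg) fg mulr0 subr0.
Qed.

Lemma energy_orth (a b : E -> R) : harm a -> harm b ->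
  (forall r : R, 0 <= r < 1 -> \int[P]_w (a (r *: dir i0 w) * b (r *: dir i0 w)) = 0) ->
  (energy nu (fun x => (a x - b x)%R) = energy nu a + energy nu b)%E.
Proof.
move=> ha hb ab; have hd := rharmonicB (@open_unit_ball R n) ha hb.
have EE c (hc : harm c) := energyE polar hc.
have ME c (hc : harm c) := measurable_mean2 polar hc.
rewrite (EE _ hd) (EE _ ha) (EE _ hb) -ge0_integralD.
- apply: eq_integral => x /set_mem xB; rewrite -EFinD; congr EFin.
  have x01 : 0 <= enorm x < 1 by rewrite enorm_ge0.
  have ba := bm_sphere mth th1 ha x01; have bb := bm_sphere mth th1 hb x01.
  exact: (int_sqr_sub ba bb (ab _ x01)).
- exact: mB.
- by move=> x _; rewrite lee_fin; apply: mean2_ge0.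
- by apply/measurable_EFinP; exact: ME.
- by move=> x _; rewrite lee_fin; apply: mean2_ge0.
- by apply/measurable_EFinP; exact: ME.
Qed.

Lemma not_tb_norm : (1 < n)%N -> ~ tb (@b2norm R n nu).
Proof.
move=> n1 /(_ 1 1 ltr01)[K [c hc]].
pose j1 := Ordinal (ltnW n1); pose j2 := Ordinal n1.
have j12 : j1 != j2 by [].
pose a k x : R := (planar j1 j2 k x).1.
have ha k : harm (a k) := rharmonic_planar j12 k.
have aZ k s x : a k (s *: x) = s ^+ k * a k x by rewrite /a planarZ.
have afin k : (energy nu (a k) < +oo)%E.
  have [M hM] := @compact_bounded_fun _ _ [set x : E | enorm x <= 1] (a k)
    (@compact_closed_ball _ _ _) (fun x _ => (continuous_planar j1 j2 k x).1).
  by apply: (energy_bounded (M := M) nu (ha k)) => x x1; apply: hM; exact: ltW.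
have e00 : energy nu (fun=> 0%R) = 0%E.
  by rewrite /energy; under eq_integral do rewrite expr0n; rewrite integral0.
have efin0 : (energy nu (fun=> 0%R) < +oo)%E by rewrite e00.
have ex k : exists w : b2, forall x, unit_ball x -> w x = (a k x)%:C.
  exact: (b2_of_harm (ha k) (rharmonic_cst 0 (@open_unit_ball R n)) (afin k) efin0).
pose w k := projT1 (cid (ex k)).
have wE k x : unit_ball x -> w k x = (a k x)%:C by exact: (projT2 (cid (ex k)) x).
have N0 k : 0 < b2norm (w k).
  rewrite lt0r b2norm_ge0 andbT; apply/eqP => /b2norm_eq0 w0.
  pose x : E := 2^-1 *: delta_mx ord0 j1.
  have xB : unit_ball x.
    by rewrite /unit_ball /= enormZ enorm_delta mulr1 gtr0_norm ?invr_gt0// invf_lt1// ltr1n.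
  have := wE k x xB; rewrite w0 b2_0 /x aZ /a planar_delta// mulr1 => /(congr1 Re) /= /esym/eqP.
  by rewrite expf_eq0 invr_eq0 pnatr_eq0 andbF.
pose e k : b2 := (b2norm (w k))^-1%:C *: w k.
have e1 k : b2norm (e k) = 1.
  by rewrite b2normZ normcR gtr0_norm ?invr_gt0// mulVf// gt_eqF.
pose b k x := (b2norm (w k))^-1 * a k x.
have hb k : harm (b k) := rharmonicZ _ (@open_unit_ball R n) (ha k).
have eE k x : unit_ball x -> e k x = (b k x)%:C.
  by move=> xB; rewrite b2Z wE// -rmorphM.
have eb k : energy nu (b k) = 1%E.
  have := b2norm_energy (e k); rewrite e1 expr1n => ->.
  rewrite [X in (_ + X)%E](energy_eq (v := fun=> 0)); last by move=> x xB; rewrite eE.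
  by rewrite e00 adde0; apply: energy_eq => x xB; rewrite eE.
have cross k l r : k != l -> 0 <= r < 1 ->
    \int[P]_w (b k (r *: dir i0 w) * b l (r *: dir i0 w)) = 0.
  move=> kl r01; pose W := \int[P]_w (a k (dir i0 w) * a l (dir i0 w)).
  pose q : R := 2^-1.
  have q0 : 0 < q by rewrite invr_gt0.
  have q1 : q < 1 by rewrite invf_lt1// ltr1n.
  have q01 : 0 <= q < 1 by rewrite ltW.
  have q201 : 0 <= q ^+ 2 < 1 by rewrite exprn_ge0 ?(ltW q0)//= expr_lt1 ?ltW.
  have bW i : bm (fun w : B_ => a i (dir i0 w)).
    rewrite (_ : (fun w => _) = (fun w => q^-1 ^+ i * a i (q *: dir i0 w))).
      by apply: bmM; [exact: bm_cst|exact: (bm_sphere mth th1 (ha i) q01)].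
    by apply/funext => z; rewrite aZ mulrA -exprMn mulVf ?expr1n ?mul1r// gt_eqF.
  have bWW := bmM (bW k) (bW l).
  have WE s t : \int[P]_w (a k (s *: dir i0 w) * a l (t *: dir i0 w)) = s ^+ k * t ^+ l * W.
    by rewrite -(bm_intZ _ bWW); apply: eq_Rintegral => z _; rewrite !aZ; ring.
  have W0 : W = 0.
    have := sphere_sym mth th1 n_gt0 th_inv (ha k) (ha l) q01 q201.
    rewrite !WE -!exprM -!exprD => /eqP; rewrite -subr_eq0 -mulrBl mulf_eq0.
    rewrite subr_eq0 => /orP[|/eqP//].
    have q_inj i j : q ^+ i = q ^+ j -> i = j.
      move=> /(congr1 GRing.inv); rewrite -!exprVn /q invrK => h.
      have : ((2 ^ i)%:R : R) = (2 ^ j)%:R by rewrite !natrX.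
      by move=> /eqP; rewrite eqr_nat eqn_exp2l// => /eqP.
    by move=> /eqP/q_inj; rewrite !mul2n -!addnn -addnA => /addnI/addIn lk; rewrite lk eqxx in kl.
  transitivity ((b2norm (w k))^-1 * (b2norm (w l))^-1 *
     \int[P]_w (a k (r *: dir i0 w) * a l (r *: dir i0 w))).
    have br i : bm (fun w : B_ => a i (r *: dir i0 w)) := bm_sphere mth th1 (ha i) r01.
    rewrite -(bm_intZ _ (bmM (br k) (br l))).
    by apply: eq_Rintegral => z _; rewrite /b; ring.
  by rewrite WE W0 !mulr0.
have [k [l [kl ckl]]] : exists k l : 'I_(#|K|.+1), k != l /\ c (e k) = c (e l).
  apply: contrapT => h.
  have inj : injective (fun k : 'I_(#|K|.+1) => c (e k)).
    by move=> k l ckl; apply/eqP; apply: contrapT => /negP kl; apply: h; exists k, l.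
  by have := leq_card _ inj; rewrite card_ord ltnn.
have := hc (e k) (e l); rewrite !e1 lexx => /(_ isT isT ckl) le1.
have := b2_energy_Re (e k - e l).
rewrite (energy_eq (v := fun x => b k x - b l x)); last first.
  by move=> x xB; rewrite b2B !eE// -rmorphB.
rewrite (energy_orth (hb k) (hb l)) => [|r r01]; last exact: cross.
rewrite !eb -EFinD lee_fin leNgt => /negP; apply.
by apply: (@le_lt_trans _ _ 1); [rewrite expr_le1 ?b2norm_ge0|rewrite ltrDl].
Qed.

Lemma near1_sphere (z : E) m : enorm z = 1 -> unit_ball (near1 m *: z).
Proof.
move=> z1; have /andP[m0 m1] := @near1_itv R m.
by rewrite /unit_ball /= enormZ z1 mulr1 gtr0_norm.
Qed.

Lemma near1_dist (z : E) (d : R) : enorm z = 1 -> 0 < d -> exists N, forall m, (N <= m)%N ->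
  enorm (near1 m *: z - z) < d.
Proof.
move=> z1 d0.
have := pseudometric_normed_Zmodule.cvgr_dist_lt _ _ (@near1_cvg R) _ d0.
move=> [N _ hN]; exists N => m Nm; have := hN m Nm.
move=> h.
have E1 : (near1 m - 1 : R) *: z = near1 m *: z - z.
  rewrite scalerBl.
  rewrite scale1r.
  by [].
by rewrite -E1 enormZ z1 mulr1 distrC.
Qed.

Lemma closure_ball (z : E) : enorm z = 1 -> closure (unit_ball : set E) z.
Proof.
move=> z1 A /nbhs_enorm[d d0 dA]; have [N hN] := near1_dist z1 d0.
exists (near1 N *: z); split; first exact: near1_sphere.
by apply: dA; rewrite enormB hN.
Qed.

(** * Essential spectrum and essential norm *)

Section boundary_extension.
Variable f : E -> R[i].
Hypothesis uf : unif_continuous_on unit_ball f.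
Local Notation F := (ball_ext f).

Let modulus (e d : R) := forall x y, unit_ball x -> unit_ball y -> enorm (x - y) < d ->
  normc (f x - f y) < e.

Lemma boundary_value z : enorm z = 1 -> exists l : R[i], forall e d, 0 < e -> 0 < d ->
  modulus e d -> forall x, unit_ball x -> enorm (x - z) < d -> normc (f x - l) <= e.
Proof.
move=> z1; have zm m := near1_sphere m z1.
have cau (G : {additive R[i] -> R}) : (forall w, `|G w| <= normc w) ->
    cvgn (fun m => G (f (near1 m *: z))).
  move=> Gn; apply: cauchy_real_cvg => e e0; have [d d0 fd] := uf e0.
  have [N hN] := near1_dist z1 (divr_gt0 d0 (ltr0n _ 2)); exists N => k l Nk Nl.
  rewrite -raddfB; apply: le_lt_trans (Gn _) _; apply: fd => //.
  rewrite (_ : _ - _ = (near1 k *: z - z) - (near1 l *: z - z)); last first.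
    by rewrite opprB addrA subrK.
  apply: le_lt_trans (enormD _ _) _; rewrite enormN (splitr d).
  by apply: ltrD; exact: hN.
have cR := cau (Re : {additive R[i] -> R}) (fun w => (ReIm_le_normc w).1).
have cI := cau (Im : {additive R[i] -> R}) (fun w => (ReIm_le_normc w).2).
set a := (fun m => _) in cR; set b := (fun m => _) in cI.
exists (limn a +i* limn b) => e d e0 d0 fd x xB xz; apply/ler_addgt0Pr => h h0.
have h20 : 0 < h / 2 by rewrite divr_gt0.
have [N1 _ hN1] := pseudometric_normed_Zmodule.cvgr_dist_lt _ _ cR _ h20.
have [N2 _ hN2] := pseudometric_normed_Zmodule.cvgr_dist_lt _ _ cI _ h20.
have dx0 : 0 < d - enorm (x - z) by rewrite subr_gt0.
have [N3 hN3] := near1_dist z1 dx0.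
pose m := maxn N1 (maxn N2 N3).
have m1 := hN1 m (leq_maxl _ _).
have m2 := hN2 m (leq_trans (leq_maxl N2 N3) (leq_maxr _ _)).
have m3 := hN3 m (leq_trans (leq_maxr N2 N3) (leq_maxr _ _)).
rewrite (_ : f x - _ = (f x - f (near1 m *: z)) + (f (near1 m *: z) - (limn a +i* limn b))); last first.
  by rewrite addrA subrK.
apply: le_trans (le_normcD _ _) _; apply: lerD.
  apply/ltW/fd => //; rewrite (_ : x - _ = (x - z) - (near1 m *: z - z)); last first.
    by rewrite opprB addrA subrK.
  apply: le_lt_trans (enormD _ _) _; rewrite enormN.
  by move: m3; move: (enorm (x - z)) (enorm _) => p q; lra.
apply: le_trans (normc_le_ReIm _) _; rewrite (splitr h) !raddfB /=.
by rewrite distrC lerD ?(ltW m1)// distrC ltW.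
Qed.

Lemma ball_extP z : enorm z = 1 -> forall e d, 0 < e -> 0 < d ->
  modulus e d -> forall x, unit_ball x -> enorm (x - z) < d -> normc (f x - F z) <= e.
Proof.
move=> z1; have [l hl] := boundary_value z1; suff -> : F z = l by exact: hl.
have PF : ProperFilter (within (unit_ball : set E) (nbhs z)).
  by apply: within_nbhs_proper; exact: closure_ball.
have c : (f y : R[i]^o) @[y --> within (unit_ball : set E) (nbhs z)] --> (l : R[i]^o); last first.
  exact: (cvg_lim (@norm_hausdorff _ R[i]^o) c).
apply/(@pseudometric_normed_Zmodule.cvgrPdist_le _ R[i]^o _ _ _) => e e0.
have eE : e = (Re e)%:C.
  by case: e e0 => p q; rewrite ltcE /= => /andP[/eqP -> _].
have r0 : 0 < Re e by move: e0; rewrite {1}eE ltcR.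
have [d d0 fd] := uf r0.
apply/nbhs_enorm; exists d => // x xz xB.
rewrite distrC eE (_ : `|f x - l| = (normc (f x - l))%:C); last by case: (f x - l).
by rewrite lecR; apply: (hl _ _ r0 d0 fd) => //; rewrite enormB.
Qed.

Lemma ball_ext_near (e : R) : 0 < e -> exists2 d : R, 0 < d & forall z x, enorm z = 1 ->
  unit_ball x -> enorm (x - z) < d -> normc (f x - F z) <= e.
Proof.
by move=> e0; have [d d0 fd] := uf e0; exists d => // z x z1; exact: (ball_extP z1 e0 d0 fd).
Qed.

Lemma ball_ext_rim (e : R) : 0 < e -> exists2 s : R, s < 1 & forall x, unit_ball x ->
  s <= enorm x -> exists2 z, enorm z = 1 & normc (f x - F z) <= e.
Proof.
move=> e0; have [d d0 hd] := ball_ext_near e0.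
pose s := Num.max (1 - d / 2) 2^-1; have s1 : s < 1.
  by rewrite gt_max gtrBl divr_gt0//= invf_lt1// ltr1n.
exists s => // x xB; rewrite ge_max => /andP[xd x2].
have x1 : enorm x < 1 := xB.
have x0 : 0 < enorm x by apply: lt_le_trans x2; rewrite invr_gt0.
have z1 : enorm ((enorm x)^-1 *: x) = 1 by rewrite enormZ gtr0_norm ?invr_gt0// mulVf// gt_eqF.
exists ((enorm x)^-1 *: x) => //; apply: hd => //.
rewrite -{1}[x]scale1r -scalerBl enormZ -[X in _ * X]gtr0_norm// -normrM mulrBl mul1r.
rewrite mulVf ?gt_eqF// distrC ger0_norm ?subr_ge0 ?(ltW x1)//.
by lra.
Qed.

Lemma ball_ext_unif (e : R) : 0 < e -> exists2 d : R, 0 < d & forall z z', enorm z = 1 ->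
  enorm z' = 1 -> enorm (z - z') < d -> normc (F z - F z') <= e.
Proof.
move=> e0; have e20 : 0 < e / 2 by rewrite divr_gt0.
have [d d0 hd] := ball_ext_near e20; exists d => // z z' z1 z1' zz.
have dz : 0 < d - enorm (z - z') by rewrite subr_gt0.
have [N hN] := near1_dist z1 dz; pose x := near1 N *: z.
have xB : unit_ball x by exact: near1_sphere.
have xz : enorm (x - z) < d - enorm (z - z') := hN N (leqnn N).
have h1 : normc (f x - F z) <= e / 2.
  by apply: hd => //; apply: lt_le_trans xz _; rewrite gerBl enorm_ge0.
have h2 : normc (f x - F z') <= e / 2.
  apply: hd => //; rewrite (_ : x - z' = (x - z) + (z - z')); last by rewrite addrA subrK.
  by apply: le_lt_trans (enormD _ _) _; rewrite -ltrBrDr.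
rewrite (_ : F z - F z' = (f x - F z') - (f x - F z)); last by rewrite opprB [RHS]addrC subrKA.
by rewrite -normcN opprB in h1; apply: le_trans (le_normcD _ _) _;
  rewrite opprB (splitr e); exact: lerD.
Qed.

Lemma ball_ext_avoid l : (forall z, enorm z = 1 -> F z <> l) ->
  exists2 r : R, 0 < r & forall z, enorm z = 1 -> r <= normc (F z - l).
Proof.
move=> Fl; have /compact_near_coveringP cS := @compact_sphere R n 1.
have [|N _ hN] := cS nat (\oo) (fun m z => enorm z = 1 -> m.+1%:R^-1 <= normc (F z - l)) _.
  move=> z /= z1; pose r := normc (F z - l).
  have r0 : 0 < r.
    rewrite lt0r normc_ge0 andbT; apply/eqP => /eq0_normc/eqP.
    by rewrite subr_eq0 => /eqP; exact: Fl.
  have r20 : 0 < r / 2 by rewrite divr_gt0.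
  have [d d0 hd] := ball_ext_unif r20; pose N := Num.truncn (r / 2)^-1.
  exists ([set z' | enorm (z - z') < d], [set m | (N <= m)%N]).
    by split; [apply/nbhs_enorm; exists d|exists N].
  move=> [z' m] /= [zz Nm] z1'; apply: (@le_trans _ _ (r / 2)).
    rewrite invf_ple ?posrE ?ltr0n//; apply: (le_trans (ltW (truncnS_gt _))).
    by rewrite ler_nat ltnS.
  have := hd z z' z1 z1' zz.
  have : r <= normc (F z - F z') + normc (F z' - l).
    by apply: le_trans (le_normcD _ _); rewrite addrA subrK.
  by move: (normc _) (normc _) => p q; lra.
exists N.+1%:R^-1 => [|z z1]; first by rewrite invr_gt0 ltr0n.
exact: (hN N (leqnn N) z z1 z1).
Qed.

End boundary_extension.

Definition tent (z : E) (d : R) (x : E) : R := Num.max 0 (1 - enorm (x - z) / d).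

Lemma max0_dist (a b : R) : `|Num.max 0 a - Num.max 0 b| <= `|a - b|.
Proof.
have [a0|a0] := leP 0 a; have [b0|b0] := leP 0 b; rewrite ?subr0 ?sub0r ?subrr ?normrN ?normr0//.
  by rewrite ger0_norm// (le_trans _ (ler_norm _))// lerDl oppr_ge0 ltW.
by rewrite ger0_norm// distrC (le_trans _ (ler_norm _))// lerDl oppr_ge0 ltW.
Qed.

Lemma tent_unif z d : 0 < d -> ball_unif (tent z d).
Proof.
move=> d0 e e0; exists (e * d) => [|x y _ _ xy]; first exact: mulr_gt0.
apply: le_lt_trans (max0_dist _ _) _.
rewrite (_ : _ - _ = (enorm (y - z) - enorm (x - z)) / d); last by ring.
rewrite normrM normfV (gtr0_norm d0) ltr_pdivrMr//; apply: le_lt_trans (enorm_dist _ _) _.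
by rewrite opprB addrA subrK enormB.
Qed.

Lemma tent_itv z d x : 0 < d -> 0 <= tent z d x <= 1.
Proof.
move=> d0; rewrite /tent le_max lexx /= ge_max ler01 /= gerBl.
by rewrite divr_ge0 ?enorm_ge0// ltW.
Qed.

Lemma tent_out z d x : 0 < d -> d <= enorm (x - z) -> tent z d x = 0.
Proof. by move=> d0 h; rewrite /tent max_l// subr_le0 ler_pdivlMr// mul1r. Qed.

Lemma tent_in z d x : 0 < d -> enorm (x - z) < d / 2 -> 2^-1 <= tent z d x.
Proof.
move=> d0 h; rewrite /tent le_max; apply/orP; right.
have : enorm (x - z) / d <= 2^-1 by rewrite ler_pdivrMr// mulrC ltW.
by lra.
Qed.

Section boundary_behaviour.
Hypothesis n_gt1 : (1 < n)%N.

Lemma tent_not_small z d p (c : R) : enorm z = 1 -> 0 < d -> 0 < c -> tb p ->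
  (forall u : b2, c * nrm (fun x => (tent z d x)%:C * u x) <= p u) -> False.
Proof.
move=> z1 d0 c0 tp hp; have mt := ball_unif_mult (tent_unif z d0).
have st : small (fun x => (tent z d x)%:C).
  split=> //; apply: (tb_dom (C := c^-1) _ _ tp) => [|u]; first by rewrite invr_ge0 ltW.
  by rewrite ler_pdivlMl.
apply: (not_tb_norm n_gt1); apply: (tb_norm_of_bump z1 (divr_gt0 d0 (ltr0n _ 2))).
apply: (small_dom (mult_bump z (d / 2)) st (ler0n _ 2)) => x xB.
have [h|h] := pselect (enorm (x - z) < d / 2); last first.
  by rewrite bump_out// normc0 mulr_ge0// normc_ge0.
rewrite bump_in// normcR ger0_norm; last by case/andP: (tent_itv z x d0).
have := tent_in d0 h; rewrite (_ : normc 1 = 1 :> R); last by rewrite -[1]/(1%:C) normcR normr1.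
by lra.
Qed.

Lemma tent_split z d (u : b2) : 0 < d ->
  let h x := (tent z d x)%:C in
  [/\ b2norm (T_ h u) <= nrm (fun x => h x * u x),
      nrm (fun x => h x * u x) <= hank h u + b2norm (T_ h u) &
      forall g M, mult g -> 0 <= M -> (forall x, unit_ball x -> normc (g x) <= M) ->
        nrm (fun x => g x * (h x * u x) - g x * T_ h u x) <= M * hank h u].
Proof.
move=> d0 h; have mt : mult h := ball_unif_mult (tent_unif z d0).
split.
- exact: orthoproj_le (L2_mul u mt).
- rewrite (_ : (fun x => _) = (fun x => (h x * u x - T_ h u x) + T_ h u x)); last first.
    by apply/funext => x; rewrite subrK.
  exact: (nrmD (L2_res u mt) (L2ball_b2 _).1).
move=> g M mg M0 gM.
have rB : L2ball nu (fun x => h x * u x - T_ h u x).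
  by apply: L2ball_B; [exact: L2ball_mul (L2ball_b2 u)|exact: L2ball_b2].
rewrite (_ : (fun x => _) = (fun x => g x * (h x * u x - T_ h u x))); last first.
  by apply/funext => x; rewrite mulrBr.
apply: nrm_domB => //; first exact: L2ball_mul.
by move=> x xB; rewrite normcM ler_wpM2r ?normc_ge0// gM.
Qed.

Lemma bounded_of_unit (A : b2 -> b2) C : linear A ->
  (forall u, b2norm u <= 1 -> b2norm (A u) <= C) -> forall u, b2norm (A u) <= C * b2norm u.
Proof.
move=> lA AC u; have [u0|u0] := eqVneq (b2norm u) 0.
  by rewrite u0 (b2norm_eq0 u0) linear0b// b2norm0 mulr0.
have up : 0 < b2norm u by rewrite lt0r u0 b2norm_ge0.
have := AC ((b2norm u)^-1%:C *: u); rewrite b2normZ normcR gtr0_norm ?invr_gt0//.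
rewrite mulVf// lexx => /(_ isT).
rewrite -[X in A X]addr0 lA linear0b// addr0 b2normZ normcR gtr0_norm ?invr_gt0//.
by rewrite ler_pdivrMl// mulrC.
Qed.

Lemma compact_bounded (A : b2 -> b2) : compact_operator A -> bounded_operator A.
Proof.
move=> [lA cA]; split=> //; move: cA; rewrite precompactE => cA.
have [s hs] := compact_finite_net cA ltr01.
exists (1 + \sum_(y <- s) b2norm y); apply: bounded_of_unit => // u u1.
have uS : closure [set A u | u in [set u | b2norm u <= 1]] (A u).
  by apply: subset_closure; exists u.
have [y ys yu] := hs _ uS.
rewrite -[A u](subKr y); apply: le_trans (b2normB _ _) _; rewrite addrC.
apply: lerD; first exact: ltW.
by rewrite (big_rem y)//= lerDl sumr_ge0// => w _; exact: b2norm_ge0.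
Qed.

Lemma op_norm_le (A : b2 -> b2) C : (forall u, b2norm u <= 1 -> b2norm (A u) <= C) ->
  op_norm A <= C.
Proof.
move=> AC; apply: ge_sup; first by exists (b2norm (A 0)), 0 => //=; rewrite b2norm0.
by move=> _ [u u1 <-]; exact: AC.
Qed.

Lemma op_normP (A : b2 -> b2) u : bounded_operator A -> b2norm (A u) <= op_norm A * b2norm u.
Proof.
move=> [lA [M AM]]; apply: bounded_of_unit => // v v1; apply: ub_le_sup; last by exists v.
exists `|M| => _ [w w1 <-]; apply: le_trans (AM w) _.
apply: le_trans (ler_wpM2r (b2norm_ge0 w) (ler_norm M)) _.
by rewrite ler_piMr.
Qed.

Lemma op_norm_ge0 (A : b2 -> b2) : bounded_operator A -> 0 <= op_norm A.
Proof.
move=> [lA [M AM]]; apply: le_trans (b2norm_ge0 (A 0)) _; apply: ub_le_sup.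
  exists `|M| => _ [w w1 <-]; apply: le_trans (AM w) _.
  apply: le_trans (ler_wpM2r (b2norm_ge0 w) (ler_norm M)) _.
  by rewrite ler_piMr.
by exists 0 => //=; rewrite b2norm0.
Qed.

Section symbol.
Variable f : E -> R[i].
Hypothesis uf : unif_continuous_on unit_ball f.
Local Notation F := (ball_ext f).

Let mf : mult f := (esscomm_unif_continuous uf).1.

Lemma unif_sub_cst l : unif_continuous_on unit_ball (fun x => f x - l).
Proof.
move=> e e0; have [d d0 fd] := uf e0; exists d => // x y xB yB xy.
by rewrite (_ : _ - _ = f x - f y); [exact: fd|ring].
Qed.

Lemma unif_conj (g : E -> R[i]) : unif_continuous_on unit_ball g ->
  unif_continuous_on unit_ball (fun x => conjc (g x)).
Proof.
move=> ug e e0; have [d d0 gd] := ug e e0; exists d => // x y xB yB xy.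
rewrite -rmorphB (_ : normc (conjc _) = normc (g x - g y)); first exact: gd.
by case: (g x - g y) => a b /=; rewrite sqrrN.
Qed.

Lemma toeplitz_sub_cst l u : T_ f u - l *: u = T_ (fun x => f x - l) u.
Proof.
rewrite (_ : T_ (fun x => f x - l) u = oproj (fun x => - l * u x + f x * u x)).
  by rewrite (orthoprojZD _ (L2ball_b2 u).1 (L2_mul u mf)) orthoproj_id scaleNr addrC.
by congr oproj; apply/funext => x; ring.
Qed.

Lemma ball_ext_bounded : exists2 M : R, 0 <= M & forall z, enorm z = 1 -> normc (F z) <= M.
Proof.
have [M M0 fM] := mult_bound mf; exists (M + 1) => [|z z1]; first by rewrite addr_ge0// ltW.
have [d d0 hd] := ball_ext_near uf ltr01; have [N hN] := near1_dist z1 d0.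
have xB := near1_sphere N z1; have := hd z _ z1 xB (hN N (leqnn N)).
rewrite -normcN opprB => h.
rewrite (_ : F z = f (near1 N *: z) + (F z - f (near1 N *: z))); last first.
  by rewrite addrC subrK.
by apply: le_trans (le_normcD _ _) _; apply: lerD => //; exact: fM.
Qed.

Lemma toeplitz_compactP : compact_operator (T_ f) <-> forall z, enorm z = 1 -> F z = 0.
Proof.
split=> [cT z z1|F0].
  apply: contrapT => Fz; pose r := normc (F z).
  have r0 : 0 < r by rewrite lt0r normc_ge0 andbT; apply/eqP => /eq0_normc.
  have r20 : 0 < r / 2 by rewrite divr_gt0.
  have [d d0 hd] := ball_ext_near uf r20.
  apply: (tent_not_small z1 d0 r20 (tb_add (tb_of_compact cT) (esscomm_unif_continuous uf).2)) => u.
  pose h x := (tent z d x)%:C; have mt : mult h := ball_unif_mult (tent_unif z d0).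
  apply: (@le_trans _ _ (nrm (fun x => f x * u x))).
    rewrite -(gtr0_norm r20) -normcR -nrmZ; last exact: L2_mul.
    have hB := L2ball_mul mt (L2ball_b2 u); have fB := L2ball_mul mf (L2ball_b2 u).
    rewrite -[leRHS]mul1r; apply: nrm_domB => //.
      exact: (L2ball_mul (mult_cst (r / 2)%:C) hB).
    move=> x xB; rewrite !normcM mul1r !normcR (gtr0_norm r20) mulrA.
    apply: ler_wpM2r; first exact: normc_ge0.
    have /andP[t0 t1] := tent_itv z x d0; rewrite ger0_norm//.
    have [h1|h1] := ltP (enorm (x - z)) d; last by rewrite tent_out// mulr0 normc_ge0.
    have := hd z x z1 xB h1; rewrite -normcN opprB => h2.
    have := le_normcD (F z - f x) (f x); rewrite subrK -/r => h3.
    apply: le_trans (ler_piMr (ltW r20) t1) _.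
    by move: h2 h3; move: (normc _) (normc _) => p q; lra.
  rewrite (_ : (fun x => _) = (fun x => T_ f u x + (f x * u x - T_ f u x))); last first.
    by apply/funext => x; rewrite addrC subrK.
  exact: (nrmD (L2ball_b2 _).1 (L2_res u mf)).
apply: compact_of_tb; first exact: toeplitz_linear.
have vf : vanishes_at_boundary f.
  move=> e e0; have [s s1 hs] := ball_ext_rim uf e0; exists s => // x xB sx.
  by have [z z1] := hs x xB sx; rewrite F0// subr0.
by apply: tb_le (tb_vanishing mf vf) => u; exact: orthoproj_le (L2_mul u mf).
Qed.

(* If S inverts T_f - F z modulo compacts, then for the tent h at z the norm of
   v = T_h u is at most M1 |(T_f - F z) v| up to a compact term, and |f - F z| is
   small where h does not vanish, so T_h would be small modulo compacts. *)
Lemma spectrum_sup z : enorm z = 1 -> essential_spectrum (T_ f) (F z).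
Proof.
move=> z1 [S [[lS [M SM]] _ cSA]].
pose l := F z; pose g x := f x - l; have ug := unif_sub_cst l.
have [mg tg] := esscomm_unif_continuous ug.
pose M1 := `|M| + 1; have M10 : 0 < M1 by rewrite ltr_wpDl.
have [Mg Mg0 gM] := mult_bound mg.
have e0 : 0 < 2^-1 / M1 by rewrite divr_gt0 ?invr_gt0.
have [d d0 hd] := ball_ext_near uf e0.
pose h x := (tent z d x)%:C; have [mt tt] : esscomm h := realess_ball_unif (tent_unif z d0).
pose A u := T_ f u - l *: u.
have tK := tb_comp (toeplitz_bounded mt) (tb_of_compact cSA).
have C0 : 0 <= 1 + M1 * Mg by rewrite addr_ge0// mulr_ge0// ltW.
have t1 : tb (fun u => (1 + M1 * Mg) * hank h u) by apply: (tb_dom C0 _ tt).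
apply: (tent_not_small z1 d0 _ (tb_add t1 tK) (c := 2^-1)); first by rewrite invr_gt0.
move=> u; rewrite -/h; have [_ h2 h3] := tent_split z u d0.
set v := T_ h u in h2 h3 *.
have SA : b2norm v <= M1 * b2norm (A v) + b2norm ((S \o A) v - v).
  rewrite -{1}[v](subKr (S (A v))); apply: le_trans (b2normB _ _) _; apply: lerD => //.
  apply: le_trans (SM _) _; apply: ler_wpM2r; first exact: b2norm_ge0.
  by rewrite (le_trans (ler_norm M))// lerDl.
have hB : L2ball nu (fun x => h x * u x) := L2ball_mul mt (L2ball_b2 u).
have ghB := L2ball_mul mg hB; have gvB := L2ball_mul mg (L2ball_b2 v).
have Av : b2norm (A v) <= 2^-1 / M1 * nrm (fun x => h x * u x) + Mg * hank h u.
  rewrite /A toeplitz_sub_cst; apply: le_trans (orthoproj_le gvB.1) _.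
  rewrite (_ : (fun x => _ * v x) =
    (fun x => g x * (h x * u x) - (g x * (h x * u x) - g x * v x))); last first.
    by apply/funext => x; rewrite subKr.
  apply: le_trans (nrmB ghB.1 (L2B ghB.1 gvB.1)) _; apply: lerD.
    apply: nrm_domB => //; first exact: ltW.
    move=> x xB; rewrite !normcM.
    have [h1|h1] := ltP (enorm (x - z)) d.
      by apply: ler_wpM2r; [rewrite mulr_ge0 ?normc_ge0|exact: (hd z x z1 xB h1)].
    by rewrite /h tent_out// normc0 mul0r !mulr0.
  by apply: h3 => //; exact: ltW.
have := ler_wpM2l (ltW M10) Av; rewrite mulrDr mulrA.
rewrite (_ : M1 * (2^-1 / M1) = 2^-1); last by field; exact: lt0r_neq0.
move: SA h2.
rewrite -[hank (fun x => _) u]/(hank h u) -[nrm (fun x => _ * u x)]/(nrm (fun x => h x * u x)).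
rewrite -[(S \o _) v - v]/((S \o A) v - v).
move: (b2norm ((S \o A) v - v)) (M1 * b2norm (A v)) (b2norm v) => r s t.
by move: (nrm _) (hank h u) => p q; lra.
Qed.

Lemma spectrum_sub l : (forall z, enorm z = 1 -> F z <> l) ->
  calkin_invertible (fun u => T_ f u - l *: u).
Proof.
move=> Fl; have [r r0 hr] := ball_ext_avoid uf Fl; pose c := r / 2.
have c0 : 0 < c by rewrite divr_gt0.
have [s s1 hs] := ball_ext_rim uf c0.
pose g x := f x - l; have ug := unif_sub_cst l.
have eg : esscomm g := esscomm_unif_continuous ug; have mg := eg.1.
have gc x : unit_ball x -> s <= enorm x -> c <= normc (g x).
  move=> xB sx; have [z z1] := hs x xB sx; rewrite -normcN opprB => h1.
  have := hr z z1; have := le_normcD (F z - f x) (f x - l); rewrite addrA subrK -/(g x).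
  by move: h1; rewrite /c; move: (normc _) (normc _) (normc _) => p q w; lra.
pose m x := Num.max (normc (g x)) c.
have mc x : c <= m x by rewrite le_max lexx orbT.
have m0 x : 0 < m x by exact: lt_le_trans (mc x).
have um : ball_unif (fun x => (m x)^-1).
  move=> e e0; have [|d d0 gd] := ug (e * c ^+ 2); first by rewrite mulr_gt0// exprn_gt0.
  exists d => // x y xB yB xy.
  rewrite (_ : _ - _ = (m y - m x) / (m x * m y)); last first.
    by field; rewrite !gt_eqF.
  rewrite normrM normfV (gtr0_norm (mulr_gt0 (m0 x) (m0 y))) ltr_pdivrMr ?mulr_gt0//.
  have dm : `|m y - m x| <= normc (g x - g y).
    have tri (p q : R[i]) : normc p - normc q <= normc (p - q).
      by rewrite lerBlDr; apply: le_trans _ (le_normcD _ _); rewrite subrK.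
    have t1 := tri (g x) (g y); have t2 := tri (g y) (g x).
    rewrite -(normcN (g y - g x)) opprB in t2; rewrite /m.
    by have [? | ?] := leP (normc (g x)) c; have [? | ?] := leP (normc (g y)) c;
      rewrite ler_norml; apply/andP; split; move: (normc_ge0 (g x - g y)); lra.
  apply: (le_lt_trans dm); apply: lt_le_trans (gd x y xB yB xy) _.
  rewrite ler_pM2l// expr2; apply: ler_pM => //; exact: ltW.
pose q x := conjc (g x) * ((m x)^-1%:C * (m x)^-1%:C).
have mq : mult q.
  have mi := ball_unif_mult um.
  exact: (multM (mult_conj mg) (multM mi mi)).
pose k x := q x * g x - 1.
have mk : mult k := multB (multM mq mg) (mult_cst 1).
have k0 : vanishes_at_boundary k.
  move=> e e0; exists s => // x xB sx; have cg := gc x xB sx.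
  have g0 : 0 < normc (g x) by exact: lt_le_trans cg.
  rewrite (_ : k x = 0) ?normc0 ?ltW//; rewrite /k /q /m max_l//.
  have E1 : conjc (g x) * g x = (normc (g x) ^+ 2)%:C.
    by rewrite normc_sqr; case: (g x) => a b; simpc; congr (_ +i* _); rewrite /rdot /=; ring.
  rewrite mulrAC E1 -!rmorphM -(rmorphB _) (_ : _ - 1 = 0) ?rmorph0//.
  by field; rewrite gt_eqF.
have tk := tb_vanishing mk k0.
have Tk u : b2norm (T_ (fun x => q x * g x) u - u) <= nrm (fun x => k x * u x).
  rewrite -{2}(orthoproj_id u) -orthoprojB; [|exact: (L2_mul u (multM mq mg))|exact: (L2ball_b2 u).1].
  rewrite (_ : (fun x => _) = (fun x => k x * u x)); last first.
    by apply/funext => x; rewrite /k mulrBl mul1r.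
  exact: orthoproj_le (L2_mul u mk).
have ecg : esscomm (fun x => conjc (g x)) := esscomm_unif_continuous (unif_conj ug).
have lA : linear (fun u => T_ f u - l *: u).
  move=> a u v; rewrite !toeplitz_sub_cst; exact: (toeplitz_linear mg).
exists (T_ q); split; first exact: (toeplitz_bounded mq).
  apply: compact_of_tb.
    by apply: linear_sub => // a u v; rewrite /= (toeplitz_linear mq) lA.
  apply: tb_le (tb_add (toeplitz_mull mq mg ecg) tk) => u /=.
  rewrite [X in X - u](toeplitz_sub_cst l (T_ q u)) -/g.
  have -> : T_ g (T_ q u) - u = (T_ (fun x => q x * g x) u - u) -
     (T_ (fun x => q x * g x) u - T_ g (T_ q u)).
    by rewrite opprB [RHS]addrC addrA subrK.
  by apply: le_trans (b2normB _ _) _; rewrite addrC; apply: lerD.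
apply: compact_of_tb.
  by apply: linear_sub => // a u v; rewrite /= lA (toeplitz_linear mq).
apply: tb_le (tb_add (toeplitz_mulr mq eg) tk) => u /=.
rewrite [X in T_ q X](toeplitz_sub_cst l u) -/g.
have -> : T_ q (T_ g u) - u = (T_ (fun x => q x * g x) u - u) -
   (T_ (fun x => q x * g x) u - T_ q (T_ g u)).
  by rewrite opprB [RHS]addrC addrA subrK.
by apply: le_trans (b2normB _ _) _; rewrite addrC; apply: lerD.
Qed.

Lemma op_norm_lower (K : b2 -> b2) z : enorm z = 1 -> compact_operator K ->
  normc (F z) <= op_norm (fun u => T_ f u + K u).
Proof.
move=> z1 cK; have [mf' tf] := esscomm_unif_continuous uf.
have bA : bounded_operator (fun u => T_ f u + K u).
  have [lT [M TM]] := toeplitz_bounded mf; have [lK [N KN]] := compact_bounded cK.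
  split; first by move=> a u v; rewrite lT lK scalerDr addrACA.
  exists (M + N) => u; apply: le_trans (b2normD _ _) _.
  by rewrite mulrDl; exact: lerD.
set N := op_norm _; rewrite leNgt; apply/negP => NF.
pose L := normc (F z); pose c := (L - N) / 2.
have c0 : 0 < c by rewrite divr_gt0// subr_gt0.
have N0 : 0 <= N by exact: op_norm_ge0.
have [d d0 hd] := ball_ext_near uf c0.
have [M M0 fM] := mult_bound mf.
pose h x := (tent z d x)%:C; have [mt tt] : esscomm h := realess_ball_unif (tent_unif z d0).
have bh := toeplitz_bounded mt.
have t1 : tb (fun u => M * hank h u) by apply: (tb_dom (ltW M0) _ tt).
apply: (tent_not_small z1 d0 c0 (tb_add t1 (tb_add (tb_comp bh (tb_of_compact cK)) (tb_comp bh tf)))).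
move=> u; rewrite -/h; have [h1 h2 h3] := tent_split z u d0.
set v := T_ h u in h1 h2 h3 *.
have hB : L2ball nu (fun x => h x * u x) := L2ball_mul mt (L2ball_b2 u).
have fhB := L2ball_mul mf hB; have fvB := L2ball_mul mf (L2ball_b2 v).
have a1 : (L - c) * nrm (fun x => h x * u x) <= nrm (fun x => f x * (h x * u x)).
  have Lc : 0 <= L - c by rewrite /c; move: N0 NF; rewrite -/L; lra.
  rewrite -{1}(ger0_norm Lc) -normcR -nrmZ; last exact: hB.1.
  rewrite -[leRHS]mul1r; apply: nrm_domB => //.
    exact: (L2ball_mul (mult_cst (L - c)%:C) hB).
  move=> x xB; rewrite mul1r [leLHS]normcM [leRHS]normcM normcR (ger0_norm Lc).
  have [x1|x1] := ltP (enorm (x - z)) d; last first.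
    by rewrite /h tent_out// mul0r normc0 !mulr0.
  apply: ler_wpM2r; first exact: normc_ge0.
  have := hd z x z1 xB x1; rewrite -normcN opprB => x2.
  have := le_normcD (F z - f x) (f x); rewrite subrK -/L => x3.
  by move: x2 x3; move: (normc _) (normc _) => p q; lra.
have a2 : nrm (fun x => f x * (h x * u x)) <= M * hank h u + nrm (fun x => f x * v x).
  rewrite (_ : (fun x => _) = (fun x => (f x * (h x * u x) - f x * v x) + f x * v x)); last first.
    by apply/funext => x; rewrite subrK.
  apply: le_trans (nrmD (L2B fhB.1 fvB.1) fvB.1) _; rewrite lerD2r.
  by apply: h3 => //; exact: ltW.
have a3 : nrm (fun x => f x * v x) <= hank f v + b2norm (T_ f v).
  rewrite (_ : (fun x => _) = (fun x => (f x * v x - T_ f v x) + T_ f v x)); last first.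
    by apply/funext => x; rewrite subrK.
  exact: (nrmD (L2_res v mf) (L2ball_b2 _).1).
have a4 : b2norm (T_ f v) <= N * b2norm v + b2norm (K v).
  rewrite -[T_ f v](addrK (K v)); apply: le_trans (b2normB _ _) _; rewrite lerD2r.
  exact: (@op_normP (fun u => T_ f u + K u) v bA).
have a5 := ler_wpM2l N0 h1.
have cE : L = N + c + c by rewrite /c -addrA -splitr addrC subrK.
move: a1; rewrite cE; move: a2 a3 a4 a5; rewrite -/v.
move: (M * hank h u) (hank f v) (b2norm (T_ f v)) (b2norm v) (b2norm (K v)) => q1 q2 q3 q4 q5.
move: (nrm (fun x => f x * (h x * u x))) (nrm (fun x => f x * v x)) => p1 p2.
move: (nrm _) => p; rewrite addrK mulrDl; lra.
Qed.

Lemma essential_normE : essential_norm (T_ f) = sup [set normc (F z) | z in unit_sphere].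
Proof.
have [M M0 FM] := ball_ext_bounded; pose i1 := Ordinal n_gt0.
have e1 : enorm (delta_mx ord0 i1 : E) = 1 by exact: enorm_delta.
have ub : has_ubound [set normc (F z) | z in unit_sphere].
  by exists M => _ [z z1 <-]; exact: FM.
have c0 : compact_operator (fun _ : b2 => 0 : b2).
  apply: compact_of_tb; first by move=> a u v; rewrite scaler0 addr0.
  by apply: tb_le tb0 => u; rewrite b2norm0.
have ne : [set op_norm (fun u => T_ f u + K u) | K in @compact_operator R n nu] !=set0.
  by exists (op_norm (fun u => T_ f u + 0)), (fun=> 0).
have low K : compact_operator K -> sup [set normc (F z) | z in unit_sphere] <=
    op_norm (fun u => T_ f u + K u).
  move=> cK; apply: ge_sup; first by exists (normc (F (delta_mx ord0 i1))), (delta_mx ord0 i1).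
  by move=> _ [z z1 <-]; exact: op_norm_lower.
apply/eqP; rewrite eq_le; apply/andP; split; last first.
  by apply: lb_le_inf => // _ [K cK <-]; exact: low.
apply/ler_addgt0Pr => e e0; set S := sup _.
have FS z : enorm z = 1 -> normc (F z) <= S by move=> z1; apply: ub_le_sup => //; exists z.
have [s s1 hs] := ball_ext_rim uf e0.
pose chi x : R[i] := (\1_[set y : E | enorm y < s] x : R)%:C.
have mchi : mult chi.
  apply: mult_indic; apply: measurable_open.
  rewrite (_ : mkset _ = (@enorm R n) @^-1` [set r | r < s])//.
  by apply: open_comp => [? _|]; [exact: continuous_enorm|exact: open_lt].
have chi_in x : enorm x < s -> chi x = 1 by move=> h; rewrite /chi indicE mem_set.
have chi_out x : s <= enorm x -> chi x = 0.
  by move=> h; rewrite /chi indicE memNset//= => h'; move: h; rewrite leNgt h'.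
pose k x := -1 * (chi x * f x); have mk : mult k := multZ (-1) (multM mchi mf).
have vk : vanishes_at_boundary k.
  move=> r r0; exists s => // x xB sx.
  by rewrite /k chi_out// mul0r mulr0 normc0 ltW.
have ck : compact_operator (T_ k).
  apply: compact_of_tb; first exact: toeplitz_linear.
  by apply: tb_le (tb_vanishing mk vk) => u; exact: orthoproj_le (L2_mul u mk).
apply: (@le_trans _ _ (op_norm (fun u => T_ f u + T_ k u))).
  apply: ge_inf; last by exists (T_ k).
  by exists S => _ [K cK <-]; exact: low.
have S0 : 0 <= S + e.
  by rewrite addr_ge0 ?(ltW e0)//; apply: le_trans (FS _ e1); exact: normc_ge0.
apply: op_norm_le => u u1.
rewrite (_ : T_ f u + T_ k u = oproj (fun x => (f x + k x) * u x)); last first.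
  rewrite -[T_ f u]scale1r -orthoprojZD; [|exact: L2_mul|exact: L2_mul].
  by congr oproj; apply/funext => x; rewrite mul1r mulrDl.
apply: le_trans (orthoproj_le (L2_mul u (multD mf mk))) _.
apply: le_trans (nrm_mul u (multD mf mk) S0 _) _; last by rewrite ler_piMr.
move=> x xB; have [xs|xs] := ltP (enorm x) s.
  by rewrite /k chi_in// mul1r mulN1r subrr normc0.
rewrite /k chi_out// mul0r mulr0 addr0; have [z z1 fz] := hs x xB xs.
rewrite -[f x](subrK (F z)) addrC; apply: le_trans (le_normcD _ _) _.
by apply: lerD => //; exact: FS.
Qed.

End symbol.

End boundary_behaviour.

End bergman_geometry.

Theorem corollary3p2 (R : realType) (n : nat) (hn : (2 <= n)%N)
    (nu : probability (borel_rV R n) R)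
    (nu_ball : carried_by_ball nu)
    (nu_regular : regular_on_ball nu)
    (nu_invariant : orthogonal_invariant nu)
    (nu_boundary : charges_boundary nu)
    (f g : 'rV[R]_n -> R[i])
    (f_unif : unif_continuous_on unit_ball f)
    (g_meas : cmeasurable_on unit_ball g)
    (g_bounded : bounded_on unit_ball g) :
  let T := toeplitz nu in
  let gf := fun x => g x * f x in
  compact_operator (fun u => T gf u - T g (T f u)) /\
  compact_operator (fun u => T gf u - T f (T g u)) /\
  essential_spectrum (T f) = [set ball_ext f z | z in unit_sphere] /\
  essential_norm (T f) = sup [set normc (ball_ext f z) | z in unit_sphere] /\
  (compact_operator (T f) <-> forall z, unit_sphere z -> ball_ext f z = 0).
Proof.
move=> T gf; have n0 : (0 < n)%N by exact: leq_trans hn.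
have mg : mult g by split.
have ef := esscomm_unif_continuous n0 nu_invariant nu_boundary f_unif; have mf := ef.1.
have ecf := esscomm_unif_continuous n0 nu_invariant nu_boundary (unif_conj f_unif).
have lT h (mh : mult h) := toeplitz_linear n0 nu_invariant nu_boundary mh.
split; [|split; [|split; [|split]]].
- apply: (compact_of_tb n0 nu_invariant nu_boundary).
    exact: linear_sub (lT _ (multM mg mf)) (linear_comp (lT _ mg) (lT _ mf)).
  exact: (toeplitz_mulr n0 nu_invariant nu_boundary mg ef).
- apply: (compact_of_tb n0 nu_invariant nu_boundary).
    exact: linear_sub (lT _ (multM mg mf)) (linear_comp (lT _ mf) (lT _ mg)).
  exact: (toeplitz_mull n0 nu_invariant nu_boundary mg mf ecf).
- apply/seteqP; split=> [l lE|_ [z z1 <-]]; last first.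
    exact: (spectrum_sup n0 nu_invariant nu_boundary hn f_unif z1).
  apply: contrapT => nF; apply: lE.
  apply: (spectrum_sub n0 nu_invariant nu_boundary f_unif) => z z1 Fz.
  by apply: nF; exists z.
- exact: (essential_normE n0 nu_invariant nu_boundary hn f_unif).
- exact: (toeplitz_compactP n0 nu_invariant nu_boundary hn f_unif).
Qed.
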